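(* Let $\alpha$ be a positive irrational and let $\operatorname{Aut}(\mathcal A_\alpha)$ denote the group of isometric automorphisms of $\mathcal A_\alpha$. If $\alpha$ is not a quadratic irrational, then $\operatorname{Aut}(\mathcal A_\alpha)=\{\pi(\mathbf c):\mathbf c\in\mathbb T^2\}\cong\mathbb T^2$. If $\alpha$ is a quadratic irrational, then $\operatorname{Aut}(\mathcal A_\alpha)=\{\pi(\mathbf c)\pi(A)^k:\mathbf c\in\mathbb T^2,k\in\mathbb Z\}\cong\mathbb T^2\rtimes_{\psi_A}\mathbb Z$ for some non-identity matrix $A\in GL(2,\mathbb Z)$.
   Context: For $f\in C(\mathbb T^2)$ (with $\mathbb T$ the unit circle), the Fourier transform is $\hat f(m,n)=\int_{\mathbb T^2} f(e^{is},e^{it})e^{-i(ms+nt)}\,d\mu$, $\mu$ normalized Lebesgue measure. For a positive irrational $\alpha$, $\mathcal A_\alpha=\{f\in C(\mathbb T^2): \hat f(m,n)=0 \text{ whenever } m+\alpha n<0\}$, a uniform algebra with the sup norm on $\mathbb T^2$. For $(c_1,c_2)\in\mathbb T^2$, $\pi((c_1,c_2))(f)(z,w)=f(c_1z,c_2w)$. For $A=\begin{bmatrix} a&b\\ c&d\end{bmatrix}\in GL(2,\mathbb Z)$, $\pi(A)(f)=f\circ\varphi$ with $\varphi(z,w)=(z^aw^b,z^cw^d)$, and $\psi_A:\mathbb T^2\to\mathbb T^2$ is $\psi_A(c_1,c_2)=(c_1^ac_2^b,c_1^cc_2^d)$. The semidirect product $\mathbb T^2\rtimes_{\psi_A}\mathbb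 Z$ has multiplication $(\mathbf c,m)\cdot(\mathbf d,n)=(\mathbf c\,\psi_A^m(\mathbf d),m+n)$. *)

(* Defs.v *)
From Stdlib Require Import Reals ZArith.
Open Scope R_scope.

Definition C := (R * R)%type.
Definition Cadd (x y : C) : C := (fst x + fst y, snd x + snd y).
Definition Copp (x : C) : C := (- fst x, - snd x).
Definition Cmul (x y : C) : C :=
  (fst x * fst y - snd x * snd y, fst x * snd y + snd x * fst y).
Definition Cmod (x : C) : R := sqrt (fst x ^ 2 + snd x ^ 2).
Definition expi (th : R) : C := (cos th, sin th).

(* A function on T^2 is represented as F(s,t) = f(e^{is}, e^{it}). *)
Definition fn := R -> R -> C.
Definition feq (F G : fn) : Prop := forall s t, F s t = G s t.

Definition cont2 (F : fn) : Prop :=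
  forall s t eps, 0 < eps -> exists delta, 0 < delta /\
    forall s' t', Rabs (s' - s) < delta -> Rabs (t' - t) < delta ->
      Cmod (Cadd (F s' t') (Copp (F s t))) < eps.
Definition periodic2 (F : fn) : Prop :=
  forall s t, F (s + 2 * PI) t = F s t /\ F s (t + 2 * PI) = F s t.
Definition CT2 (F : fn) : Prop := cont2 F /\ periodic2 F.

Definition RInt_is (h : R -> R) (a b v : R) : Prop :=
  exists pr : Riemann_integrable h a b, RiemannInt pr = v.

(* hat f (m,n) = z, with normalized measure; integral over T^2 computed as an
   iterated Riemann integral (Fubini for continuous integrands). *)
Definition fourier_coef_is (F : fn) (m n : Z) (z : C) : Prop :=
  exists gr gi : R -> R,
    (forall s,
       RInt_is (fun t => fst (Cmul (F s t) (expi (- (IZR m * s + IZR n * t)))))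
               0 (2 * PI) (gr s) /\
       RInt_is (fun t => snd (Cmul (F s t) (expi (- (IZR m * s + IZR n * t)))))
               0 (2 * PI) (gi s)) /\
    RInt_is gr 0 (2 * PI) (fst z * (4 * PI ^ 2)) /\
    RInt_is gi 0 (2 * PI) (snd z * (4 * PI ^ 2)).

Definition Aalpha (alpha : R) (F : fn) : Prop :=
  CT2 F /\ forall m n : Z, IZR m + alpha * IZR n < 0 -> fourier_coef_is F m n (0, 0).

Definition bounded_by (F : fn) (r : R) : Prop := forall s t, Cmod (F s t) <= r.

Definition isometric_aut (alpha : R) (T : fn -> fn) : Prop :=
  (forall F, Aalpha alpha F -> Aalpha alpha (T F)) /\
  (forall F G, Aalpha alpha F -> Aalpha alpha G -> feq (T F) (T G) -> feq F G) /\
  (forall G, Aalpha alpha G -> exists F, Aalpha alpha F /\ feq (T F) G) /\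
  (forall F G, Aalpha alpha F -> Aalpha alpha G ->
     feq (T (fun s t => Cadd (F s t) (G s t))) (fun s t => Cadd (T F s t) (T G s t))) /\
  (forall (l : C) F, Aalpha alpha F ->
     feq (T (fun s t => Cmul l (F s t))) (fun s t => Cmul l (T F s t))) /\
  (forall F G, Aalpha alpha F -> Aalpha alpha G ->
     feq (T (fun s t => Cmul (F s t) (G s t))) (fun s t => Cmul (T F s t) (T G s t))) /\
  (forall F, Aalpha alpha F -> forall r, bounded_by F r <-> bounded_by (T F) r).

(* c = (e^{i c1}, e^{i c2}) in T^2, given by angles *)
Definition pi_c (c : R * R) (F : fn) : fn := fun s t => F (s + fst c) (t + snd c).
Definition angle_eq (c d : R * R) : Prop :=
  exists k l : Z, fst c - fst d = 2 * PI * IZR k /\ snd c - snd d = 2 * PI * IZR l.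

Record mat := Mat { ma : Z; mb : Z; mc : Z; md : Z }.
Definition mdet (A : mat) : Z := (ma A * md A - mb A * mc A)%Z.
Definition inGL2Z (A : mat) : Prop := mdet A = 1%Z \/ mdet A = (-1)%Z.
Definition mat_inv (A : mat) : mat :=
  let e := mdet A in
  Mat (e * md A)%Z (- (e * mb A))%Z (- (e * mc A))%Z (e * ma A)%Z.

(* pi(A) f = f o phi, phi(z,w) = (z^a w^b, z^c w^d) *)
Definition pi_mat (A : mat) (F : fn) : fn :=
  fun s t => F (IZR (ma A) * s + IZR (mb A) * t) (IZR (mc A) * s + IZR (md A) * t).

Definition zpow {X : Type} (f finv : X -> X) (k : Z) : X -> X :=
  match k with
  | Z0 => fun x => x
  | Zpos p => fun x => Nat.iter (Pos.to_nat p) f x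
  | Zneg p => fun x => Nat.iter (Pos.to_nat p) finv x
  end.

Definition pi_pow (A : mat) (k : Z) : fn -> fn :=
  zpow (pi_mat A) (pi_mat (mat_inv A)) k.

Definition psi (A : mat) (c : R * R) : R * R :=
  (IZR (ma A) * fst c + IZR (mb A) * snd c, IZR (mc A) * fst c + IZR (md A) * snd c).
Definition psi_pow (A : mat) (m : Z) : R * R -> R * R :=
  zpow (psi A) (psi (mat_inv A)) m.

(* multiplication in T^2 x|_{psi_A} Z (additive angle coordinates) *)
Definition sd_mul (A : mat) (x y : (R * R) * Z) : (R * R) * Z :=
  let c := fst x in let m := snd x in let d := fst y in let n := snd y in
  ((fst c + fst (psi_pow A m d), snd c + snd (psi_pow A m d)), (m + n)%Z).

Definition irrational (alpha : R) : Prop :=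
  forall p q : Z, q <> 0%Z -> alpha <> IZR p / IZR q.
Definition quadratic_irrational (alpha : R) : Prop :=
  irrational alpha /\
  exists a b c : Z, a <> 0%Z /\ IZR a * alpha ^ 2 + IZR b * alpha + IZR c = 0.

(* Main.v *)
(** Write w(m,n) = m + alpha n, so that A_alpha is the uniform closure of the span of the
    characters chi_m with w(m) >= 0 (Fejer).  Let T be an isometric automorphism.

    The functions u_m = T chi_m are unimodular: where |u_m| < 1, multiply by a function peaking
    there; pulling the product back by T contradicts the isometry.  Hence T F = F o Phi with
    Phi = (H1, H2) built from lifts of the phases of u_(1,0) and u_(0,1).

    The map chi_m |-> e^(-c w(m)) chi_m is multiplicative and, by a spectral radius argument, a
    contraction of A_alpha; the same argument bounds the derivative of its values along the flow
    of direction v = (1, alpha).  The damped u_m form a multiplicative family, bounded below for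
    0 <= w(m) <= 1 and equicontinuous along the flow.  As such m = (a,b) have arbitrarily large
    b, this forces the phase increments along the flow to be exactly proportional; letting
    c -> 0, H2 - alpha H1 is constant on flow lines.  So the integer linear part A of Phi has v as
    an eigenvector, and H2 - alpha H1 has constant periodic part.  For small w(m) > 0,
    u_m = const * chi_(mA) e^(i w(m) h1), and linearising in w(m) shows that h1 has no negative
    Fourier coefficients; being real it is constant.  Thus T F(x) = F(A x + d).

    Surjectivity of T gives A in GL(2,Z), and the eigenvalue is positive.  The stabiliser of the ray
    of v is trivial unless alpha is quadratic, when it is nontrivial by Pell's equation and, the
    eigenvalues being discrete in (1, oo), generated by the element with smallest eigenvalue > 1. *)

Require Import Defs.
From Stdlib Require Import Reals ZArith Lra Lia List FinFun Classical IndefiniteDescription FunctionalExtensionality.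
From Coquelicot Require Import Coquelicot.
Open Scope R_scope.

(** * Means and Fourier coefficients on the torus *)

(** The obstacle is that nothing is known in advance about the regularity of T chi_m. Infinitely
    many frequencies have weight in [0, 1], and although each such chi_m varies slowly along the
    flow, T chi_m is only known to be a unimodular element of A_alpha. Damping is evaluation at
    height c of the analytic extension over a flow line, and the Cauchy-type estimate available
    there has a constant 4/c that sees only the sup norm. It is therefore common to the whole
    family, which is what the sweep over arbitrarily large b requires. The estimates are made on
    formal trigonometric polynomials. Bounding coefficients one by one costs a factor polynomial in
    the degree, and this factor disappears when n-th roots are taken of the estimates for n-th
    powers. Fejer means then carry the estimates over to the whole algebra. T acts only on
    characters of nonnegative weight, so identities for (a, b) of mixed sign are obtained after
    multiplication by the member of index (|a|, |b|), followed by cancellation of a factor without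
    zeros. *)

Ltac cring := lazymatch goal with |- @eq _ ?x ?y => change (@eq C x y); ring end.

Lemma C_eq (x y : C) : fst x = fst y -> snd x = snd y -> x = y.
Proof. destruct x, y; simpl; intros; subst; reflexivity. Qed.

Ltac aring := first [ring | cring | solve [apply C_eq; simpl; ring]].

Lemma expi_add (a b : R) : expi (a + b) = Cmult (expi a) (expi b).
Proof. apply C_eq; simpl; [rewrite cos_plus | rewrite sin_plus]; ring. Qed.

Lemma expi_0 : expi 0 = RtoC 1.
Proof. apply C_eq; simpl; [apply cos_0 | apply sin_0]. Qed.

Lemma Cmod_expi (a : R) : Cmod (expi a) = 1.
Proof.
  unfold Cmod, expi; simpl.
  replace (cos a * (cos a * 1) + sin a * (sin a * 1)) with 1.
  - apply sqrt_1.
  - generalize (sin2_cos2 a); unfold Rsqr; lra.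
Qed.

Lemma expi_conj (a : R) : expi (- a) = Cconj (expi a).
Proof. apply C_eq; simpl; [apply cos_neg | apply sin_neg]. Qed.

Lemma expi_2PI_Z (k : Z) : expi (2 * PI * IZR k) = RtoC 1.
Proof.
  assert (H : forall n : nat, expi (2 * PI * INR n) = RtoC 1).
  { intros n; induction n as [|n IH].
    - simpl INR; rewrite Rmult_0_r; apply expi_0.
    - rewrite S_INR, Rmult_plus_distr_l, expi_add, IH.
      apply C_eq; simpl; rewrite Rmult_1_r, cos_2PI, sin_2PI; ring. }
  destruct (Z_le_gt_dec 0 k) as [Hk|Hk].
  - rewrite <- (Z2Nat.id k) by lia. rewrite <- INR_IZR_INZ. apply H.
  - replace (2 * PI * IZR k) with (- (2 * PI * IZR (- k))) by (rewrite opp_IZR; ring).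
    rewrite expi_conj, <- (Z2Nat.id (- k)) by lia.
    rewrite <- INR_IZR_INZ, H. apply C_eq; simpl; ring.
Qed.

Lemma expi_eq_1 (a : R) : expi a = RtoC 1 -> exists k : Z, a = 2 * PI * IZR k.
Proof.
  intros H; injection H as Hc Hs.
  destruct (sin_eq_0_0 a Hs) as [k Hk].
  destruct (Z.Even_or_Odd k) as [[j Hj]|[j Hj]].
  - exists j. rewrite Hk, Hj, mult_IZR. ring.
  - exfalso.
    assert (E : expi a = expi PI).
    { rewrite Hk, Hj, plus_IZR, mult_IZR.
      replace ((2 * IZR j + 1) * PI) with (2 * PI * IZR j + PI) by ring.
      rewrite expi_add, expi_2PI_Z. apply C_eq; simpl; ring. }
    injection E as E1 _. rewrite cos_PI in E1. lra.
Qed.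

Lemma expi_eq (a b : R) : expi a = expi b -> exists k : Z, a - b = 2 * PI * IZR k.
Proof.
  intros H. apply expi_eq_1.
  replace (a - b) with (a + - b) by ring.
  rewrite expi_add, H, <- expi_add, Rplus_opp_r. apply expi_0.
Qed.

Lemma Rabs_fst_le (z : C) : Rabs (fst z) <= Cmod z.
Proof. eapply Rle_trans; [apply Rmax_l | apply Rmax_Cmod]. Qed.

Lemma Rabs_snd_le (z : C) : Rabs (snd z) <= Cmod z.
Proof. eapply Rle_trans; [apply Rmax_r | apply Rmax_Cmod]. Qed.

Lemma Cmod_le_sum (z : C) : Cmod z <= Rabs (fst z) + Rabs (snd z).
Proof.
  replace z with (RtoC (fst z) + (0, snd z))%C by (apply C_eq; simpl; ring).
  eapply Rle_trans; [apply Cmod_triangle|].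
  rewrite Cmod_R. apply Rplus_le_compat.
  - right; f_equal; simpl; ring.
  - unfold Cmod; simpl.
    replace (0 * (0 * 1) + snd z * (snd z * 1)) with (Rsqr (snd z)) by (unfold Rsqr; ring).
    rewrite sqrt_Rsqr_abs. right; f_equal; ring.
Qed.

(** * Continuity in two variables and iterated integrals *)

Definition contR (f : R -> R -> R) : Prop := forall s t, continuity_2d_pt f s t.

Definition contC (F : fn) : Prop :=
  contR (fun s t => fst (F s t)) /\ contR (fun s t => snd (F s t)).

Lemma cont2_contC (F : fn) : cont2 F <-> contC F.
Proof.
  split.
  - intros H; split; intros s t eps; destruct (H s t eps (cond_pos eps)) as [d [Hd H']];
    exists (mkposreal d Hd); intros u v Hu Hv; simpl in *;
    specialize (H' u v Hu Hv).
    + eapply Rle_lt_trans; [|exact H'].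
      replace (fst (F u v) - fst (F s t)) with (fst (Cadd (F u v) (Defs.Copp (F s t)))) by (simpl; ring).
      apply Rabs_fst_le.
    + eapply Rle_lt_trans; [|exact H'].
      replace (snd (F u v) - snd (F s t)) with (snd (Cadd (F u v) (Defs.Copp (F s t)))) by (simpl; ring).
      apply Rabs_snd_le.
  - intros [H1 H2] s t eps He.
    assert (He2 : 0 < eps / 2) by lra.
    destruct (H1 s t (mkposreal _ He2)) as [d1 D1].
    destruct (H2 s t (mkposreal _ He2)) as [d2 D2].
    exists (Rmin d1 d2); split.
    + apply Rmin_pos; [apply (cond_pos d1) | apply (cond_pos d2)].
    + intros s' t' Hs Ht.
      eapply Rle_lt_trans; [apply Cmod_le_sum|]. simpl.
      specialize (D1 s' t' (Rlt_le_trans _ _ _ Hs (Rmin_l _ _)) (Rlt_le_trans _ _ _ Ht (Rmin_l _ _))).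
      specialize (D2 s' t' (Rlt_le_trans _ _ _ Hs (Rmin_r _ _)) (Rlt_le_trans _ _ _ Ht (Rmin_r _ _))).
      simpl in *. unfold Rminus in *. lra.
Qed.

Lemma contR_plus f g : contR f -> contR g -> contR (fun s t => f s t + g s t).
Proof. intros Hf Hg s t; apply continuity_2d_pt_plus; auto. Qed.
Lemma contR_minus f g : contR f -> contR g -> contR (fun s t => f s t - g s t).
Proof. intros Hf Hg s t; apply continuity_2d_pt_minus; auto. Qed.
Lemma contR_mult f g : contR f -> contR g -> contR (fun s t => f s t * g s t).
Proof. intros Hf Hg s t; apply continuity_2d_pt_mult; auto. Qed.
Lemma contR_const c : contR (fun _ _ => c).
Proof. intros s t; apply continuity_2d_pt_const. Qed.
Lemma contR_fst : contR (fun s _ => s).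
Proof. intros s t; apply continuity_2d_pt_id1. Qed.
Lemma contR_snd : contR (fun _ t => t).
Proof. intros s t; apply continuity_2d_pt_id2. Qed.
Lemma contR_comp (h : R -> R) f : continuity h -> contR f -> contR (fun s t => h (f s t)).
Proof. intros Hh Hf s t; apply continuity_1d_2d_pt_comp; auto. Qed.
Lemma contR_ext f g : (forall s t, f s t = g s t) -> contR f -> contR g.
Proof. intros E Hf s t. eapply continuity_2d_pt_ext; [exact E | apply Hf]. Qed.

Lemma contR_comp2 (f g h : R -> R -> R) :
  contR f -> contR g -> contR h -> contR (fun s t => f (g s t) (h s t)).
Proof.
  intros Hf Hg Hh s t eps.
  destruct (Hf (g s t) (h s t) eps) as [d D].
  destruct (Hg s t d) as [d1 D1]. destruct (Hh s t d) as [d2 D2].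
  exists (mkposreal _ (Rmin_pos _ _ (cond_pos d1) (cond_pos d2))).
  simpl; intros u v Hu Hv. apply D.
  - apply D1; eapply Rlt_le_trans; eauto; apply Rmin_l.
  - apply D2; eapply Rlt_le_trans; eauto; apply Rmin_r.
Qed.

Lemma contC_mult F G : contC F -> contC G -> contC (fun s t => Cmult (F s t) (G s t)).
Proof.
  intros [F1 F2] [G1 G2]; split; simpl.
  - apply contR_minus; apply contR_mult; assumption.
  - apply contR_plus; apply contR_mult; assumption.
Qed.
Lemma contC_plus F G : contC F -> contC G -> contC (fun s t => Cplus (F s t) (G s t)).
Proof. intros [F1 F2] [G1 G2]; split; simpl; apply contR_plus; assumption. Qed.
Lemma contC_const c : contC (fun _ _ => c).
Proof. split; apply contR_const. Qed.
Lemma contC_expi f : contR f -> contC (fun s t => expi (f s t)).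
Proof.
  intros Hf; split; simpl; apply contR_comp; auto; [apply continuity_cos | apply continuity_sin].
Qed.
Lemma contC_comp2 F (g h : R -> R -> R) :
  contC F -> contR g -> contR h -> contC (fun s t => F (g s t) (h s t)).
Proof.
  intros [F1 F2] Hg Hh; split.
  - apply (contR_comp2 (fun s t => fst (F s t))); auto.
  - apply (contR_comp2 (fun s t => snd (F s t))); auto.
Qed.
Lemma contR_lin0 (a b : R) : contR (fun s t => a * s + b * t).
Proof.
  repeat first [apply contR_plus | apply contR_mult | apply contR_const | apply contR_fst | apply contR_snd].
Qed.

Lemma contR_continuous_snd f s t : contR f -> continuous (f s) t.
Proof.
  intros H. apply continuity_pt_filterlim. intros eps He.
  destruct (H s t (mkposreal _ He)) as [d D].
  exists d; split; [apply (cond_pos d)|].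
  intros x [_ Hx]. simpl in *. unfold R_dist in *.
  apply (D s x); [|exact Hx]. rewrite Rminus_diag_eq, Rabs_R0 by reflexivity. apply (cond_pos d).
Qed.

Lemma ex_RInt_inner f s : contR f -> ex_RInt (f s) 0 (2 * PI).
Proof. intros H. apply (@ex_RInt_continuous R_CompleteNormedModule). intros; apply contR_continuous_snd; auto. Qed.

Lemma continuous_RInt_inner f s : contR f -> continuous (fun s => RInt (f s) 0 (2 * PI)) s.
Proof.
  intros H. apply continuity_pt_filterlim. intros eps He.
  pose proof PI_RGT_0 as Hpi.
  (* The inner interval has length 2 pi, so this tolerance integrates to eps / 2. *)
  assert (He' : 0 < eps / (4 * PI)) by (apply Rdiv_lt_0_compat; lra).
  destruct (uniform_continuity_2d_1d' f 0 (2 * PI) s (fun x _ => H s x) (mkposreal _ He')) as [d D].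
  exists d; split; [apply (cond_pos d)|].
  intros x [_ Hx]; simpl in *; unfold R_dist in *.
  rewrite <- (@RInt_minus R_CompleteNormedModule) by (apply ex_RInt_inner; auto).
  apply Rle_lt_trans with ((2 * PI - 0) * (eps / (4 * PI))).
  - apply abs_RInt_le_const.
    + lra.
    + apply (@ex_RInt_minus R_NormedModule); apply ex_RInt_inner; auto.
    + intros t Ht. left. apply Rabs_def2 in Hx.
      apply (D t s t x); auto; try lra.
      rewrite Rminus_diag_eq, Rabs_R0 by reflexivity. apply (cond_pos d).
  - replace ((2 * PI - 0) * (eps / (4 * PI))) with (eps / 2) by (field; lra). lra.
Qed.

Lemma ex_RInt_outer f : contR f -> ex_RInt (fun s => RInt (f s) 0 (2 * PI)) 0 (2 * PI).
Proof.
  intros H. apply (@ex_RInt_continuous R_CompleteNormedModule).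
  intros; apply continuous_RInt_inner; auto.
Qed.

Definition mean (f : R -> R -> R) : R :=
  RInt (fun s => RInt (f s) 0 (2 * PI)) 0 (2 * PI) / (4 * PI ^ 2).

Lemma mean_ext f g : (forall s t, f s t = g s t) -> mean f = mean g.
Proof.
  intros E. unfold mean. f_equal. apply RInt_ext; intros s _.
  apply RInt_ext; intros t _. apply E.
Qed.

Lemma mean_plus f g : contR f -> contR g -> mean (fun s t => f s t + g s t) = mean f + mean g.
Proof.
  intros Hf Hg. unfold mean.
  rewrite (RInt_ext _ (fun s => plus (RInt (f s) 0 (2 * PI)) (RInt (g s) 0 (2 * PI)))).
  - rewrite (@RInt_plus R_CompleteNormedModule) by (apply ex_RInt_outer; auto).
    unfold plus; simpl. unfold Rdiv; ring.
  - intros s _. apply (@RInt_plus R_CompleteNormedModule); apply ex_RInt_inner; auto.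
Qed.

Lemma mean_scal l f : contR f -> mean (fun s t => l * f s t) = l * mean f.
Proof.
  intros Hf. unfold mean.
  rewrite (RInt_ext _ (fun s => scal l (RInt (f s) 0 (2 * PI)))).
  - rewrite (@RInt_scal R_CompleteNormedModule) by (apply ex_RInt_outer; auto).
    unfold scal; simpl; unfold mult; simpl. unfold Rdiv; ring.
  - intros s _. apply (@RInt_scal R_CompleteNormedModule); apply ex_RInt_inner; auto.
Qed.

Lemma mean_minus f g : contR f -> contR g -> mean (fun s t => f s t - g s t) = mean f - mean g.
Proof.
  intros Hf Hg.
  rewrite (mean_ext _ (fun s t => f s t + (-1) * g s t)) by (intros; ring).
  rewrite mean_plus, mean_scal; auto; [ring|].
  apply contR_mult; auto; apply contR_const.
Qed.

Lemma mean_const c : mean (fun _ _ => c) = c.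
Proof.
  unfold mean. rewrite (RInt_ext _ (fun _ => 2 * PI * c)).
  - rewrite RInt_const. unfold scal; simpl; unfold mult; simpl. field. apply PI_neq0.
  - intros; rewrite RInt_const. unfold scal; simpl; unfold mult; simpl. ring.
Qed.

Lemma mean_le f g : contR f -> contR g -> (forall s t, f s t <= g s t) -> mean f <= mean g.
Proof.
  intros Hf Hg H. pose proof PI_RGT_0 as Hpi. unfold mean, Rdiv.
  apply Rmult_le_compat_r.
  - left; apply Rinv_0_lt_compat. assert (0 < PI ^ 2) by (apply pow_lt; auto). lra.
  - apply RInt_le; try (apply ex_RInt_outer; auto); try lra.
    intros s _. apply RInt_le; try (apply ex_RInt_inner; auto); try lra.
    intros t _. apply H.
Qed.

Lemma mean_Rabs_le f r : contR f -> (forall s t, Rabs (f s t) <= r) -> Rabs (mean f) <= r.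
Proof.
  intros Hf H. apply Rabs_le. split.
  - rewrite <- (mean_const (- r)). apply mean_le; auto; [apply contR_const|].
    intros s t; specialize (H s t). apply Rabs_le_between in H. lra.
  - rewrite <- (mean_const r). apply mean_le; auto; [apply contR_const|].
    intros s t; specialize (H s t). apply Rabs_le_between in H. lra.
Qed.

Definition Cmean (F : fn) : C := (mean (fun s t => fst (F s t)), mean (fun s t => snd (F s t))).

Lemma Cmean_ext F G : (forall s t, F s t = G s t) -> Cmean F = Cmean G.
Proof. intros E; apply C_eq; simpl; apply mean_ext; intros; rewrite E; reflexivity. Qed.

Lemma Cmean_plus F G : contC F -> contC G ->
  Cmean (fun s t => Cplus (F s t) (G s t)) = Cplus (Cmean F) (Cmean G).
Proof. intros [F1 F2] [G1 G2]; apply C_eq; simpl; apply mean_plus; auto. Qed.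

Lemma Cmean_scal l F : contC F -> Cmean (fun s t => Cmult l (F s t)) = Cmult l (Cmean F).
Proof.
  intros [F1 F2]; apply C_eq; simpl.
  - rewrite mean_minus, !mean_scal; auto; apply contR_mult; auto; apply contR_const.
  - rewrite mean_plus, !mean_scal; auto; apply contR_mult; auto; apply contR_const.
Qed.

Lemma Cmean_const c : Cmean (fun _ _ => c) = c.
Proof. apply C_eq; simpl; apply mean_const. Qed.

Lemma Cmean_minus F G : contC F -> contC G ->
  Cmean (fun s t => Cminus (F s t) (G s t)) = Cminus (Cmean F) (Cmean G).
Proof. intros [F1 F2] [G1 G2]; apply C_eq; simpl; apply mean_minus; auto. Qed.

(** The two components are bounded separately, whence the factor 2. It is harmless: later it is
    either absorbed in a tolerance or removed by the passage to powers in [pow_bound_le]. *)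
Lemma Cmod_Cmean_le F r : contC F -> (forall s t, Cmod (F s t) <= r) -> Cmod (Cmean F) <= 2 * r.
Proof.
  intros [F1 F2] H. eapply Rle_trans; [apply Cmod_le_sum|]. simpl.
  assert (Rabs (mean (fun s t => fst (F s t))) <= r).
  { apply mean_Rabs_le; auto; intros; eapply Rle_trans; [apply Rabs_fst_le|apply H]. }
  assert (Rabs (mean (fun s t => snd (F s t))) <= r).
  { apply mean_Rabs_le; auto; intros; eapply Rle_trans; [apply Rabs_snd_le|apply H]. }
  lra.
Qed.

(** * Characters and Fourier coefficients *)

Definition chi (m : Z * Z) : fn := fun s t => expi (IZR (fst m) * s + IZR (snd m) * t).
Definition freq_add (m n : Z * Z) : Z * Z := (fst m + fst n, snd m + snd n)%Z.
Definition freq_opp (m : Z * Z) : Z * Z := (- fst m, - snd m)%Z.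

Lemma chi_add m n s t : chi (freq_add m n) s t = Cmult (chi m s t) (chi n s t).
Proof. unfold chi, freq_add; simpl. rewrite <- expi_add, !plus_IZR. f_equal; ring. Qed.
Lemma chi_0 s t : chi (0, 0)%Z s t = RtoC 1.
Proof. unfold chi; simpl. rewrite <- expi_0. f_equal; ring. Qed.
Lemma Cmod_chi m s t : Cmod (chi m s t) = 1.
Proof. apply Cmod_expi. Qed.
Lemma contC_chi m : contC (chi m).
Proof. apply contC_expi, contR_lin0. Qed.

Lemma RInt_cos_lin (n : Z) (a : R) : n <> 0%Z -> RInt (fun t => cos (a + IZR n * t)) 0 (2 * PI) = 0.
Proof.
  intros Hn. assert (Hn' : IZR n <> 0) by (apply not_0_IZR; auto).
  assert (E : minus (sin (a + IZR n * (2 * PI)) / IZR n) (sin (a + IZR n * 0) / IZR n) = 0).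
  { assert (E : expi (a + IZR n * (2 * PI)) = expi (a + IZR n * 0)).
    { replace (a + IZR n * (2 * PI)) with (2 * PI * IZR n + (a + IZR n * 0)) by ring.
      rewrite expi_add, expi_2PI_Z. apply C_eq; simpl; ring. }
    injection E as _ E. rewrite E. unfold minus, plus, opp; simpl. ring. }
  pose proof (@is_RInt_derive R_CompleteNormedModule (fun t => sin (a + IZR n * t) / IZR n)
    (fun t => cos (a + IZR n * t)) 0 (2 * PI)) as D.
  etransitivity; [apply is_RInt_unique, D | exact E].
  - intros x _. auto_derive; [exact I | field; auto].
  - intros x _. apply (@ex_derive_continuous R_AbsRing R_NormedModule). auto_derive; exact I.
Qed.

(** The inner integral already vanishes when n is nonzero; otherwise the integrand depends on s
    alone and the outer integral vanishes. *)
Lemma mean_cos_lin m n a : (m, n) <> (0, 0)%Z -> mean (fun s t => cos (IZR m * s + IZR n * t + a)) = 0.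
Proof.
  intros H. unfold mean. destruct (Z.eq_dec n 0) as [->|Hn].
  - assert (Hm : m <> 0%Z) by (intros ->; apply H; reflexivity).
    rewrite (RInt_ext _ (fun s => scal (2 * PI) (cos (a + IZR m * s)))).
    + rewrite (@RInt_scal R_CompleteNormedModule).
      * rewrite RInt_cos_lin by auto. unfold scal; simpl; unfold mult; simpl. unfold Rdiv; ring.
      * apply (@ex_RInt_continuous R_CompleteNormedModule). intros x _.
        apply (@ex_derive_continuous R_AbsRing R_NormedModule). auto_derive; exact I.
    + intros s _. rewrite (RInt_ext _ (fun _ => cos (a + IZR m * s))).
      * rewrite RInt_const. rewrite Rminus_0_r; reflexivity.
      * intros; f_equal; ring.
  - rewrite (RInt_ext _ (fun s => 0)).
    + rewrite RInt_const. unfold scal; simpl; unfold mult; simpl. unfold Rdiv; ring.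
    + intros s _. rewrite (RInt_ext _ (fun t => cos ((IZR m * s + a) + IZR n * t))).
      * apply RInt_cos_lin; auto.
      * intros; f_equal; ring.
Qed.

Lemma Cmean_chi m : m <> (0, 0)%Z -> Cmean (chi m) = RtoC 0.
Proof.
  intros H. destruct m as [m n]. apply C_eq; simpl.
  - rewrite (mean_ext _ (fun s t => cos (IZR m * s + IZR n * t + 0))) by (intros; f_equal; ring).
    apply mean_cos_lin; auto.
  - rewrite (mean_ext _ (fun s t => cos (IZR m * s + IZR n * t + - (PI / 2)))).
    + apply mean_cos_lin; auto.
    + intros. rewrite <- cos_shift, <- cos_neg. f_equal. ring.
Qed.

Lemma Cmean_chi_0 : Cmean (chi (0, 0)%Z) = RtoC 1.
Proof. rewrite (Cmean_ext _ (fun _ _ => RtoC 1)) by (intros; apply chi_0). apply Cmean_const. Qed.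

Definition coef (F : fn) (m : Z * Z) : C := Cmean (fun s t => Cmult (F s t) (chi (freq_opp m) s t)).

Lemma RInt_is_iff h a b v : RInt_is h a b v <-> ex_RInt h a b /\ RInt h a b = v.
Proof.
  split.
  - intros [pr H]. split; [apply ex_RInt_Reals_1; exact pr|]. rewrite (RInt_Reals _ _ _ pr); exact H.
  - intros [H1 H2]. exists (ex_RInt_Reals_0 _ _ _ H1). rewrite <- RInt_Reals; exact H2.
Qed.

(** The relational coefficient leaves the inner integrals [gr] and [gi] as witnesses. For continuous
    F it is the graph of the total function [coef], on which the later algebra is done. *)
Lemma fourier_coef_iff F m n z : contC F -> fourier_coef_is F m n z <-> z = coef F (m, n).
Proof.
  intros HF. pose proof PI_neq0 as Hpi.
  assert (K : forall x : R, x = x / (4 * PI ^ 2) * (4 * PI ^ 2)) by (intros; field; auto).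
  assert (E : forall s t, Cmul (F s t) (expi (- (IZR m * s + IZR n * t))) = Cmult (F s t) (chi (freq_opp (m, n)) s t)).
  { intros s t. unfold chi, freq_opp; simpl. rewrite !opp_IZR.
    replace (- (IZR m * s + IZR n * t)) with (- IZR m * s + - IZR n * t) by ring. reflexivity. }
  assert (HG : contC (fun s t => Cmul (F s t) (expi (- (IZR m * s + IZR n * t))))).
  { apply contC_mult; auto. apply contC_expi.
    apply contR_ext with (fun s t => - IZR m * s + - IZR n * t); [intros; ring | apply contR_lin0]. }
  assert (EC : coef F (m, n) = Cmean (fun s t => Cmul (F s t) (expi (- (IZR m * s + IZR n * t))))).
  { apply Cmean_ext. intros; symmetry; apply E. }
  rewrite EC; clear E EC. destruct HG as [G1 G2].
  set (G := fun s t => Cmul (F s t) (expi (- (IZR m * s + IZR n * t)))) in *.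
  split.
  - intros (gr & gi & H1 & H2 & H3).
    apply RInt_is_iff in H2. apply RInt_is_iff in H3.
    apply C_eq; simpl; unfold mean.
    + rewrite (RInt_ext _ gr).
      * rewrite (proj2 H2). field; auto.
      * intros s _. destruct (H1 s) as [H _]. apply RInt_is_iff in H. apply (proj2 H).
    + rewrite (RInt_ext _ gi).
      * rewrite (proj2 H3). field; auto.
      * intros s _. destruct (H1 s) as [_ H]. apply RInt_is_iff in H. apply (proj2 H).
  - intros ->. exists (fun s => RInt (fun t => fst (G s t)) 0 (2 * PI)), (fun s => RInt (fun t => snd (G s t)) 0 (2 * PI)).
    split; [intros s; split|split]; apply RInt_is_iff; split; auto.
    + apply (ex_RInt_inner (fun s t => fst (G s t))); auto.
    + apply (ex_RInt_inner (fun s t => snd (G s t))); auto.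
    + apply (ex_RInt_outer (fun s t => fst (G s t))); auto.
    + apply (ex_RInt_outer (fun s t => snd (G s t))); auto.
Qed.

(** * Periodic functions: uniform continuity and oscillation *)

Lemma reduce_2PI (s : R) : exists k : Z, Rabs (s - 2 * PI * IZR k) <= PI.
Proof.
  pose proof PI_RGT_0 as Hpi.
  destruct (archimed ((s - PI) / (2 * PI))) as [H1 H2].
  exists (up ((s - PI) / (2 * PI))).
  set (k := IZR (up ((s - PI) / (2 * PI)))) in *.
  assert (E : (s - PI) = 2 * PI * ((s - PI) / (2 * PI))) by (field; lra).
  apply Rabs_le; split; nra.
Qed.

Lemma periodic2_Z (F : fn) : periodic2 F ->
  forall (j k : Z) s t, F (s + 2 * PI * IZR j) (t + 2 * PI * IZR k) = F s t.
Proof.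
  intros HF.
  assert (N1 : forall (n : nat) s t, F (s + 2 * PI * INR n) t = F s t).
  { induction n as [|n IH]; intros s t.
    - simpl INR; f_equal; ring.
    - rewrite S_INR. replace (s + 2 * PI * (INR n + 1)) with ((s + 2 * PI * INR n) + 2 * PI) by ring.
      rewrite (proj1 (HF _ _)). apply IH. }
  assert (N2 : forall (n : nat) s t, F s (t + 2 * PI * INR n) = F s t).
  { induction n as [|n IH]; intros s t.
    - simpl INR; f_equal; ring.
    - rewrite S_INR. replace (t + 2 * PI * (INR n + 1)) with ((t + 2 * PI * INR n) + 2 * PI) by ring.
      rewrite (proj2 (HF _ _)). apply IH. }
  assert (Z1 : forall j s t, F (s + 2 * PI * IZR j) t = F s t).
  { intros j s t. destruct (Z_le_gt_dec 0 j).
    - rewrite <- (Z2Nat.id j) by lia. rewrite <- INR_IZR_INZ. apply N1.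
    - rewrite <- (N1 (Z.to_nat (- j)) (s + 2 * PI * IZR j) t).
      f_equal. rewrite INR_IZR_INZ, Z2Nat.id, opp_IZR by lia. ring. }
  assert (Z2 : forall j s t, F s (t + 2 * PI * IZR j) = F s t).
  { intros j s t. destruct (Z_le_gt_dec 0 j).
    - rewrite <- (Z2Nat.id j) by lia. rewrite <- INR_IZR_INZ. apply N2.
    - rewrite <- (N2 (Z.to_nat (- j)) s (t + 2 * PI * IZR j)).
      f_equal. rewrite INR_IZR_INZ, Z2Nat.id, opp_IZR by lia. ring. }
  intros. rewrite Z1, Z2. reflexivity.
Qed.

Lemma unif_cont (F : fn) : contC F -> periodic2 F -> forall eps, 0 < eps ->
  exists d, 0 < d /\ forall s t s' t', Rabs (s' - s) < d -> Rabs (t' - t) < d ->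
    Cmod (Cminus (F s' t') (F s t)) < eps.
Proof.
  intros [H1 H2] HP eps He.
  assert (He2 : 0 < eps / 2) by lra.
  (* Base points are reduced to |s|, |t| <= pi <= 4 and the increments stay below 1, so both points
     lie well inside this square. *)
  destruct (uniform_continuity_2d _ (-10) 10 (-10) 10 (fun x y _ _ => H1 x y) (mkposreal _ He2)) as [d1 D1].
  destruct (uniform_continuity_2d _ (-10) 10 (-10) 10 (fun x y _ _ => H2 x y) (mkposreal _ He2)) as [d2 D2].
  exists (Rmin 1 (Rmin d1 d2)). split.
  { repeat apply Rmin_pos; try lra; apply cond_pos. }
  intros s t s' t' Hs Ht.
  destruct (reduce_2PI s) as [j Hj]. destruct (reduce_2PI t) as [k Hk].
  assert (E : forall a b, F a b = F (a - 2 * PI * IZR j) (b - 2 * PI * IZR k)).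
  { intros a b. rewrite <- (periodic2_Z F HP j k (a - 2 * PI * IZR j)). f_equal; ring. }
  rewrite (E s t), (E s' t').
  pose proof PI_4.
  assert (Q1 : Rabs (s' - s) < 1) by (eapply Rlt_le_trans; [exact Hs|apply Rmin_l]).
  assert (Q2 : Rabs (t' - t) < 1) by (eapply Rlt_le_trans; [exact Ht|apply Rmin_l]).
  assert (W1 : Rabs (s' - s) < Rmin d1 d2) by (eapply Rlt_le_trans; [exact Hs|apply Rmin_r]).
  assert (W2 : Rabs (t' - t) < Rmin d1 d2) by (eapply Rlt_le_trans; [exact Ht|apply Rmin_r]).
  set (a := s - 2 * PI * IZR j) in *. set (b := t - 2 * PI * IZR k) in *.
  set (a' := s' - 2 * PI * IZR j) in *. set (b' := t' - 2 * PI * IZR k) in *.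
  replace (s' - s) with (a' - a) in * by (unfold a, a'; ring).
  replace (t' - t) with (b' - b) in * by (unfold b, b'; ring).
  clearbody a b a' b'.
  apply Rabs_le_between in Hj, Hk. pose proof Q1 as Q1'. pose proof Q2 as Q2'.
  apply Rabs_def2 in Q1', Q2'.
  eapply Rle_lt_trans; [apply Cmod_le_sum|].
  assert (X1 : Rabs (fst (F a' b') - fst (F a b)) < eps / 2).
  { apply (D1 a b a' b'); try lra; eapply Rlt_le_trans; eauto; apply Rmin_l. }
  assert (X2 : Rabs (snd (F a' b') - snd (F a b)) < eps / 2).
  { apply (D2 a b a' b'); try lra; eapply Rlt_le_trans; eauto; apply Rmin_r. }
  simpl. unfold Rminus in *. lra.
Qed.

(** Up to periods two points differ by at most pi <= 4 in each coordinate. A walk in n steps of size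
    at most d / 2 joins them once n d / 2 >= 4, and each step changes F by less than 1. *)
Lemma osc_bound (F : fn) : contC F -> periodic2 F -> exists B, 0 <= B /\ forall s t s' t',
  Cmod (Cminus (F s' t') (F s t)) <= B.
Proof.
  intros HC HP.
  destruct (unif_cont F HC HP 1 Rlt_0_1) as [d [Hd D]].
  assert (CH : forall n s t s' t', Rabs (s' - s) <= INR n * (d / 2) -> Rabs (t' - t) <= INR n * (d / 2) ->
    Cmod (Cminus (F s' t') (F s t)) <= INR n).
  { induction n as [|n IH]; intros s t s' t' Hs Ht.
    - simpl in *. rewrite Rmult_0_l in *.
      assert (s' = s) by (apply Rabs_le_between in Hs; lra).
      assert (t' = t) by (apply Rabs_le_between in Ht; lra). subst.
      replace (Cminus (F s t) (F s t)) with (RtoC 0) by ring. rewrite Cmod_0; lra.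
    - rewrite S_INR in *. pose proof (pos_INR n) as Hn.
      (* The last of the n + 1 equal steps covers this fraction of the segment. *)
      set (lam := / (INR n + 1)).
      assert (Hl : lam * (INR n + 1) = 1) by (unfold lam; field; lra).
      assert (Hl0 : 0 < lam) by (apply Rinv_0_lt_compat; lra).
      set (sm := s + (1 - lam) * (s' - s)). set (tm := t + (1 - lam) * (t' - t)).
      assert (A0 : 0 <= 1 - lam) by nra.
      replace (Cminus (F s' t') (F s t)) with (Cplus (Cminus (F s' t') (F sm tm)) (Cminus (F sm tm) (F s t))) by ring.
      eapply Rle_trans; [apply Cmod_triangle|]. rewrite Rplus_comm. apply Rplus_le_compat.
      + apply IH.
        * unfold sm. replace (s + (1 - lam) * (s' - s) - s) with ((1 - lam) * (s' - s)) by ring.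
          rewrite Rabs_mult, (Rabs_pos_eq (1 - lam)) by auto. nra.
        * unfold tm. replace (t + (1 - lam) * (t' - t) - t) with ((1 - lam) * (t' - t)) by ring.
          rewrite Rabs_mult, (Rabs_pos_eq (1 - lam)) by auto. nra.
      + left. apply D.
        * unfold sm. replace (s' - (s + (1 - lam) * (s' - s))) with (lam * (s' - s)) by ring.
          rewrite Rabs_mult, (Rabs_pos_eq lam) by lra. nra.
        * unfold tm. replace (t' - (t + (1 - lam) * (t' - t))) with (lam * (t' - t)) by ring.
          rewrite Rabs_mult, (Rabs_pos_eq lam) by lra. nra. }
  destruct (archimed (4 / (d / 2))) as [H1 _].
  set (n := Z.to_nat (up (4 / (d / 2)))).
  assert (P0 : 0 < 4 / (d / 2)) by (apply Rdiv_lt_0_compat; lra).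
  assert (Hn : 4 <= INR n * (d / 2)).
  { unfold n. rewrite INR_IZR_INZ, Z2Nat.id.
    - assert (E : 4 = 4 / (d / 2) * (d / 2)) by (field; lra). rewrite E at 1.
      apply Rmult_le_compat_r; lra.
    - apply le_IZR. lra. }
  exists (INR n). split; [apply pos_INR|].
  intros s t s' t'.
  destruct (reduce_2PI (s' - s)) as [j Hj]. destruct (reduce_2PI (t' - t)) as [k Hk].
  rewrite <- (periodic2_Z F HP j k s t). pose proof PI_4.
  apply CH.
  - replace (s' - (s + 2 * PI * IZR j)) with (s' - s - 2 * PI * IZR j) by ring. lra.
  - replace (t' - (t + 2 * PI * IZR k)) with (t' - t - 2 * PI * IZR k) by ring. lra.
Qed.

Lemma CT2_bounded (F : fn) : contC F -> periodic2 F -> exists B, 0 <= B /\ forall s t, Cmod (F s t) <= B.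
Proof.
  intros HC HP. destruct (osc_bound F HC HP) as [B [HB H]].
  exists (B + Cmod (F 0 0)). split; [pose proof (Cmod_ge_0 (F 0 0)); lra|].
  intros s t. replace (F s t) with (Cplus (Cminus (F s t) (F 0 0)) (F 0 0)) by ring.
  eapply Rle_trans; [apply Cmod_triangle|]. apply Rplus_le_compat_r, H.
Qed.

Lemma cos_Rabs x : cos (Rabs x) = cos x.
Proof. unfold Rabs; destruct (Rcase_abs x); [apply cos_neg | reflexivity]. Qed.

Lemma one_minus_cos_ge_0 x : 0 <= 1 - cos x.
Proof. generalize (COS_bound x); lra. Qed.

(** The modulus of continuity is traded for a trigonometric majorant, whose average against a
    positive kernel can be computed, as in Korovkin's theorem. Points that are far apart modulo
    periods have one term 1 - cos at least 1 - cos d, so Q only has to make the majorant exceed the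
    oscillation there. *)
Lemma korovkin_bound (F : fn) : contC F -> periodic2 F -> forall eps, 0 < eps ->
  exists Q, 0 <= Q /\ forall s t s' t',
    Cmod (Cminus (F s' t') (F s t)) <= eps + Q * ((1 - cos (s - s')) + (1 - cos (t - t'))).
Proof.
  intros HC HP eps He.
  destruct (unif_cont F HC HP eps He) as [d0 [Hd0 D0]].
  destruct (osc_bound F HC HP) as [B [HB HO]].
  pose proof PI_RGT_0 as Hpi.
  set (d := Rmin d0 (PI / 2)).
  assert (Hd : 0 < d) by (apply Rmin_pos; lra).
  assert (Hd2 : d <= PI / 2) by apply Rmin_r.
  assert (Hdd : d <= d0) by apply Rmin_l.
  assert (Hc : 0 < 1 - cos d).
  { rewrite <- cos_0. enough (cos d < cos 0) by lra. apply cos_decreasing_1; lra. }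
  exists (B / (1 - cos d)). split.
  { apply Rmult_le_pos; auto. left; apply Rinv_0_lt_compat; auto. }
  intros s t s' t'.
  destruct (reduce_2PI (s' - s)) as [j Hj]. destruct (reduce_2PI (t' - t)) as [k Hk].
  assert (C1 : cos (s - s') = cos (s' - s - 2 * PI * IZR j)).
  { rewrite <- cos_neg. replace (- (s - s')) with ((s' - s - 2 * PI * IZR j) + 2 * PI * IZR j) by ring.
    assert (E : forall a, cos (a + 2 * PI * IZR j) = cos a).
    { intros a. change (fst (expi (a + 2 * PI * IZR j)) = cos a).
      rewrite expi_add, expi_2PI_Z; simpl; ring. }
    apply E. }
  assert (C2 : cos (t - t') = cos (t' - t - 2 * PI * IZR k)).
  { rewrite <- cos_neg. replace (- (t - t')) with ((t' - t - 2 * PI * IZR k) + 2 * PI * IZR k) by ring.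
    assert (E : forall a, cos (a + 2 * PI * IZR k) = cos a).
    { intros a. change (fst (expi (a + 2 * PI * IZR k)) = cos a).
      rewrite expi_add, expi_2PI_Z; simpl; ring. }
    apply E. }
  rewrite C1, C2.
  rewrite <- (periodic2_Z F HP j k s t).
  replace (s' - s - 2 * PI * IZR j) with (s' - (s + 2 * PI * IZR j)) in * by ring.
  replace (t' - t - 2 * PI * IZR k) with (t' - (t + 2 * PI * IZR k)) in * by ring.
  set (a := s + 2 * PI * IZR j) in *. set (b := t + 2 * PI * IZR k) in *.
  pose proof (one_minus_cos_ge_0 (s' - a)) as P1. pose proof (one_minus_cos_ge_0 (t' - b)) as P2.
  assert (FAR : forall z, Rabs z <= PI -> d <= Rabs z -> 1 - cos d <= 1 - cos z).
  { intros z Hz1 Hz2. rewrite <- (cos_Rabs z). enough (cos (Rabs z) <= cos d) by lra.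
    apply cos_decr_1; lra. }
  assert (BIG : 1 - cos d <= (1 - cos (s' - a)) + (1 - cos (t' - b)) ->
    Cmod (Cminus (F s' t') (F a b)) <= eps + B / (1 - cos d) * ((1 - cos (s' - a)) + (1 - cos (t' - b)))).
  { intros H. eapply Rle_trans; [apply HO|].
    assert (B <= B / (1 - cos d) * ((1 - cos (s' - a)) + (1 - cos (t' - b)))).
    { replace B with (B / (1 - cos d) * (1 - cos d)) at 1 by (field; lra).
      apply Rmult_le_compat_l; auto. apply Rmult_le_pos; auto. left; apply Rinv_0_lt_compat; auto. }
    lra. }
  destruct (Rlt_le_dec (Rabs (s' - a)) d) as [L1|L1].
  - destruct (Rlt_le_dec (Rabs (t' - b)) d) as [L2|L2].
    + left. eapply Rlt_le_trans; [apply D0; lra|].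
      assert (0 <= B / (1 - cos d) * ((1 - cos (s' - a)) + (1 - cos (t' - b)))).
      { apply Rmult_le_pos; [|lra]. apply Rmult_le_pos; auto. left; apply Rinv_0_lt_compat; auto. }
      lra.
    + apply BIG. specialize (FAR _ Hk L2). lra.
  - apply BIG. specialize (FAR _ Hj L1). lra.
Qed.

(** * Fejer approximation *)

Definition tpoly := list (C * (Z * Z)).
(** The characters are replaced by an arbitrary function [th] of the frequency, so that one
    evaluation serves for points of the torus, for points of the half-planes, for images under T and
    for means. *)
Definition peval (th : Z * Z -> C) (p : tpoly) : C :=
  fold_right (fun e acc => Cplus (Cmult (fst e) (th (snd e))) acc) (RtoC 0) p.
Definition teval (p : tpoly) : fn := fun s t => peval (fun m => chi m s t) p.

Lemma peval_app th p q : peval th (p ++ q) = Cplus (peval th p) (peval th q).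
Proof. induction p as [|e p IH]; simpl; [aring | rewrite IH; aring]. Qed.

Lemma peval_ext th th' p : (forall e, In e p -> th (snd e) = th' (snd e)) -> peval th p = peval th' p.
Proof.
  induction p as [|e p IH]; simpl; intros H; auto.
  rewrite H, IH; auto.
Qed.

Lemma contC_teval p : contC (teval p).
Proof.
  induction p as [|e p IH].
  - apply (contC_const (RtoC 0)).
  - apply (contC_plus (fun s t => Cmult (fst e) (chi (snd e) s t)) (teval p)); auto.
    apply contC_mult; [apply contC_const | apply contC_chi].
Qed.

Lemma chi_periodic m : periodic2 (chi m).
Proof.
  intros s t. unfold chi. split.
  - replace (IZR (fst m) * (s + 2 * PI) + IZR (snd m) * t) with (2 * PI * IZR (fst m) + (IZR (fst m) * s + IZR (snd m) * t)) by aring.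
    rewrite expi_add, expi_2PI_Z. aring.
  - replace (IZR (fst m) * s + IZR (snd m) * (t + 2 * PI)) with (2 * PI * IZR (snd m) + (IZR (fst m) * s + IZR (snd m) * t)) by aring.
    rewrite expi_add, expi_2PI_Z. aring.
Qed.

Lemma teval_periodic p : periodic2 (teval p).
Proof.
  intros s t; unfold teval; split; apply peval_ext; intros e _; apply chi_periodic.
Qed.

Lemma Cmean_peval (F : fn) (G : Z * Z -> fn) p : contC F -> (forall m, contC (G m)) ->
  Cmean (fun s t => Cmult (F s t) (peval (fun m => G m s t) p)) =
  peval (fun m => Cmean (fun s t => Cmult (F s t) (G m s t))) p.
Proof.
  intros HF HG. induction p as [|e p IH]; simpl.
  - rewrite (Cmean_ext _ (fun _ _ => RtoC 0)) by (intros; aring). apply Cmean_const.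
  - rewrite <- IH, <- Cmean_scal, <- Cmean_plus.
    + apply Cmean_ext; intros; aring.
    + apply contC_mult; [apply contC_const | apply contC_mult; auto].
    + apply contC_mult; auto. clear IH. induction p as [|e' p IH].
      * apply (contC_const (RtoC 0)).
      * apply (contC_plus (fun s t => Cmult (fst e') (G (snd e') s t)) (fun s t => peval (fun m => G m s t) p)); auto.
        apply contC_mult; [apply contC_const | auto].
    + apply contC_mult; auto.
Qed.

(* Sums of Dirichlet kernels, with frequencies listed with multiplicity. *)
Fixpoint dirichlet_freqs (n : nat) : list Z :=
  match n with
  | O => (0 :: nil)%Z
  | S k => dirichlet_freqs k ++ (Z.of_nat n :: (- Z.of_nat n)%Z :: nil)
  end.
Fixpoint fejer_freqs (n : nat) : list Z :=
  match n with O => dirichlet_freqs 0 | S k => fejer_freqs k ++ dirichlet_freqs n end.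
Fixpoint dirichlet_kernel (n : nat) (z : R) : R :=
  match n with O => 1 | S k => dirichlet_kernel k z + 2 * cos (INR n * z) end.
(** The sum of the Dirichlet kernels of orders 0 to n, without division: its mean is n + 1, and the
    normalisation appears in [fejer]. *)
Fixpoint fejer_kernel (n : nat) (z : R) : R :=
  match n with O => 1 | S k => fejer_kernel k z + dirichlet_kernel n z end.

Lemma dirichlet_kernel_cos n z : (1 - cos z) * dirichlet_kernel n z = cos (INR n * z) - cos (INR (S n) * z).
Proof.
  induction n as [|n IH].
  - simpl. rewrite Rmult_0_l, cos_0, Rmult_1_l. aring.
  - change (dirichlet_kernel (S n) z) with (dirichlet_kernel n z + 2 * cos (INR (S n) * z)).
    rewrite Rmult_plus_distr_l, IH.
    replace (INR n * z) with (INR (S n) * z - z) by (rewrite S_INR; aring).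
    replace (INR (S (S n)) * z) with (INR (S n) * z + z) by (rewrite (S_INR (S n)); aring).
    rewrite cos_minus, cos_plus. aring.
Qed.

(** The identities for the Dirichlet kernels telescope. The factor 1 - cos z plays the part of the
    squared half-angle sine in the closed form of the kernel. *)
Lemma fejer_kernel_cos n z : (1 - cos z) * fejer_kernel n z = 1 - cos (INR (S n) * z).
Proof.
  induction n as [|n IH].
  - simpl. rewrite Rmult_1_l. aring.
  - change (fejer_kernel (S n) z) with (fejer_kernel n z + dirichlet_kernel (S n) z).
    rewrite Rmult_plus_distr_l, IH, dirichlet_kernel_cos. aring.
Qed.

Lemma fejer_kernel_ge_0 n z : 0 <= fejer_kernel n z.
Proof.
  (* The closed form says nothing where 1 - cos z vanishes; there each cosine in the sum equals
     1. *)
  destruct (Req_dec (cos z) 1) as [E|E].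
  - assert (Hs : sin z = 0).
    { generalize (sin2_cos2 z). unfold Rsqr. rewrite E. intros H. nra. }
    assert (Hc : forall k, cos (INR k * z) = 1 /\ sin (INR k * z) = 0).
    { induction k as [|k [IH1 IH2]].
      - simpl; rewrite Rmult_0_l, cos_0, sin_0; auto.
      - rewrite S_INR, Rmult_plus_distr_r, Rmult_1_l, cos_plus, sin_plus, IH1, IH2, E, Hs. split; aring. }
    assert (Hd : forall k, 0 <= dirichlet_kernel k z).
    { induction k as [|k IH]; [simpl; lra|].
      change (0 <= dirichlet_kernel k z + 2 * cos (INR (S k) * z)). rewrite (proj1 (Hc (S k))). lra. }
    induction n as [|n IH]; [simpl; lra|].
    change (0 <= fejer_kernel n z + dirichlet_kernel (S n) z). specialize (Hd (S n)). lra.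
  - assert (H : 0 < 1 - cos z) by (generalize (COS_bound z); lra).
    apply Rmult_le_reg_l with (1 - cos z); auto.
    rewrite fejer_kernel_cos, Rmult_0_r. apply one_minus_cos_ge_0.
Qed.

(** This is how the concentration of the kernel is used: against 1 - cos it stays bounded while its
    mean grows like n. *)
Lemma fejer_kernel_cos_le n z : (1 - cos z) * fejer_kernel n z <= 2.
Proof. rewrite fejer_kernel_cos. generalize (COS_bound (INR (S n) * z)); lra. Qed.

Definition exp_sum (l : list Z) (z : R) : C :=
  fold_right (fun j acc => Cplus (expi (IZR j * z)) acc) (RtoC 0) l.

Lemma exp_sum_app l l' z : exp_sum (l ++ l') z = Cplus (exp_sum l z) (exp_sum l' z).
Proof. induction l as [|j l IH]; simpl; [aring | rewrite IH; aring]. Qed.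

Lemma exp_sum_dirichlet_freqs n z : exp_sum (dirichlet_freqs n) z = RtoC (dirichlet_kernel n z).
Proof.
  induction n as [|n IH].
  - simpl. rewrite Rmult_0_l, expi_0. aring.
  - change (dirichlet_freqs (S n)) with (dirichlet_freqs n ++ (Z.of_nat (S n) :: (- Z.of_nat (S n))%Z :: nil)).
    rewrite exp_sum_app, IH. unfold exp_sum, fold_right. rewrite opp_IZR, <- INR_IZR_INZ.
    replace (- INR (S n) * z) with (- (INR (S n) * z)) by aring.
    rewrite expi_conj. change (dirichlet_kernel (S n) z) with (dirichlet_kernel n z + 2 * cos (INR (S n) * z)).
    apply C_eq; unfold expi; simpl fst; simpl snd; aring.
Qed.

Lemma exp_sum_fejer_freqs n z : exp_sum (fejer_freqs n) z = RtoC (fejer_kernel n z).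
Proof.
  induction n as [|n IH].
  - apply (exp_sum_dirichlet_freqs 0).
  - change (fejer_freqs (S n)) with (fejer_freqs n ++ dirichlet_freqs (S n)). rewrite exp_sum_app, IH, exp_sum_dirichlet_freqs.
    change (fejer_kernel (S n) z) with (fejer_kernel n z + dirichlet_kernel (S n) z). apply C_eq; simpl; aring.
Qed.

Definition square_poly (l1 l2 : list Z) : tpoly := map (fun m => (RtoC 1, m)) (list_prod l1 l2).

Lemma teval_square_poly l1 l2 s t : teval (square_poly l1 l2) s t = Cmult (exp_sum l1 s) (exp_sum l2 t).
Proof.
  unfold square_poly, teval. induction l1 as [|j l1 IH]; simpl.
  - aring.
  - rewrite map_app, peval_app, IH.
    assert (E : peval (fun m => chi m s t) (map (fun m => (RtoC 1, m)) (map (fun y => (j, y)) l2))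
      = Cmult (expi (IZR j * s)) (exp_sum l2 t)).
    { clear IH. induction l2 as [|k l2 IH2]; simpl; [aring|].
      rewrite IH2. unfold chi; simpl. rewrite expi_add. aring. }
    rewrite E. aring.
Qed.

(** This is the mean of [exp_sum l], since a nonzero frequency averages to 0. *)
Definition zero_count (l : list Z) : R := fold_right (fun j acc => (if Z.eq_dec j 0 then 1 else 0) + acc) 0 l.

Lemma zero_count_app l l' : zero_count (l ++ l') = zero_count l + zero_count l'.
Proof. induction l as [|j l IH]; simpl; [aring | rewrite IH; aring]. Qed.

Lemma zero_count_dirichlet_freqs n : zero_count (dirichlet_freqs n) = 1.
Proof.
  induction n as [|n IH].
  - simpl; aring.
  - change (dirichlet_freqs (S n)) with (dirichlet_freqs n ++ (Z.of_nat (S n) :: (- Z.of_nat (S n))%Z :: nil)).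
    rewrite zero_count_app, IH. unfold zero_count, fold_right.
    destruct (Z.eq_dec (Z.of_nat (S n)) 0); [lia|].
    destruct (Z.eq_dec (- Z.of_nat (S n)) 0); [lia|]. aring.
Qed.

Lemma zero_count_fejer_freqs n : zero_count (fejer_freqs n) = INR (S n).
Proof.
  induction n as [|n IH].
  - simpl; aring.
  - change (fejer_freqs (S n)) with (fejer_freqs n ++ dirichlet_freqs (S n)). rewrite zero_count_app, IH, zero_count_dirichlet_freqs, (S_INR (S n)). aring.
Qed.

Lemma Cmean_chi_if m : Cmean (chi m) = RtoC ((if Z.eq_dec (fst m) 0 then 1 else 0) * (if Z.eq_dec (snd m) 0 then 1 else 0)).
Proof.
  destruct m as [j k]; simpl.
  destruct (Z.eq_dec j 0) as [->|Hj]; [destruct (Z.eq_dec k 0) as [->|Hk]|].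
  - rewrite Cmean_chi_0. f_equal; aring.
  - rewrite Cmean_chi by (intros H; inversion H; auto). f_equal; aring.
  - rewrite Cmean_chi by (intros H; inversion H; auto). f_equal; aring.
Qed.

(** A character at (s - u, t - v) splits into a factor in (s, t) and one in (u, v); only the
    frequency (0, 0) survives the mean, hence the result is independent of (s, t). *)
Lemma Cmean_conv_square_poly l1 l2 s t :
  Cmean (fun u v => teval (square_poly l1 l2) (s - u) (t - v)) = RtoC (zero_count l1 * zero_count l2).
Proof.
  assert (E0 : forall u v, teval (square_poly l1 l2) (s - u) (t - v) =
    Cmult (RtoC 1) (peval (fun m => Cmult (chi m s t) (chi (freq_opp m) u v)) (square_poly l1 l2))).
  { intros u v. rewrite Cmult_1_l. unfold teval. apply peval_ext. intros e _.
    unfold chi, freq_opp; simpl. rewrite !opp_IZR, <- expi_add. f_equal. aring. }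
  rewrite (Cmean_ext _ _ E0).
  rewrite (Cmean_peval (fun _ _ => RtoC 1) (fun m u v => Cmult (chi m s t) (chi (freq_opp m) u v))).
  2: apply contC_const.
  2: intros m; apply contC_mult; [apply contC_const | apply contC_chi].
  rewrite (peval_ext _ (fun m => RtoC ((if Z.eq_dec (fst m) 0 then 1 else 0) * (if Z.eq_dec (snd m) 0 then 1 else 0)))).
  - clear E0. unfold square_poly. induction l1 as [|j l1 IH]; simpl.
    + apply C_eq; simpl; aring.
    + rewrite map_app, peval_app, IH.
      assert (E : peval (fun m => RtoC ((if Z.eq_dec (fst m) 0 then 1 else 0) * (if Z.eq_dec (snd m) 0 then 1 else 0)))
        (map (fun m => (RtoC 1, m)) (map (fun y => (j, y)) l2)) = RtoC ((if Z.eq_dec j 0 then 1 else 0) * zero_count l2)).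
      { clear IH. induction l2 as [|k l2 IH2]; simpl; [f_equal; aring|].
        rewrite IH2. apply C_eq; simpl; aring. }
      rewrite E. apply C_eq; simpl; aring.
  - intros e _. destruct e as [c m]; simpl snd.
    rewrite (Cmean_ext _ (fun u v => Cmult (chi m s t) (chi (freq_opp m) u v))) by (intros; aring).
    rewrite Cmean_scal by apply contC_chi. rewrite Cmean_chi_if.
    destruct m as [j k]; unfold freq_opp; simpl.
    destruct (Z.eq_dec j 0) as [->|Hj]; [destruct (Z.eq_dec k 0) as [->|Hk]|].
    + simpl. rewrite chi_0. apply C_eq; simpl; aring.
    + destruct (Z.eq_dec (- 0) 0); [|lia]. destruct (Z.eq_dec (- k) 0); [lia|]. apply C_eq; simpl; aring.
    + destruct (Z.eq_dec (- j) 0); [lia|]. apply C_eq; simpl; aring.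
Qed.

Lemma zero_count_single_0 : zero_count (0 :: nil)%Z = 1.
Proof. simpl; ring. Qed.

Lemma mean_fejer_kernel_fst n t : mean (fun u v => fejer_kernel n (t - u)) = INR (S n).
Proof.
  transitivity (fst (Cmean (fun u v => teval (square_poly (fejer_freqs n) (0 :: nil)%Z) (t - u) (0 - v)))).
  - apply mean_ext. intros u v. rewrite teval_square_poly, exp_sum_fejer_freqs.
    simpl. rewrite Rmult_0_l, cos_0, sin_0. ring.
  - rewrite Cmean_conv_square_poly, zero_count_fejer_freqs, zero_count_single_0. unfold RtoC, fst. ring.
Qed.

Lemma mean_fejer_kernel_snd n t : mean (fun u v => fejer_kernel n (t - v)) = INR (S n).
Proof.
  transitivity (fst (Cmean (fun u v => teval (square_poly (0 :: nil)%Z (fejer_freqs n)) (0 - u) (t - v)))).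
  - apply mean_ext. intros u v. rewrite teval_square_poly, exp_sum_fejer_freqs.
    simpl. rewrite Rmult_0_l, cos_0, sin_0. ring.
  - rewrite Cmean_conv_square_poly, zero_count_fejer_freqs, zero_count_single_0. unfold RtoC, fst. ring.
Qed.

Lemma mean_fejer_kernel_prod n s t : mean (fun u v => fejer_kernel n (s - u) * fejer_kernel n (t - v)) = INR (S n) * INR (S n).
Proof.
  transitivity (fst (Cmean (fun u v => teval (square_poly (fejer_freqs n) (fejer_freqs n)) (s - u) (t - v)))).
  - apply mean_ext. intros u v. rewrite teval_square_poly, !exp_sum_fejer_freqs. simpl. ring.
  - rewrite Cmean_conv_square_poly, zero_count_fejer_freqs. unfold RtoC, fst. ring.
Qed.

Lemma continuity_dirichlet_kernel n : continuity (dirichlet_kernel n).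
Proof.
  induction n as [|n IH].
  - intros x; apply continuity_pt_const; intros a b; reflexivity.
  - change (continuity (fun z => dirichlet_kernel n z + 2 * cos (INR (S n) * z))).
    apply (continuity_plus (dirichlet_kernel n) (fun z => 2 * cos (INR (S n) * z))); auto.
    intros x. apply derivable_continuous_pt. apply ex_derive_Reals_0. auto_derive; exact I.
Qed.

Lemma continuity_fejer_kernel n : continuity (fejer_kernel n).
Proof.
  induction n as [|n IH].
  - intros x; apply continuity_pt_const; intros a b; reflexivity.
  - apply (continuity_plus (fejer_kernel n) (dirichlet_kernel (S n))); auto. apply continuity_dirichlet_kernel.
Qed.

(** A frequency j occurs n + 1 - |j| times in [fejer_freqs n], so the repetitions in the list
    produce the usual triangular weights of the Fejer mean in both variables. *)
Definition fejer (F : fn) (n : nat) : tpoly :=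
  map (fun m => (Cmult (coef F m) (RtoC (/ (INR (S n) * INR (S n)))), m)) (list_prod (fejer_freqs n) (fejer_freqs n)).

Lemma teval_fejer F n s t : contC F ->
  teval (fejer F n) s t = Cmult (RtoC (/ (INR (S n) * INR (S n))))
    (Cmean (fun u v => Cmult (F u v) (RtoC (fejer_kernel n (s - u) * fejer_kernel n (t - v))))).
Proof.
  intros HF.
  rewrite (Cmean_ext _ (fun u v => Cmult (F u v)
    (peval (fun m => Cmult (chi m s t) (chi (freq_opp m) u v)) (square_poly (fejer_freqs n) (fejer_freqs n))))).
  - rewrite (Cmean_peval F (fun m u v => Cmult (chi m s t) (chi (freq_opp m) u v))); auto.
    2: intros m; apply contC_mult; [apply contC_const | apply contC_chi].
    unfold teval, fejer, square_poly. generalize (RtoC (/ (INR (S n) * INR (S n)))). intros c. induction (list_prod (fejer_freqs n) (fejer_freqs n)) as [|m l IH]; simpl; [aring|].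
    rewrite IH.
    rewrite (Cmean_ext (fun u v => Cmult (F u v) (Cmult (chi m s t) (chi (freq_opp m) u v)))
      (fun u v => Cmult (chi m s t) (Cmult (F u v) (chi (freq_opp m) u v)))) by (intros; aring).
    rewrite Cmean_scal by (apply contC_mult; auto; apply contC_chi).
    fold (coef F m). aring.
  - intros u v. f_equal.
    rewrite (peval_ext _ (fun m => chi m (s - u) (t - v))).
    + fold (teval (square_poly (fejer_freqs n) (fejer_freqs n)) (s - u) (t - v)). rewrite teval_square_poly, !exp_sum_fejer_freqs. apply C_eq; simpl; aring.
    + intros e _. unfold chi, freq_opp; simpl. rewrite !opp_IZR, <- expi_add. f_equal. aring.
Qed.

(** Each factor 1 - cos absorbs one of the two kernels, so the term with Q averages to order n + 1,
    against a normalisation of (n + 1)^2. *)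
Lemma kernel_estimate (g : R -> R -> R) n s t eps Q : contR g -> 0 <= eps -> 0 <= Q ->
  (forall u v, Rabs (g u v) <= eps + Q * ((1 - cos (s - u)) + (1 - cos (t - v)))) ->
  Rabs (mean (fun u v => g u v * (fejer_kernel n (s - u) * fejer_kernel n (t - v)))) <=
  eps * (INR (S n) * INR (S n)) + 4 * Q * INR (S n).
Proof.
  intros Hg He HQ H.
  assert (C1 : contR (fun u v => fejer_kernel n (s - u))).
  { apply contR_comp; [apply continuity_fejer_kernel|]. apply contR_minus; [apply contR_const | apply contR_fst]. }
  assert (C2 : contR (fun u v => fejer_kernel n (t - v))).
  { apply contR_comp; [apply continuity_fejer_kernel|]. apply contR_minus; [apply contR_const | apply contR_snd]. }
  assert (C12 : contR (fun u v => fejer_kernel n (s - u) * fejer_kernel n (t - v))) by (apply contR_mult; auto).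
  assert (CG : contR (fun u v => g u v * (fejer_kernel n (s - u) * fejer_kernel n (t - v)))) by (apply contR_mult; auto).
  set (h := fun u v => eps * (fejer_kernel n (s - u) * fejer_kernel n (t - v)) + (2 * Q) * (fejer_kernel n (s - u) + fejer_kernel n (t - v))).
  assert (Ch : contR h).
  { apply contR_plus; apply contR_mult; auto; try apply contR_const. apply contR_plus; auto. }
  assert (Mh : mean h = eps * (INR (S n) * INR (S n)) + 4 * Q * INR (S n)).
  { unfold h. rewrite mean_plus, mean_scal, mean_fejer_kernel_prod, mean_scal, mean_plus, mean_fejer_kernel_fst, mean_fejer_kernel_snd; auto.
    - aring.
    - apply contR_plus; auto.
    - apply contR_mult; auto; apply contR_const.
    - apply contR_mult; [apply contR_const | apply contR_plus; auto]. }
  assert (B : forall u v, Rabs (g u v * (fejer_kernel n (s - u) * fejer_kernel n (t - v))) <= h u v).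
  { intros u v. pose proof (fejer_kernel_ge_0 n (s - u)) as P1. pose proof (fejer_kernel_ge_0 n (t - v)) as P2.
    assert (P12 : 0 <= fejer_kernel n (s - u) * fejer_kernel n (t - v)) by (apply Rmult_le_pos; auto).
    rewrite Rabs_mult, (Rabs_pos_eq (fejer_kernel n (s - u) * fejer_kernel n (t - v))) by auto.
    eapply Rle_trans; [apply Rmult_le_compat_r; [auto|apply H]|].
    unfold h. pose proof (fejer_kernel_cos_le n (s - u)) as L1. pose proof (fejer_kernel_cos_le n (t - v)) as L2.
    rewrite Rmult_plus_distr_r. apply Rplus_le_compat_l.
    replace (Q * (1 - cos (s - u) + (1 - cos (t - v))) * (fejer_kernel n (s - u) * fejer_kernel n (t - v))) with
      (Q * (((1 - cos (s - u)) * fejer_kernel n (s - u)) * fejer_kernel n (t - v) + ((1 - cos (t - v)) * fejer_kernel n (t - v)) * fejer_kernel n (s - u))) by aring.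
    replace (2 * Q * (fejer_kernel n (s - u) + fejer_kernel n (t - v))) with (Q * (2 * fejer_kernel n (t - v) + 2 * fejer_kernel n (s - u))) by aring.
    apply Rmult_le_compat_l; auto. apply Rplus_le_compat; apply Rmult_le_compat_r; auto. }
  rewrite <- Mh. apply Rabs_le. split.
  - replace (- mean h) with (mean (fun u v => (-1) * h u v)) by (rewrite mean_scal; auto; aring).
    apply mean_le; auto.
    + apply contR_mult; auto; apply contR_const.
    + intros u v. specialize (B u v). apply Rabs_le_between in B. lra.
  - apply mean_le; auto. intros u v. specialize (B u v). apply Rabs_le_between in B. lra.
Qed.

Lemma fejer_approx (F : fn) : contC F -> periodic2 F -> forall eps, 0 < eps ->
  exists n, forall s t, Cmod (Cminus (F s t) (teval (fejer F n) s t)) <= eps.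
Proof.
  intros HC HP eps He.
  destruct (korovkin_bound F HC HP (eps / 4)) as [Q [HQ K]]; [lra|].
  (* With M = n + 1, the two components together cost (eps / 2) M^2 + 8 Q M; the choice 16 Q <= eps
     M makes this at most eps M^2. *)
  destruct (archimed (16 * Q / eps)) as [H1 _].
  assert (P0 : 0 <= 16 * Q / eps) by (apply Rmult_le_pos; [lra | left; apply Rinv_0_lt_compat; auto]).
  set (n := Z.to_nat (up (16 * Q / eps))). exists n.
  assert (Hn : 16 * Q / eps <= INR (S n)).
  { rewrite S_INR. unfold n. rewrite INR_IZR_INZ, Z2Nat.id; [lra|]. apply le_IZR. lra. }
  intros s t. rewrite teval_fejer by auto. set (M := INR (S n)) in *.
  assert (HM : 0 < M) by (apply lt_0_INR; lia).
  set (g := fun u v => Cminus (F s t) (F u v)).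
  assert (Cg : contC g).
  { destruct HC as [F1 F2]. split; apply contR_minus; auto; apply contR_const. }
  assert (E : Cminus (F s t) (Cmult (RtoC (/ (M * M)))
      (Cmean (fun u v => Cmult (F u v) (RtoC (fejer_kernel n (s - u) * fejer_kernel n (t - v)))))) =
    Cmult (RtoC (/ (M * M))) (Cmean (fun u v => Cmult (g u v) (RtoC (fejer_kernel n (s - u) * fejer_kernel n (t - v)))))).
  { set (k := fun u v => RtoC (fejer_kernel n (s - u) * fejer_kernel n (t - v))).
    assert (Ck : contC k).
    { split; unfold k; simpl; [|apply contR_const].
      apply contR_mult; (apply contR_comp; [apply continuity_fejer_kernel|]);
      apply contR_minus; (apply contR_const || apply contR_fst || apply contR_snd). }
    change (fun u v => Cmult (F u v) (RtoC (fejer_kernel n (s - u) * fejer_kernel n (t - v)))) with (fun u v => Cmult (F u v) (k u v)).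
    change (fun u v => Cmult (g u v) (RtoC (fejer_kernel n (s - u) * fejer_kernel n (t - v)))) with (fun u v => Cmult (g u v) (k u v)).
    rewrite (Cmean_ext (fun u v => Cmult (g u v) (k u v)) (fun u v => Cminus (Cmult (F s t) (k u v)) (Cmult (F u v) (k u v))))
      by (intros; unfold g; aring).
    rewrite Cmean_minus, Cmean_scal; auto.
    - assert (Mk : Cmean k = RtoC (M * M)).
      { apply C_eq; unfold k; simpl fst; simpl snd; [apply mean_fejer_kernel_prod | apply mean_const]. }
      rewrite Mk. generalize (Cmean (fun u v => Cmult (F u v) (k u v))). intros z.
      apply C_eq; simpl; field; lra.
    - apply contC_mult; auto; apply contC_const.
    - apply contC_mult; auto. }
  rewrite E, Cmod_mult, Cmod_R, Rabs_pos_eq by (left; apply Rinv_0_lt_compat; nra).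
  assert (Bd : forall f : C -> R, (f = fst \/ f = snd) ->
    Rabs (mean (fun u v => f (g u v) * (fejer_kernel n (s - u) * fejer_kernel n (t - v)))) <= eps / 4 * (M * M) + 4 * Q * M).
  { intros f Hf. apply kernel_estimate; auto; try lra.
    - destruct Cg as [G1 G2]. destruct Hf as [-> | ->]; auto.
    - intros u v. eapply Rle_trans; [|apply K].
      replace (Cmod (Cminus (F u v) (F s t))) with (Cmod (g u v)).
      + destruct Hf as [-> | ->]; [apply Rabs_fst_le | apply Rabs_snd_le].
      + rewrite <- Cmod_opp. f_equal. unfold g. aring. }
  pose proof (Bd fst (or_introl eq_refl)) as B1. pose proof (Bd snd (or_intror eq_refl)) as B2.
  assert (BB : Cmod (Cmean (fun u v => Cmult (g u v) (RtoC (fejer_kernel n (s - u) * fejer_kernel n (t - v))))) <= eps / 2 * (M * M) + 8 * Q * M).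
  { eapply Rle_trans; [apply Cmod_le_sum|].
    replace (fst (Cmean (fun u v => Cmult (g u v) (RtoC (fejer_kernel n (s - u) * fejer_kernel n (t - v)))))) with
      (mean (fun u v => fst (g u v) * (fejer_kernel n (s - u) * fejer_kernel n (t - v)))).
    2: { unfold Cmean; simpl fst. apply mean_ext; intros; unfold RtoC; simpl fst; simpl snd; aring. }
    replace (snd (Cmean (fun u v => Cmult (g u v) (RtoC (fejer_kernel n (s - u) * fejer_kernel n (t - v)))))) with
      (mean (fun u v => snd (g u v) * (fejer_kernel n (s - u) * fejer_kernel n (t - v)))).
    2: { unfold Cmean; simpl snd. apply mean_ext; intros; unfold RtoC; simpl fst; simpl snd; aring. }
    lra. }
  apply Rmult_le_reg_l with (M * M); [nra|].
  rewrite <- Rmult_assoc, Rinv_r, Rmult_1_l by nra.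
  assert (16 * Q <= eps * M).
  { apply Rmult_le_reg_r with (/ eps); [apply Rinv_0_lt_compat; auto|].
    replace (eps * M * / eps) with M by (field; lra). exact Hn. }
  nra.
Qed.

(** * The algebra as a closure of analytic trigonometric polynomials *)

Definition weight (al : R) (m : Z * Z) : R := IZR (fst m) + al * IZR (snd m).
Definition analytic (al : R) (p : tpoly) : Prop := List.Forall (fun e => 0 <= weight al (snd e)) p.

Definition near (F G : fn) (eps : R) : Prop := forall s t, Cmod (Cminus (F s t) (G s t)) <= eps.

Lemma weight_add al m n : weight al (freq_add m n) = weight al m + weight al n.
Proof. unfold weight, freq_add; simpl. rewrite !plus_IZR. ring. Qed.

Lemma weight_opp al m : weight al (freq_opp m) = - weight al m.
Proof. unfold weight, freq_opp; simpl. rewrite !opp_IZR. ring. Qed.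

Lemma Cminus_mod_sym (x y : C) : Cmod (Cminus x y) = Cmod (Cminus y x).
Proof. rewrite <- Cmod_opp. f_equal. ring. Qed.

Lemma near_sym F G e : near F G e -> near G F e.
Proof. intros H s t. rewrite Cminus_mod_sym. apply H. Qed.

Lemma near_trans F G H e1 e2 : near F G e1 -> near G H e2 -> near F H (e1 + e2).
Proof.
  intros H1 H2 s t.
  replace (Cminus (F s t) (H s t)) with (Cplus (Cminus (F s t) (G s t)) (Cminus (G s t) (H s t))) by aring.
  eapply Rle_trans; [apply Cmod_triangle|]. apply Rplus_le_compat; auto.
Qed.

Definition freq_dec (m n : Z * Z) : {m = n} + {m <> n}.
Proof. decide equality; apply Z.eq_dec. Defined.

Lemma coef_chi m n : coef (chi m) n = if freq_dec m n then RtoC 1 else RtoC 0.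
Proof.
  unfold coef. rewrite (Cmean_ext _ (chi (freq_add m (freq_opp n)))) by (intros; symmetry; apply chi_add).
  destruct (freq_dec m n) as [->|H].
  - replace (freq_add n (freq_opp n)) with (0, 0)%Z; [apply Cmean_chi_0|].
    unfold freq_add, freq_opp; simpl. f_equal; ring.
  - apply Cmean_chi. intros E. apply H. destruct m, n; unfold freq_add, freq_opp in E; simpl in E.
    injection E as E1 E2. f_equal; lia.
Qed.

Lemma contC_coef_arg F m : contC F -> contC (fun s t => Cmult (F s t) (chi (freq_opp m) s t)).
Proof. intros H; apply contC_mult; auto; apply contC_chi. Qed.

Lemma coef_ext F G m : (forall s t, F s t = G s t) -> coef F m = coef G m.
Proof. intros E; apply Cmean_ext; intros; rewrite E; reflexivity. Qed.

Lemma coef_plus F G m : contC F -> contC G -> coef (fun s t => Cplus (F s t) (G s t)) m = Cplus (coef F m) (coef G m).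
Proof.
  intros HF HG. unfold coef. rewrite <- Cmean_plus by (apply contC_coef_arg; auto).
  apply Cmean_ext; intros; aring.
Qed.

Lemma coef_scal c F m : contC F -> coef (fun s t => Cmult c (F s t)) m = Cmult c (coef F m).
Proof.
  intros HF. unfold coef. rewrite <- Cmean_scal by (apply contC_coef_arg; auto).
  apply Cmean_ext; intros; aring.
Qed.

Lemma coef_mul_chi F m n : coef (fun s t => Cmult (chi m s t) (F s t)) n = coef F (freq_add n (freq_opp m)).
Proof.
  unfold coef. apply Cmean_ext; intros s t.
  replace (freq_opp (freq_add n (freq_opp m))) with (freq_add m (freq_opp n)).
  - rewrite chi_add. aring.
  - destruct m, n; unfold freq_add, freq_opp; simpl; f_equal; ring.
Qed.

Lemma contC_minus F G : contC F -> contC G -> contC (fun s t => Cminus (F s t) (G s t)).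
Proof. intros [F1 F2] [G1 G2]; split; simpl; apply contR_minus; assumption. Qed.

Lemma coef_minus F G m : contC F -> contC G -> coef (fun s t => Cminus (F s t) (G s t)) m = Cminus (coef F m) (coef G m).
Proof.
  intros HF HG. unfold coef. rewrite <- Cmean_minus by (apply contC_coef_arg; auto).
  apply Cmean_ext; intros; aring.
Qed.

Lemma coef_bound F m r : contC F -> (forall s t, Cmod (F s t) <= r) -> Cmod (coef F m) <= 2 * r.
Proof.
  intros HF H. apply Cmod_Cmean_le; [apply contC_coef_arg; auto|].
  intros s t. rewrite Cmod_mult, Cmod_chi, Rmult_1_r. apply H.
Qed.

Lemma coef_teval p m : coef (teval p) m = fold_right (fun e acc => Cplus (if freq_dec (snd e) m then fst e else RtoC 0) acc) (RtoC 0) p.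
Proof.
  induction p as [|e p IH]; simpl.
  - unfold coef. rewrite (Cmean_ext _ (fun _ _ => RtoC 0)) by (intros; unfold teval; simpl; aring). apply Cmean_const.
  - rewrite (coef_ext (teval (e :: p)) (fun s t => Cplus (Cmult (fst e) (chi (snd e) s t)) (teval p s t))) by reflexivity.
    rewrite coef_plus, coef_scal, coef_chi, IH.
    + destruct (freq_dec (snd e) m); aring.
    + apply contC_chi.
    + apply contC_mult; [apply contC_const | apply contC_chi].
    + apply contC_teval.
Qed.

Lemma coef_teval_neg al p m : analytic al p -> weight al m < 0 -> coef (teval p) m = RtoC 0.
Proof.
  intros Hp Hm. rewrite coef_teval. induction Hp as [|e p He Hp IH]; simpl; auto.
  rewrite IH. destruct (freq_dec (snd e) m) as [E|E]; [subst; lra|ring].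
Qed.

Lemma contC_limit F : (forall eps, 0 < eps -> exists G, contC G /\ near F G eps) -> contC F.
Proof.
  intros H. apply cont2_contC. intros s t eps He.
  destruct (H (eps / 4)) as [G [HG HN]]; [lra|].
  apply cont2_contC in HG. destruct (HG s t (eps / 4)) as [d [Hd D]]; [lra|].
  exists d; split; auto. intros s' t' Hs Ht. specialize (D s' t' Hs Ht).
  change (Cmod (Cminus (F s' t') (F s t)) < eps).
  change (Cmod (Cminus (G s' t') (G s t)) < eps / 4) in D.
  replace (Cminus (F s' t') (F s t)) with
    (Cplus (Cplus (Cminus (F s' t') (G s' t')) (Cminus (G s' t') (G s t))) (Copp (Cminus (F s t) (G s t)))) by aring.
  eapply Rle_lt_trans; [apply Cmod_triangle|]. rewrite Cmod_opp.
  pose proof (Cmod_triangle (Cminus (F s' t') (G s' t')) (Cminus (G s' t') (G s t))).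
  pose proof (HN s t). pose proof (HN s' t'). lra.
Qed.

Lemma C_eq_of_small (x y : C) : (forall eps, 0 < eps -> Cmod (Cminus x y) <= eps) -> x = y.
Proof.
  intros H. assert (E : Cmod (Cminus x y) = 0).
  { apply Rle_antisym; [|apply Cmod_ge_0]. apply le_epsilon. intros e He. rewrite Rplus_0_l. auto. }
  apply Cmod_eq_0 in E. replace x with (Cplus (Cminus x y) y) by ring. rewrite E. ring.
Qed.

Lemma periodic_limit F : (forall eps, 0 < eps -> exists G, periodic2 G /\ near F G eps) -> periodic2 F.
Proof.
  intros H s t. split; apply C_eq_of_small; intros e He;
    (destruct (H (e / 2)) as [G [HG HN]]; [lra|]).
  - replace (Cminus (F (s + 2 * PI) t) (F s t)) with
      (Cminus (Cminus (F (s + 2 * PI) t) (G (s + 2 * PI) t)) (Cminus (F s t) (G s t)))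
      by (rewrite (proj1 (HG s t)); aring).
    eapply Rle_trans; [apply Cmod_triangle|]. rewrite Cmod_opp.
    pose proof (HN (s + 2 * PI) t). pose proof (HN s t). lra.
  - replace (Cminus (F s (t + 2 * PI)) (F s t)) with
      (Cminus (Cminus (F s (t + 2 * PI)) (G s (t + 2 * PI))) (Cminus (F s t) (G s t)))
      by (rewrite (proj2 (HG s t)); aring).
    eapply Rle_trans; [apply Cmod_triangle|]. rewrite Cmod_opp.
    pose proof (HN s (t + 2 * PI)). pose proof (HN s t). lra.
Qed.

Lemma Aalpha_contC al F : Aalpha al F -> contC F.
Proof. intros [[H _] _]. apply cont2_contC; auto. Qed.

Lemma Aalpha_periodic al F : Aalpha al F -> periodic2 F.
Proof. intros [[_ H] _]; auto. Qed.

Lemma Aalpha_coef al F m : Aalpha al F -> weight al m < 0 -> coef F m = RtoC 0.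
Proof.
  intros HF Hm. pose proof (Aalpha_contC _ _ HF) as HC. destruct HF as [_ H].
  destruct m as [m n]. symmetry. apply (fourier_coef_iff F m n); auto.
Qed.

Lemma Aalpha_intro al F : contC F -> periodic2 F -> (forall m, weight al m < 0 -> coef F m = RtoC 0) -> Aalpha al F.
Proof.
  intros HC HP H. split; [split; [apply cont2_contC; auto | auto]|].
  intros m n Hm. apply fourier_coef_iff; auto. symmetry; apply H; auto.
Qed.

(** The coefficients of a Fejer polynomial are multiples of those of F, so the entries of negative
    weight carry the coefficient 0 and can be filtered out without changing the values. *)
Lemma Aalpha_approx al F : Aalpha al F -> forall eps, 0 < eps ->
  exists p, analytic al p /\ near F (teval p) eps.
Proof.
  intros HF eps He. pose proof (Aalpha_contC _ _ HF) as HC. pose proof (Aalpha_periodic _ _ HF) as HP.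
  destruct (fejer_approx F HC HP eps He) as [n Hn].
  exists (filter (fun e => if Rle_dec 0 (weight al (snd e)) then true else false) (fejer F n)). split.
  - apply Forall_forall. intros e He'. apply filter_In in He'. destruct He' as [_ He'].
    destruct (Rle_dec 0 (weight al (snd e))); [auto | discriminate].
  - intros s t. replace (teval (filter _ (fejer F n)) s t) with (teval (fejer F n) s t); [apply Hn|].
    unfold fejer. generalize (RtoC (/ (INR (S n) * INR (S n)))). intros c.
    induction (list_prod (fejer_freqs n) (fejer_freqs n)) as [|m l IH]; [reflexivity|].
    simpl. destruct (Rle_dec 0 (weight al m)) as [L|L].
    + unfold teval in *; simpl. rewrite IH. reflexivity.
    + rewrite <- IH. unfold teval; simpl. rewrite (Aalpha_coef al F m HF) by lra. aring.
Qed.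

(** Continuity, periodicity and the vanishing of a coefficient all pass to uniform limits. With
    [Aalpha_approx] this turns membership into approximability, the form used from here on. *)
Lemma Aalpha_of_approx al F :
  (forall eps, 0 < eps -> exists p, analytic al p /\ near F (teval p) eps) -> Aalpha al F.
Proof.
  intros H.
  assert (HC : contC F).
  { apply contC_limit. intros e He. destruct (H e He) as [p [_ Hp]]. exists (teval p); split; auto. apply contC_teval. }
  apply Aalpha_intro; auto.
  - apply periodic_limit. intros e He. destruct (H e He) as [p [_ Hp]]. exists (teval p); split; auto. apply teval_periodic.
  - intros m Hm. apply C_eq_of_small. intros e He. destruct (H (e / 2)) as [p [Hp HN]]; [lra|].
    rewrite <- (coef_teval_neg al p m Hp Hm).
    rewrite <- coef_minus by (auto; apply contC_teval).
    eapply Rle_trans; [apply coef_bound with (r := e / 2)|lra].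
    + apply contC_minus; auto; apply contC_teval.
    + exact HN.
Qed.

Lemma teval_Aalpha al p : analytic al p -> Aalpha al (teval p).
Proof.
  intros Hp. apply Aalpha_of_approx. intros e He. exists p; split; auto.
  intros s t. replace (Cminus (teval p s t) (teval p s t)) with (RtoC 0) by aring. rewrite Cmod_0; lra.
Qed.

Lemma chi_Aalpha al m : 0 <= weight al m -> Aalpha al (chi m).
Proof.
  intros H. apply Aalpha_of_approx. intros e He. exists ((RtoC 1, m) :: nil). split.
  - constructor; auto.
  - intros s t. unfold teval; simpl.
    replace (Cminus (chi m s t) _) with (RtoC 0) by aring. rewrite Cmod_0; lra.
Qed.

(** All Fejer polynomials of F reduce to their constant terms, and they approximate F uniformly. *)
Lemma const_of_coef F : contC F -> periodic2 F -> (forall m, m <> (0, 0)%Z -> coef F m = RtoC 0) ->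
  forall s t s' t', F s t = F s' t'.
Proof.
  intros HC HP H.
  assert (E : forall n s t s' t', teval (fejer F n) s t = teval (fejer F n) s' t').
  { intros n s t s' t'. unfold fejer. generalize (RtoC (/ (INR (S n) * INR (S n)))). intros c. induction (list_prod (fejer_freqs n) (fejer_freqs n)) as [|m l IH]; [reflexivity|].
    unfold teval in *; simpl in *. rewrite IH. f_equal.
    destruct (freq_dec m (0, 0)%Z) as [->|Hm].
    - rewrite !chi_0. reflexivity.
    - rewrite H by auto. aring. }
  intros s t s' t'. apply C_eq_of_small. intros e He.
  destruct (fejer_approx F HC HP (e / 2)) as [n Hn]; [lra|].
  replace (Cminus (F s t) (F s' t')) with
    (Cminus (Cminus (F s t) (teval (fejer F n) s t)) (Cminus (F s' t') (teval (fejer F n) s' t')))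
    by (rewrite (E n s t s' t'); aring).
  eapply Rle_trans; [apply Cmod_triangle|]. rewrite Cmod_opp.
  pose proof (Hn s t). pose proof (Hn s' t'). lra.
Qed.

(** * Damping characters along the flow *)

Definition poly_mul (p q : tpoly) : tpoly :=
  flat_map (fun e => map (fun f => (Cmult (fst e) (fst f), freq_add (snd e) (snd f))) q) p.
Fixpoint poly_pow (p : tpoly) (n : nat) : tpoly :=
  match n with O => (RtoC 1, (0, 0)%Z) :: nil | S k => poly_mul p (poly_pow p k) end.

(** The condition under which [peval th] is multiplicative on formal polynomials; it is imposed on
    all frequencies, including those of negative weight. *)
Definition hom (th : Z * Z -> C) : Prop :=
  th (0, 0)%Z = RtoC 1 /\ forall m n, th (freq_add m n) = Cmult (th m) (th n).

Lemma peval_pmul1 th e q : hom th ->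
  peval th (map (fun f => (Cmult (fst e) (fst f), freq_add (snd e) (snd f))) q) =
  Cmult (Cmult (fst e) (th (snd e))) (peval th q).
Proof.
  intros [_ H]. induction q as [|f q IH]; simpl; [ring|].
  rewrite IH, H. ring.
Qed.

Lemma peval_poly_mul th p q : hom th -> peval th (poly_mul p q) = Cmult (peval th p) (peval th q).
Proof.
  intros H. induction p as [|e p IH]; simpl; [ring|].
  rewrite peval_app, IH, peval_pmul1 by auto. ring.
Qed.

Lemma peval_poly_pow th p n : hom th -> peval th (poly_pow p n) = Cpow (peval th p) n.
Proof.
  intros H. induction n as [|n IH]; simpl.
  - rewrite (proj1 H). ring.
  - rewrite peval_poly_mul, IH by auto. reflexivity.
Qed.

Lemma hom_chi s t : hom (fun m => chi m s t).
Proof. split; [apply chi_0 | intros; apply chi_add]. Qed.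

Lemma teval_poly_mul p q s t : teval (poly_mul p q) s t = Cmult (teval p s t) (teval q s t).
Proof. apply peval_poly_mul, hom_chi. Qed.
Lemma teval_poly_pow p n s t : teval (poly_pow p n) s t = Cpow (teval p s t) n.
Proof. apply peval_poly_pow, hom_chi. Qed.

Lemma analytic_app al p q : analytic al p -> analytic al q -> analytic al (p ++ q).
Proof. intros; apply Forall_app; split; auto. Qed.

Lemma analytic_poly_mul al p q : analytic al p -> analytic al q -> analytic al (poly_mul p q).
Proof.
  intros Hp Hq. induction Hp as [|e p He Hp IH]; simpl; [constructor|].
  apply analytic_app; auto. clear IH. induction Hq as [|f q Hf Hq IH]; simpl; constructor; auto.
  simpl. rewrite weight_add. lra.
Qed.

Lemma analytic_poly_pow al p n : analytic al p -> analytic al (poly_pow p n).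
Proof.
  intros Hp. induction n as [|n IH]; simpl.
  - constructor; [|constructor]. unfold weight; simpl. lra.
  - apply analytic_poly_mul; auto.
Qed.

(** * Degree bounds and sums over boxes of frequencies *)

Definition degle (D : nat) (p : tpoly) : Prop :=
  List.Forall (fun e => (Z.abs (fst (snd e)) <= Z.of_nat D /\ Z.abs (snd (snd e)) <= Z.of_nat D)%Z) p.

Lemma degle_exists p : exists D, degle D p.
Proof.
  induction p as [|e p [D IH]]; [exists O; constructor|].
  exists (D + Z.to_nat (Z.abs (fst (snd e))) + Z.to_nat (Z.abs (snd (snd e))))%nat.
  constructor; [lia|]. eapply Forall_impl; [|exact IH]. simpl. intros; lia.
Qed.

Lemma degle_poly_mul D1 D2 p q : degle D1 p -> degle D2 q -> degle (D1 + D2) (poly_mul p q).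
Proof.
  intros Hp Hq. induction Hp as [|e p He Hp IH]; simpl; [constructor|].
  apply Forall_app; split; auto. clear IH. induction Hq as [|f q Hf Hq IH]; simpl; constructor; auto.
  unfold freq_add; simpl. lia.
Qed.

Lemma degle_poly_pow D p n : degle D p -> degle (n * D) (poly_pow p n).
Proof.
  intros Hp. induction n as [|n IH]; simpl.
  - constructor; [simpl; lia|constructor].
  - apply degle_poly_mul; auto.
Qed.

Definition Z_interval (D : nat) : list Z := map (fun k => (Z.of_nat k - Z.of_nat D)%Z) (seq 0 (2 * D + 1)).
Definition box (D : nat) : list (Z * Z) := list_prod (Z_interval D) (Z_interval D).

Lemma NoDup_Z_interval D : NoDup (Z_interval D).
Proof. apply Injective_map_NoDup; [intros x y H; lia | apply seq_NoDup]. Qed.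

Lemma in_Z_interval D j : In j (Z_interval D) <-> (Z.abs j <= Z.of_nat D)%Z.
Proof.
  unfold Z_interval. rewrite in_map_iff. split.
  - intros [k [<- Hk]]. apply in_seq in Hk. lia.
  - intros H. exists (Z.to_nat (j + Z.of_nat D)). split; [lia|]. apply in_seq. lia.
Qed.

Lemma NoDup_list_prod {A B : Type} (l : list A) (l' : list B) : NoDup l -> NoDup l' -> NoDup (list_prod l l').
Proof.
  intros Hl Hl'. induction Hl as [|a l Ha Hl IH]; simpl; [constructor|].
  apply NoDup_app; auto.
  - apply Injective_map_NoDup; auto. intros x y H. injection H; auto.
  - intros [x y] H1 H2. apply in_map_iff in H1. destruct H1 as [z [E Hz]]. injection E as -> ->.
    apply in_prod_iff in H2. tauto.
Qed.

Definition Csum {A : Type} (f : A -> C) (l : list A) : C := fold_right (fun a acc => Cplus (f a) acc) (RtoC 0) l.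

Lemma Csum_plus {A : Type} (f g : A -> C) l : Csum (fun a => Cplus (f a) (g a)) l = Cplus (Csum f l) (Csum g l).
Proof. induction l as [|a l IH]; simpl; [ring | rewrite IH; ring]. Qed.
Lemma Csum_ext {A : Type} (f g : A -> C) l : (forall a, f a = g a) -> Csum f l = Csum g l.
Proof. intros E; induction l as [|a l IH]; simpl; [auto | rewrite IH, E; auto]. Qed.

Lemma Cmod_Csum {A : Type} (f : A -> C) l r : (forall a, In a l -> Cmod (f a) <= r) -> Cmod (Csum f l) <= INR (length l) * r.
Proof.
  induction l as [|a l IH]; intros H.
  - simpl. rewrite Cmod_0. lra.
  - change (Csum f (a :: l)) with (Cplus (f a) (Csum f l)). change (length (a :: l)) with (S (length l)).
    rewrite S_INR. eapply Rle_trans; [apply Cmod_triangle|].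
    assert (Cmod (f a) <= r) by (apply H; left; auto).
    assert (Cmod (Csum f l) <= INR (length l) * r) by (apply IH; intros; apply H; right; auto). lra.
Qed.

Lemma Csum_single (th : Z * Z -> C) a (m : Z * Z) l : NoDup l -> In m l ->
  Csum (fun n => Cmult (if freq_dec m n then a else RtoC 0) (th n)) l = Cmult a (th m).
Proof.
  intros Hl. induction Hl as [|n l Hn Hl IH]; intros Hm; [destruct Hm|]. simpl.
  destruct (freq_dec m n) as [->|E].
  - assert (Z0 : Csum (fun k => Cmult (if freq_dec n k then a else RtoC 0) (th k)) l = RtoC 0).
    { clear IH Hm Hl. induction l as [|k l IH]; simpl; auto.
      destruct (freq_dec n k) as [->|_]; [exfalso; apply Hn; left; auto|].
      rewrite IH; [ring | intros H; apply Hn; right; auto]. }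
    rewrite Z0. ring.
  - destruct Hm as [->|Hm]; [congruence|]. rewrite IH by auto. ring.
Qed.

(** A list may repeat frequencies, and its individual entries are not controlled by the sup norm.
    Summing over the box collects repeated entries into true Fourier coefficients, which are. *)
Lemma peval_box th p D : degle D p -> peval th p = Csum (fun m => Cmult (coef (teval p) m) (th m)) (box D).
Proof.
  intros H. rewrite (Csum_ext _ (fun m => Cmult (fold_right (fun e acc => Cplus (if freq_dec (snd e) m then fst e else RtoC 0) acc) (RtoC 0) p) (th m)))
    by (intros; rewrite coef_teval; reflexivity).
  induction H as [|e p He Hp IH]; simpl.
  - induction (box D) as [|m l IH]; simpl; [auto | rewrite <- IH; ring].
  - rewrite IH. rewrite <- (Csum_single th (fst e) (snd e) (box D)).
    + rewrite <- Csum_plus. apply Csum_ext. intros m. ring.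
    + apply NoDup_list_prod; apply NoDup_Z_interval.
    + destruct e as [a [j k]]. apply in_prod_iff. simpl in He. split; apply in_Z_interval; simpl; lia.
Qed.

Lemma length_box D : INR (length (box D)) = (2 * INR D + 1) ^ 2.
Proof.
  unfold box, Z_interval. rewrite length_prod, !length_map, !length_seq, mult_INR, plus_INR, mult_INR. simpl. ring.
Qed.

(** There are (2 D + 1)^2 collected coefficients, each at most 2 r in modulus, and those of negative
    weight vanish, so [th] only matters on the half-plane. *)
Lemma peval_crude_bound al th p D r B : degle D p -> analytic al p -> (forall s t, Cmod (teval p s t) <= r) ->
  0 <= B -> (forall m, 0 <= weight al m -> Cmod (th m) <= B) -> Cmod (peval th p) <= (2 * INR D + 1) ^ 2 * (2 * r * B).
Proof.
  intros HD Hp Hr HB Hth. rewrite (peval_box th p D HD), <- length_box. apply Cmod_Csum.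
  intros m _. assert (r0 : 0 <= r) by (eapply Rle_trans; [apply Cmod_ge_0 | apply (Hr 0 0)]).
  destruct (Rle_dec 0 (weight al m)) as [L|L].
  - rewrite Cmod_mult. apply Rmult_le_compat; try apply Cmod_ge_0; auto.
    apply coef_bound; auto. apply contC_teval.
  - rewrite (coef_teval_neg al p m) by (auto; lra). rewrite Cmult_0_l, Cmod_0.
    apply Rmult_le_pos; auto. lra.
Qed.

(** A polynomial factor does not survive n-th roots. Concretely, if z = x / y > 1 then z^(3k) grows
    at least like k^3, which beats the quadratic factor. *)
Lemma pow_bound_le x y K : 0 <= x -> 0 <= y -> (forall n : nat, x ^ n <= K * (INR n + 1) ^ 2 * y ^ n) -> x <= y.
Proof.
  intros Hx Hy H. destruct (Rle_lt_dec x y) as [L|L]; auto. exfalso.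
  destruct Hy as [Hy|<-].
  2: { specialize (H 1%nat). simpl in H. lra. }
  set (z := x / y).
  assert (Hz : 1 < z). { unfold z. apply Rmult_lt_reg_r with y; auto. unfold Rdiv. rewrite Rmult_assoc, Rinv_l; lra. }
  assert (H' : forall n, z ^ n <= K * (INR n + 1) ^ 2).
  { intros n. unfold z, Rdiv. rewrite Rpow_mult_distr, pow_inv.
    assert (0 < y ^ n) by (apply pow_lt; auto).
    apply Rmult_le_reg_r with (y ^ n); auto.
    replace (x ^ n * / y ^ n * y ^ n) with (x ^ n) by (field; lra). apply H. }
  set (h := z - 1). assert (Hh : 0 < h) by (unfold h; lra).
  assert (KK : 1 <= K) by (specialize (H' O); simpl in H'; lra).
  (* Along n = 3 k, Bernoulli's inequality gives z^n >= (k h)^3, while (3 k + 1)^2 <= 16 k^2;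
     division by k^2 bounds k h^3 for all k. *)
  assert (G : forall k : nat, (1 <= k)%nat -> INR k * h ^ 3 <= 16 * K).
  { intros k Hk. specialize (H' (k * 3)%nat).
    rewrite pow_mult in H'.
    assert (B1 : INR k * h <= z ^ k).
    { replace z with (1 + h) by (unfold h; ring).
      pose proof (poly k h Hh). lra. }
    assert (Hk' : 1 <= INR k) by (change 1 with (INR 1); apply le_INR; auto).
    assert (B2 : (INR k * h) ^ 3 <= (z ^ k) ^ 3) by (apply pow_incr; split; auto; nra).
    rewrite mult_INR in H'. simpl INR in H'.
    assert (B3 : K * (INR k * (1 + 1 + 1) + 1) ^ 2 <= K * (16 * INR k ^ 2)).
    { apply Rmult_le_compat_l; [lra|]. nra. }
    apply Rmult_le_reg_l with (INR k ^ 2); [apply pow_lt; lra|].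
    rewrite Rpow_mult_distr in B2.
    replace (INR k ^ 2 * (INR k * h ^ 3)) with (INR k ^ 3 * h ^ 3) by ring. lra. }
  assert (H3 : 0 < h ^ 3) by (apply pow_lt; auto).
  destruct (archimed (16 * K / h ^ 3)) as [A1 _].
  assert (P : 0 < 16 * K / h ^ 3) by (apply Rdiv_lt_0_compat; lra).
  assert (UP : (0 < up (16 * K / h ^ 3))%Z) by (apply lt_IZR; lra).
  specialize (G (Z.to_nat (up (16 * K / h ^ 3)))).
  rewrite INR_IZR_INZ, Z2Nat.id in G by lia.
  assert (16 * K < IZR (up (16 * K / h ^ 3)) * h ^ 3).
  { apply Rmult_lt_reg_r with (/ h ^ 3); [apply Rinv_0_lt_compat; auto|].
    replace (IZR (up (16 * K / h ^ 3)) * h ^ 3 * / h ^ 3) with (IZR (up (16 * K / h ^ 3))) by (field; lra). exact A1. }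
  assert ((1 <= Z.to_nat (up (16 * K / h ^ 3)))%nat) by lia. specialize (G H1). lra.
Qed.

Lemma degree_factor_le (n D : nat) : (2 * INR (n * D) + 1) ^ 2 <= (2 * INR D + 1) ^ 2 * (INR n + 1) ^ 2.
Proof.
  rewrite mult_INR, <- Rpow_mult_distr. pose proof (pos_INR n). pose proof (pos_INR D).
  apply pow_incr. split; nra.
Qed.

(* Spectral radius: a bound polynomial in the degree, applied to all powers of [p], improves to norm 1. *)
Lemma peval_contraction al th p r : hom th -> analytic al p -> (forall s t, Cmod (teval p s t) <= r) ->
  (forall m, 0 <= weight al m -> Cmod (th m) <= 1) -> Cmod (peval th p) <= r.
Proof.
  intros Hh Hp Hr Hth. assert (r0 : 0 <= r) by (eapply Rle_trans; [apply Cmod_ge_0 | apply (Hr 0 0)]).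
  destruct (degle_exists p) as [D HD].
  apply (pow_bound_le _ _ ((2 * INR D + 1) ^ 2 * 2)); auto; [apply Cmod_ge_0|].
  intros n. rewrite <- Cmod_pow, <- peval_poly_pow by auto.
  eapply Rle_trans.
  - apply (peval_crude_bound al th (poly_pow p n) (n * D) (r ^ n) 1); auto; try lra.
    + apply degle_poly_pow; auto.
    + apply analytic_poly_pow; auto.
    + intros s t. rewrite teval_poly_pow, Cmod_pow. apply pow_incr. split; [apply Cmod_ge_0 | auto].
  - assert (0 <= r ^ n) by (apply pow_le; auto).
    pose proof (degree_factor_le n D). nra.
Qed.

(** The derivative in the direction (1, al) with its factor i left out; [is_derive_damped_chi]
    restores that factor. *)
Definition flow_deriv (al : R) (p : tpoly) : tpoly := map (fun e => (Cmult (RtoC (weight al (snd e))) (fst e), snd e)) p.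
Fixpoint flow_deriv_iter (al : R) (n : nat) (p : tpoly) : tpoly := match n with O => p | S k => flow_deriv_iter al k (flow_deriv al p) end.

Lemma peval_flow_deriv th al p : peval th (flow_deriv al p) = peval (fun m => Cmult (RtoC (weight al m)) (th m)) p.
Proof. induction p as [|e p IH]; simpl; [auto | rewrite IH; ring]. Qed.

Lemma peval_flow_deriv_iter th al n p : peval th (flow_deriv_iter al n p) = peval (fun m => Cmult (RtoC (weight al m ^ n)) (th m)) p.
Proof.
  revert p. induction n as [|n IH]; intros p; simpl.
  - apply peval_ext. intros; ring.
  - rewrite IH, peval_flow_deriv. apply peval_ext. intros e _. rewrite RtoC_mult. ring.
Qed.

Lemma leibniz th al p q : peval th (flow_deriv al (poly_mul p q)) = Cplus (peval th (poly_mul (flow_deriv al p) q)) (peval th (poly_mul p (flow_deriv al q))).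
Proof.
  rewrite peval_flow_deriv. induction p as [|e p IH]; simpl; [ring|].
  rewrite !peval_app, IH.
  assert (E : peval (fun m => Cmult (RtoC (weight al m)) (th m)) (map (fun f => (Cmult (fst e) (fst f), freq_add (snd e) (snd f))) q) =
    Cplus (peval th (map (fun f => (Cmult (Cmult (RtoC (weight al (snd e))) (fst e)) (fst f), freq_add (snd e) (snd f))) q))
      (peval th (map (fun f => (Cmult (fst e) (fst f), freq_add (snd e) (snd f))) (flow_deriv al q)))).
  { clear IH. induction q as [|f q IH]; simpl; [ring|]. rewrite IH, weight_add, RtoC_plus. ring. }
  rewrite E. ring.
Qed.

Lemma leibniz_flow_deriv_iter th al l p q : peval th (flow_deriv_iter al (S l) (poly_mul p q)) =
  Cplus (peval th (flow_deriv_iter al l (poly_mul (flow_deriv al p) q))) (peval th (flow_deriv_iter al l (poly_mul p (flow_deriv al q)))).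
Proof. simpl. rewrite !peval_flow_deriv_iter. apply leibniz. Qed.

(** A zero of order at least [a], in the flow direction, at the point that [th] represents. *)
Definition vanish (th : Z * Z -> C) (al : R) (a : nat) (p : tpoly) : Prop :=
  forall j, (j < a)%nat -> peval th (flow_deriv_iter al j p) = RtoC 0.

Lemma vanish_flow_deriv th al a p : vanish th al a p -> vanish th al (Nat.pred a) (flow_deriv al p).
Proof. intros H j Hj. apply (H (S j)). lia. Qed.

(** Orders of vanishing add: each application of the Leibniz rule lowers the order of one factor by
    one, and after fewer than a + b of them a zero is left in every term. *)
Lemma vanish_poly_mul th al : hom th -> forall l a b p q, vanish th al a p -> vanish th al b q -> (l < a + b)%nat ->
  peval th (flow_deriv_iter al l (poly_mul p q)) = RtoC 0.
Proof.
  intros Hh. induction l as [|l IH]; intros a b p q Hp Hq Hl.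
  - simpl. rewrite peval_poly_mul by auto. destruct a as [|a].
    + assert (E : peval th q = RtoC 0) by (apply (Hq O); lia). rewrite E. ring.
    + assert (E : peval th p = RtoC 0) by (apply (Hp O); lia). rewrite E. ring.
  - rewrite leibniz_flow_deriv_iter.
    rewrite (IH (Nat.pred a) b (flow_deriv al p) q), (IH a (Nat.pred b) p (flow_deriv al q)); auto; try (apply vanish_flow_deriv; auto); try lia.
    ring.
Qed.

Lemma lead_pmul0 th al : hom th -> forall b p q, vanish th al b q ->
  peval th (flow_deriv_iter al b (poly_mul p q)) = Cmult (peval th p) (peval th (flow_deriv_iter al b q)).
Proof.
  intros Hh. induction b as [|b IH]; intros p q Hq.
  - simpl. apply peval_poly_mul; auto.
  - rewrite leibniz_flow_deriv_iter. rewrite (vanish_poly_mul th al Hh b 0 (S b) (flow_deriv al p) q) by (auto; try lia; intros j Hj; lia).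
    rewrite IH by (apply (vanish_flow_deriv th al (S b)); auto). simpl. ring.
Qed.

(** Only the terms of the Leibniz expansion that differentiate p exactly once survive, and there are
    b + 1 of them. Iterated, this factor becomes the factorial in [lead_poly_pow]. *)
Lemma lead_pmul1 th al : hom th -> forall b p q, peval th p = RtoC 0 -> vanish th al b q ->
  peval th (flow_deriv_iter al (S b) (poly_mul p q)) = Cmult (RtoC (INR (S b))) (Cmult (peval th (flow_deriv al p)) (peval th (flow_deriv_iter al b q))).
Proof.
  intros Hh. induction b as [|b IH]; intros p q Hp Hq.
  - rewrite leibniz_flow_deriv_iter. simpl flow_deriv_iter. rewrite !peval_poly_mul, Hp by auto. simpl INR. ring.
  - rewrite leibniz_flow_deriv_iter. rewrite lead_pmul0 by auto.
    rewrite IH by (auto; apply (vanish_flow_deriv th al (S b)); auto).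
    rewrite (S_INR (S b)), RtoC_plus. simpl flow_deriv_iter. ring.
Qed.

Lemma vanish_poly_pow th al p n : hom th -> peval th p = RtoC 0 -> vanish th al n (poly_pow p n).
Proof.
  intros Hh Hp. induction n as [|n IH]; [intros j Hj; lia|].
  intros j Hj. apply (vanish_poly_mul th al Hh j 1 n); auto.
  intros k Hk. replace k with O by lia. exact Hp.
Qed.

Lemma lead_poly_pow th al p n : hom th -> peval th p = RtoC 0 ->
  peval th (flow_deriv_iter al n (poly_pow p n)) = Cmult (RtoC (INR (fact n))) (Cpow (peval th (flow_deriv al p)) n).
Proof.
  intros Hh Hp. induction n as [|n IH].
  - simpl. rewrite (proj1 Hh). ring.
  - change (poly_pow p (S n)) with (poly_mul p (poly_pow p n)).
    rewrite lead_pmul1, IH by (auto; apply vanish_poly_pow; auto).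
    change (fact (S n)) with (S n * fact n)%nat. rewrite mult_INR, RtoC_mult, Cpow_S. ring.
Qed.

(* The character [m] at height [c] of the half-plane attached to the flow line through (s,t). *)
Definition damped_chi (al c s t : R) (m : Z * Z) : C := Cmult (RtoC (exp (- (c * weight al m)))) (chi m s t).

Lemma hom_damped_chi al c s t : hom (damped_chi al c s t).
Proof.
  split; unfold damped_chi.
  - rewrite chi_0. replace (- (c * weight al (0, 0)%Z)) with 0 by (unfold weight; simpl; ring).
    rewrite exp_0. ring.
  - intros m n. rewrite chi_add, weight_add.
    replace (- (c * (weight al m + weight al n))) with (- (c * weight al m) + - (c * weight al n)) by ring.
    rewrite exp_plus, RtoC_mult. aring.
Qed.

Lemma Cmod_damped_chi al c s t m : Cmod (damped_chi al c s t m) = exp (- (c * weight al m)).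
Proof.
  unfold damped_chi. rewrite Cmod_mult, Cmod_chi, Cmod_R, Rmult_1_r. apply Rabs_pos_eq. left; apply exp_pos.
Qed.

Lemma exp_neg_le_1 x : 0 <= x -> exp (- x) <= 1.
Proof.
  intros H. rewrite <- exp_0. destruct H as [H|<-].
  - left; apply exp_increasing; lra.
  - rewrite Ropp_0; right; auto.
Qed.

(** One term of the exponential series. With x = c w it bounds the n-th flow derivative of a damped
    character, uniformly over the weights w >= 0. *)
Lemma pow_fact_exp x n : 0 <= x -> x ^ n * exp (- x) <= INR (fact n).
Proof.
  intros Hx.
  assert (H : x ^ n / INR (fact n) <= exp x).
  { eapply Rle_trans; [|apply (exp_ge_taylor x n Hx)].
    assert (P : forall k, 0 <= x ^ k / INR (fact k)).
    { intros k. apply Rmult_le_pos; [apply pow_le; auto|]. left; apply Rinv_0_lt_compat, INR_fact_lt_0. }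
    destruct n as [|n]; [simpl; lra|]. rewrite tech5.
    assert (0 <= sum_f_R0 (fun k => x ^ k / INR (fact k)) n) by (apply cond_pos_sum; auto). lra. }
  pose proof (INR_fact_lt_0 n). pose proof (exp_pos x). rewrite exp_Ropp.
  apply Rmult_le_reg_r with (exp x); auto.
  rewrite Rmult_assoc, Rinv_l, Rmult_1_r by lra.
  apply Rmult_le_reg_r with (/ INR (fact n)); [apply Rinv_0_lt_compat; auto|].
  replace (INR (fact n) * exp x * / INR (fact n)) with (exp x) by (field; lra). exact H.
Qed.

(* If p vanishes at the point, the n-th derivative of p^n there is n! p'^n, while
   w^n e^(-cw) <= n!/c^n; comparing n-th roots gives a Schwarz-type bound. *)
Lemma derivative_bound0 al c s t p r : 0 < c -> analytic al p -> (forall s t, Cmod (teval p s t) <= r) ->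
  peval (damped_chi al c s t) p = RtoC 0 -> c * Cmod (peval (damped_chi al c s t) (flow_deriv al p)) <= r.
Proof.
  intros Hc Hp Hr Hz. assert (r0 : 0 <= r) by (eapply Rle_trans; [apply Cmod_ge_0 | apply (Hr 0 0)]).
  destruct (degle_exists p) as [D HD]. set (th := damped_chi al c s t) in *.
  assert (Hh : hom th) by apply hom_damped_chi.
  apply (pow_bound_le _ _ ((2 * INR D + 1) ^ 2 * 2)); auto.
  { apply Rmult_le_pos; [lra | apply Cmod_ge_0]. }
  intros n. pose proof (INR_fact_lt_0 n) as Hf.
  assert (Hcn : 0 < c ^ n) by (apply pow_lt; auto).
  assert (B : Cmod (peval th (flow_deriv_iter al n (poly_pow p n))) <= (2 * INR (n * D) + 1) ^ 2 * (2 * r ^ n * (INR (fact n) / c ^ n))).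
  { rewrite peval_flow_deriv_iter. apply (peval_crude_bound al); auto.
    - apply degle_poly_pow; auto.
    - apply analytic_poly_pow; auto.
    - intros s' t'. rewrite teval_poly_pow, Cmod_pow. apply pow_incr. split; [apply Cmod_ge_0 | auto].
    - apply Rmult_le_pos; [lra|]. left; apply Rinv_0_lt_compat; auto.
    - intros m Hm. unfold th. rewrite Cmod_mult, Cmod_damped_chi, Cmod_R, Rabs_pos_eq by (apply pow_le; auto).
      apply Rmult_le_reg_r with (c ^ n); auto. unfold Rdiv. rewrite Rmult_assoc with (r1 := INR (fact n)), Rinv_l, Rmult_1_r by lra.
      replace (weight al m ^ n * exp (- (c * weight al m)) * c ^ n) with ((c * weight al m) ^ n * exp (- (c * weight al m)))
        by (rewrite Rpow_mult_distr; ring).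
      apply pow_fact_exp. apply Rmult_le_pos; lra. }
  rewrite (lead_poly_pow th al p n Hh Hz), Cmod_mult, Cmod_R, Cmod_pow, (Rabs_pos_eq (INR (fact n))) in B by lra.
  rewrite Rpow_mult_distr.
  assert (B' : c ^ n * Cmod (peval th (flow_deriv al p)) ^ n <= (2 * INR (n * D) + 1) ^ 2 * (2 * r ^ n)).
  { apply Rmult_le_reg_l with (INR (fact n) / c ^ n); [apply Rdiv_lt_0_compat; auto|].
    replace (INR (fact n) / c ^ n * (c ^ n * Cmod (peval th (flow_deriv al p)) ^ n)) with (INR (fact n) * Cmod (peval th (flow_deriv al p)) ^ n) by (field; lra).
    lra. }
  eapply Rle_trans; [exact B'|].
  assert (0 <= r ^ n) by (apply pow_le; auto).
  pose proof (degree_factor_le n D). nra.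
Qed.

Lemma damped_chi_contraction al c s t p r : 0 <= c -> analytic al p -> (forall s t, Cmod (teval p s t) <= r) ->
  Cmod (peval (damped_chi al c s t) p) <= r.
Proof.
  intros Hc Hp Hr. apply (peval_contraction al); auto; [apply hom_damped_chi|].
  intros m Hm. rewrite Cmod_damped_chi. apply exp_neg_le_1. apply Rmult_le_pos; auto.
Qed.

(** Subtracting the value z as a term of frequency 0 creates a zero at the point, leaves the flow
    derivative unchanged because that frequency has weight 0, and at most doubles the sup norm. *)
Lemma derivative_bound al c s t p r : 0 < c -> analytic al p -> (forall s t, Cmod (teval p s t) <= r) ->
  c * Cmod (peval (damped_chi al c s t) (flow_deriv al p)) <= 2 * r.
Proof.
  intros Hc Hp Hr. set (z := peval (damped_chi al c s t) p).
  assert (Hz : Cmod z <= r) by (apply damped_chi_contraction; auto; lra).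
  pose proof (proj1 (hom_damped_chi al c s t)) as H0.
  pose proof (derivative_bound0 al c s t ((Copp z, (0, 0)%Z) :: p) (2 * r) Hc) as H.
  assert (E : peval (damped_chi al c s t) (flow_deriv al ((Copp z, (0, 0)%Z) :: p)) = peval (damped_chi al c s t) (flow_deriv al p)).
  { simpl. unfold weight at 1; simpl. rewrite Rmult_0_r, Rplus_0_l. ring. }
  rewrite E in H. apply H.
  - constructor; auto. unfold weight; simpl; lra.
  - intros s' t'. unfold teval. simpl. rewrite chi_0. eapply Rle_trans; [apply Cmod_triangle|].
    rewrite Cmult_1_r, Cmod_opp. specialize (Hr s' t'). unfold teval in Hr. lra.
  - simpl. rewrite H0. fold z. ring.
Qed.

(** Multiplication by i turns the pair of components of [flow_deriv] into (- snd, fst). *)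
Lemma is_derive_damped_chi al c s t x p :
  is_derive (fun x => fst (peval (damped_chi al c (s + x) (t + al * x)) p)) x
    (- snd (peval (damped_chi al c (s + x) (t + al * x)) (flow_deriv al p))) /\
  is_derive (fun x => snd (peval (damped_chi al c (s + x) (t + al * x)) p)) x
    (fst (peval (damped_chi al c (s + x) (t + al * x)) (flow_deriv al p))).
Proof.
  induction p as [|e p [IH1 IH2]].
  - simpl. rewrite Ropp_0. split; apply (@is_derive_const R_AbsRing R_NormedModule).
  - simpl. set (m := snd e). set (a := fst e).
    set (k := exp (- (c * weight al m))).
    assert (D1 : is_derive (fun x => cos (IZR (fst m) * (s + x) + IZR (snd m) * (t + al * x))) x
      (- weight al m * sin (IZR (fst m) * (s + x) + IZR (snd m) * (t + al * x)))).
    { auto_derive; auto. unfold weight; ring. }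
    assert (D2 : is_derive (fun x => sin (IZR (fst m) * (s + x) + IZR (snd m) * (t + al * x))) x
      (weight al m * cos (IZR (fst m) * (s + x) + IZR (snd m) * (t + al * x)))).
    { auto_derive; auto. unfold weight; ring. }
    set (cx := fun x => cos (IZR (fst m) * (s + x) + IZR (snd m) * (t + al * x))) in *.
    set (sx := fun x => sin (IZR (fst m) * (s + x) + IZR (snd m) * (t + al * x))) in *.
    set (f1 := fun x => fst (peval (damped_chi al c (s + x) (t + al * x)) p)) in *.
    set (f2 := fun x => snd (peval (damped_chi al c (s + x) (t + al * x)) p)) in *.
    split.
    + apply is_derive_ext with (fun x => (fst a * k * cx x - snd a * k * sx x) + f1 x).
      { intros y. unfold f1, cx, sx, k. simpl. ring. }
      match goal with |- is_derive _ _ ?l => replace l with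
        ((fst a * k * (- weight al m * sx x) - snd a * k * (weight al m * cx x)) + - snd (peval (damped_chi al c (s + x) (t + al * x)) (flow_deriv al p))) end.
      * apply (@is_derive_plus R_AbsRing R_NormedModule); auto.
        apply (@is_derive_minus R_AbsRing R_NormedModule); apply is_derive_scal; auto.
      * unfold cx, sx, k. simpl. ring.
    + apply is_derive_ext with (fun x => (fst a * k * sx x + snd a * k * cx x) + f2 x).
      { intros y. unfold f2, cx, sx, k. simpl. ring. }
      match goal with |- is_derive _ _ ?l => replace l with
        ((fst a * k * (weight al m * cx x) + snd a * k * (- weight al m * sx x)) + fst (peval (damped_chi al c (s + x) (t + al * x)) (flow_deriv al p))) end.
      * apply (@is_derive_plus R_AbsRing R_NormedModule); auto.
        apply (@is_derive_plus R_AbsRing R_NormedModule); apply is_derive_scal; auto.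
      * unfold cx, sx, k. simpl. ring.
Qed.

(** The mean value inequality gives 2 r / c for each component, and the two are added. *)
Lemma damped_chi_lipschitz al c s t p r x : 0 < c -> analytic al p -> (forall s t, Cmod (teval p s t) <= r) ->
  Cmod (Cminus (peval (damped_chi al c (s + x) (t + al * x)) p) (peval (damped_chi al c s t) p)) <= 4 * r / c * Rabs x.
Proof.
  intros Hc Hp Hr. eapply Rle_trans; [apply Cmod_le_sum|].
  assert (E : damped_chi al c s t = damped_chi al c (s + 0) (t + al * 0)) by (f_equal; ring). rewrite E.
  assert (DB : forall y, Cmod (peval (damped_chi al c (s + y) (t + al * y)) (flow_deriv al p)) <= 2 * r / c).
  { intros y. apply Rmult_le_reg_l with c; auto. replace (c * (2 * r / c)) with (2 * r) by (field; lra).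
    apply derivative_bound; auto. }
  assert (V1 : Rabs (fst (peval (damped_chi al c (s + x) (t + al * x)) p) - fst (peval (damped_chi al c (s + 0) (t + al * 0)) p)) <= 2 * r / c * Rabs (x - 0)).
  { apply (bounded_variation (fun x => fst (peval (damped_chi al c (s + x) (t + al * x)) p))
      (fun x => - snd (peval (damped_chi al c (s + x) (t + al * x)) (flow_deriv al p)))).
    intros y _. split; [apply is_derive_damped_chi|]. rewrite Rabs_Ropp. eapply Rle_trans; [apply Rabs_snd_le|apply DB]. }
  assert (V2 : Rabs (snd (peval (damped_chi al c (s + x) (t + al * x)) p) - snd (peval (damped_chi al c (s + 0) (t + al * 0)) p)) <= 2 * r / c * Rabs (x - 0)).
  { apply (bounded_variation (fun x => snd (peval (damped_chi al c (s + x) (t + al * x)) p))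
      (fun x => fst (peval (damped_chi al c (s + x) (t + al * x)) (flow_deriv al p)))).
    intros y _. split; [apply is_derive_damped_chi|]. eapply Rle_trans; [apply Rabs_fst_le|apply DB]. }
  rewrite Rminus_0_r in V1, V2. simpl. unfold Rminus in *.
  replace (4 * r / c * Rabs x) with (2 * r / c * Rabs x + 2 * r / c * Rabs x) by (field; lra). lra.
Qed.

(** * Damping as an operation on functions *)

Definition damped (al c : R) (p : tpoly) : fn := fun s t => peval (damped_chi al c s t) p.

(* [G] is the uniform limit of the damped polynomials whose undamped versions tend to [F]. *)
Definition damping (al c : R) (F G : fn) : Prop :=
  forall eps, 0 < eps -> exists p, analytic al p /\ near F (teval p) eps /\ near G (damped al c p) eps.

Definition poly_opp (p : tpoly) : tpoly := map (fun e => (Copp (fst e), snd e)) p.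

Lemma peval_poly_opp th p : peval th (poly_opp p) = Copp (peval th p).
Proof. induction p as [|e p IH]; simpl; [ring | rewrite IH; ring]. Qed.

Lemma analytic_poly_opp al p : analytic al p -> analytic al (poly_opp p).
Proof. intros H. induction H; simpl; constructor; auto. Qed.

(** The contraction is applied to the formal difference of the two polynomials. This is what makes
    damping depend on the function and not on the polynomial chosen to approximate it. *)
Lemma near_damped al c p q e : 0 <= c -> analytic al p -> analytic al q -> near (teval p) (teval q) e ->
  near (damped al c p) (damped al c q) e.
Proof.
  intros Hc Hp Hq H s t.
  replace (Cminus (damped al c p s t) (damped al c q s t)) with (peval (damped_chi al c s t) (p ++ poly_opp q)).
  - apply damped_chi_contraction; auto.
    + apply analytic_app; auto. apply analytic_poly_opp; auto.
    + intros s' t'. unfold teval. rewrite peval_app, peval_poly_opp. apply H.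
  - rewrite peval_app, peval_poly_opp. reflexivity.
Qed.

Lemma near_bound F G e r : near F G e -> (forall s t, Cmod (F s t) <= r) -> forall s t, Cmod (G s t) <= r + e.
Proof.
  intros H HF s t. replace (G s t) with (Cplus (F s t) (Copp (Cminus (F s t) (G s t)))) by aring.
  eapply Rle_trans; [apply Cmod_triangle|]. rewrite Cmod_opp.
  specialize (H s t). specialize (HF s t). lra.
Qed.

Lemma le_epsilon_scaled x y K : 0 <= K -> (forall eps, 0 < eps -> eps <= 1 -> x <= y + K * eps) -> x <= y.
Proof.
  intros HK H. apply le_epsilon. intros e He.
  set (d := Rmin 1 (e / (K + 1))).
  assert (0 < e / (K + 1)) by (apply Rdiv_lt_0_compat; lra).
  assert (Hd : 0 < d) by (apply Rmin_pos; lra).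
  assert (Hd2 : d <= e / (K + 1)) by apply Rmin_r.
  specialize (H d Hd (Rmin_l _ _)).
  assert (K * d <= e).
  { apply Rle_trans with ((K + 1) * (e / (K + 1))).
    - apply Rmult_le_compat; lra.
    - right; field; lra. }
  lra.
Qed.

(** By [near_damped] the damped forms of a sequence of approximating polynomials are uniformly
    Cauchy. G is their pointwise limit, taken by components, and the Cauchy estimate makes the
    convergence uniform. *)
Lemma damping_exists al c F : 0 <= c -> Aalpha al F -> exists G, damping al c F G.
Proof.
  intros Hc HF.
  assert (Hn : forall n : nat, 0 < / (INR n + 1)).
  { intros n. apply Rinv_0_lt_compat. pose proof (pos_INR n). lra. }
  assert (HP : forall n : nat, exists p, analytic al p /\ near F (teval p) (/ (INR n + 1))).
  { intros n. apply Aalpha_approx; auto. }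
  set (P := fun n => proj1_sig (constructive_indefinite_description _ (HP n))).
  assert (PA : forall n, analytic al (P n)) by (intros n; apply (proj2_sig (constructive_indefinite_description _ (HP n)))).
  assert (PN : forall n, near F (teval (P n)) (/ (INR n + 1))) by (intros n; apply (proj2_sig (constructive_indefinite_description _ (HP n)))).
  clearbody P.
  assert (PP : forall n k, near (damped al c (P n)) (damped al c (P k)) (/ (INR n + 1) + / (INR k + 1))).
  { intros n k. apply near_damped; auto. apply near_trans with F; auto. apply near_sym; auto. }
  assert (MON : forall n k, (n <= k)%nat -> / (INR k + 1) <= / (INR n + 1)).
  { intros n k Hk. apply Rinv_le_contravar; [pose proof (pos_INR n); lra|]. apply le_INR in Hk. lra. }
  assert (SM : forall e, 0 < e -> exists N : nat, / (INR N + 1) < e).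
  { intros e He. destruct (archimed_cor1 e He) as [N [HN HN0]]. exists N.
    eapply Rle_lt_trans; [|exact HN]. apply Rinv_le_contravar; [apply lt_0_INR; auto|]. lra. }
  assert (CV : forall (f : C -> R), (f = fst \/ f = snd) -> forall s t,
    exists l, Un_cv (fun n => f (damped al c (P n) s t)) l).
  { intros f Hf s t.
    assert (CC : Cauchy_crit (fun n => f (damped al c (P n) s t))).
    { intros e He. destruct (SM (e / 2)) as [N HN]; [lra|]. exists N. intros n k Hn' Hk'.
      unfold Rdist.
      apply Rle_lt_trans with (Cmod (Cminus (damped al c (P n) s t) (damped al c (P k) s t))).
      - destruct Hf as [-> | ->]; [apply (Rabs_fst_le (Cminus _ _)) | apply (Rabs_snd_le (Cminus _ _))].
      - eapply Rle_lt_trans; [apply PP|]. pose proof (MON N n Hn'). pose proof (MON N k Hk'). lra. }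
    destruct (Rcomplete.R_complete _ CC) as [l Hl]. exists l; auto. }
  set (G := fun s t => (proj1_sig (constructive_indefinite_description _ (CV fst (or_introl eq_refl) s t)),
                        proj1_sig (constructive_indefinite_description _ (CV snd (or_intror eq_refl) s t))) : C).
  exists G.
  assert (LIM : forall (U : nat -> R) l n b, Un_cv U l -> (forall k, (n <= k)%nat -> Rabs (U n - U k) <= b) -> Rabs (l - U n) <= b).
  { intros U l n b HU Hb. apply le_epsilon. intros e He. destruct (HU e He) as [N HN].
    specialize (HN (Nat.max N n) (Nat.le_max_l _ _)). specialize (Hb (Nat.max N n) (Nat.le_max_r _ _)).
    unfold Rdist in HN. replace (l - U n) with (- (U (Nat.max N n) - l) + - (U n - U (Nat.max N n))) by ring.
    eapply Rle_trans; [apply Rabs_triang|]. rewrite !Rabs_Ropp. lra. }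
  intros eps He. destruct (SM (eps / 4)) as [N HN]; [lra|]. exists (P N). split; [auto|split].
  - intros s t. eapply Rle_trans; [apply PN|]. lra.
  - intros s t. eapply Rle_trans; [apply Cmod_le_sum|].
    assert (D : forall k, (N <= k)%nat -> Cmod (Cminus (damped al c (P N) s t) (damped al c (P k) s t)) <= eps / 2).
    { intros k Hk. eapply Rle_trans; [apply PP|]. pose proof (MON N k Hk). lra. }
    assert (D1 : Rabs (fst (G s t) - fst (damped al c (P N) s t)) <= eps / 2).
    { apply (LIM (fun n => fst (damped al c (P n) s t))).
      - apply (proj2_sig (constructive_indefinite_description _ (CV fst (or_introl eq_refl) s t))).
      - intros k Hk. eapply Rle_trans; [apply (Rabs_fst_le (Cminus _ _)) | apply D; auto]. }
    assert (D2 : Rabs (snd (G s t) - snd (damped al c (P N) s t)) <= eps / 2).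
    { apply (LIM (fun n => snd (damped al c (P n) s t))).
      - apply (proj2_sig (constructive_indefinite_description _ (CV snd (or_intror eq_refl) s t))).
      - intros k Hk. eapply Rle_trans; [apply (Rabs_snd_le (Cminus _ _)) | apply D; auto]. }
    revert D1 D2. generalize (G s t) (damped al c (P N) s t). intros z w D1 D2.
    simpl. unfold Rminus in *. lra.
Qed.

Lemma damping_bound al c F G r : 0 <= c -> damping al c F G -> (forall s t, Cmod (F s t) <= r) ->
  forall s t, Cmod (G s t) <= r.
Proof.
  intros Hc H Hr s t. apply (le_epsilon_scaled _ _ 2); [lra|]. intros e He _.
  destruct (H e He) as [p [Hp [HF HG]]].
  pose proof (near_bound _ _ _ _ HF Hr) as B.
  pose proof (damped_chi_contraction al c s t p (r + e) Hc Hp B) as B'.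
  pose proof (near_bound (damped al c p) G e (r + e) (near_sym _ _ _ HG)) as B2.
  specialize (B2 (fun s t => damped_chi_contraction al c s t p (r + e) Hc Hp B) s t). lra.
Qed.

Lemma damping_unique al c F G G' : 0 <= c -> damping al c F G -> damping al c F G' -> forall s t, G s t = G' s t.
Proof.
  intros Hc H H' s t. apply C_eq_of_small. intros e He.
  destruct (H (e / 4)) as [p [Hp [HF HG]]]; [lra|].
  destruct (H' (e / 4)) as [q [Hq [HF' HG']]]; [lra|].
  pose proof (near_damped al c p q (e / 4 + e / 4) Hc Hp Hq (near_trans _ _ _ _ _ (near_sym _ _ _ HF) HF')) as N.
  pose proof (near_trans _ _ _ _ _ (near_trans _ _ _ _ _ HG N) (near_sym _ _ _ HG') s t). lra.
Qed.

Lemma near_mult F1 F2 G1 G2 r e : 0 <= e -> e <= 1 -> 0 <= r -> near F1 G1 e -> near F2 G2 e ->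
  (forall s t, Cmod (F1 s t) <= r) -> (forall s t, Cmod (F2 s t) <= r) ->
  near (fun s t => Cmult (F1 s t) (F2 s t)) (fun s t => Cmult (G1 s t) (G2 s t)) ((2 * r + 1) * e).
Proof.
  intros He He1 Hr N1 N2 B1 B2 s t.
  replace (Cminus (Cmult (F1 s t) (F2 s t)) (Cmult (G1 s t) (G2 s t))) with
    (Cplus (Cmult (F1 s t) (Cminus (F2 s t) (G2 s t))) (Cmult (Cminus (F1 s t) (G1 s t)) (G2 s t))) by aring.
  eapply Rle_trans; [apply Cmod_triangle|]. rewrite !Cmod_mult.
  pose proof (near_bound _ _ _ _ N2 B2 s t) as B3.
  specialize (N1 s t). specialize (N2 s t). specialize (B1 s t).
  assert (Cmod (F1 s t) * Cmod (Cminus (F2 s t) (G2 s t)) <= r * e).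
  { apply Rmult_le_compat; auto; apply Cmod_ge_0. }
  assert (Cmod (Cminus (F1 s t) (G1 s t)) * Cmod (G2 s t) <= e * (r + e)).
  { apply Rmult_le_compat; auto; apply Cmod_ge_0. }
  nra.
Qed.

(** Damping is multiplicative on polynomials because the weight is additive; the products of
    approximants have error at most (2 r + 1) d. *)
Lemma damping_mult al c F1 F2 G1 G2 r : 0 <= c -> damping al c F1 G1 -> damping al c F2 G2 ->
  (forall s t, Cmod (F1 s t) <= r) -> (forall s t, Cmod (F2 s t) <= r) ->
  damping al c (fun s t => Cmult (F1 s t) (F2 s t)) (fun s t => Cmult (G1 s t) (G2 s t)).
Proof.
  intros Hc H1 H2 B1 B2 eps He.
  assert (Hr : 0 <= r) by (eapply Rle_trans; [apply Cmod_ge_0 | apply (B1 0 0)]).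
  set (d := Rmin 1 (eps / (2 * r + 1))).
  assert (0 < eps / (2 * r + 1)) by (apply Rdiv_lt_0_compat; lra).
  assert (Hd : 0 < d) by (apply Rmin_pos; lra).
  assert (Hd1 : d <= 1) by apply Rmin_l.
  assert (Hd2 : (2 * r + 1) * d <= eps).
  { apply Rle_trans with ((2 * r + 1) * (eps / (2 * r + 1))).
    - apply Rmult_le_compat_l; [lra | apply Rmin_r].
    - right; field; lra. }
  destruct (H1 d Hd) as [p [Hp [HF1 HG1]]]. destruct (H2 d Hd) as [q [Hq [HF2 HG2]]].
  exists (poly_mul p q). split; [apply analytic_poly_mul; auto|split].
  - intros s t. rewrite teval_poly_mul. eapply Rle_trans; [|exact Hd2]. apply near_mult; auto; lra.
  - intros s t. unfold damped. rewrite (peval_poly_mul (damped_chi al c s t)) by apply hom_damped_chi.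
    eapply Rle_trans; [|exact Hd2].
    apply (near_mult G1 G2 (damped al c p) (damped al c q)); auto; try lra.
    + apply (damping_bound al c F1); auto.
    + apply (damping_bound al c F2); auto.
Qed.

(** F enters the constant only through its sup norm, so all damped unimodular functions share the
    Lipschitz constant 4 / c along the flow. *)
Lemma damping_lipschitz al c F G r : 0 < c -> damping al c F G -> (forall s t, Cmod (F s t) <= r) ->
  forall s t x, Cmod (Cminus (G (s + x) (t + al * x)) (G s t)) <= 4 * r / c * Rabs x.
Proof.
  intros Hc H Hr s t x.
  assert (0 <= 4 / c * Rabs x).
  { apply Rmult_le_pos; [|apply Rabs_pos]. left; apply Rdiv_lt_0_compat; lra. }
  apply (le_epsilon_scaled _ _ (4 / c * Rabs x + 2)); [lra|].
  intros e He _. destruct (H e He) as [p [Hp [HF HG]]].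
  pose proof (damped_chi_lipschitz al c s t p (r + e) x Hc Hp (near_bound _ _ _ _ HF Hr)) as L.
  pose proof (HG s t) as N1. pose proof (HG (s + x) (t + al * x)) as N2. unfold damped in *.
  replace (Cminus (G (s + x) (t + al * x)) (G s t)) with
    (Cplus (Cplus (Cminus (G (s + x) (t + al * x)) (peval (damped_chi al c (s + x) (t + al * x)) p))
      (Cminus (peval (damped_chi al c (s + x) (t + al * x)) p) (peval (damped_chi al c s t) p)))
      (Copp (Cminus (G s t) (peval (damped_chi al c s t) p)))) by aring.
  eapply Rle_trans; [apply Cmod_triangle|]. rewrite Cmod_opp.
  pose proof (Cmod_triangle (Cminus (G (s + x) (t + al * x)) (peval (damped_chi al c (s + x) (t + al * x)) p))
      (Cminus (peval (damped_chi al c (s + x) (t + al * x)) p) (peval (damped_chi al c s t) p))).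
  replace (4 * r / c * Rabs x + (4 / c * Rabs x + 2) * e) with (4 * (r + e) / c * Rabs x + 2 * e) by (field; lra).
  lra.
Qed.

Lemma damped_close al c p : 0 <= c -> analytic al p ->
  near (damped al c p) (teval p) (c * fold_right (fun e acc => Cmod (fst e) * weight al (snd e) + acc) 0 p).
Proof.
  intros Hc Hp s t. induction Hp as [|e p He Hp IH].
  - unfold damped, teval; simpl. replace (Cminus (RtoC 0) (RtoC 0)) with (RtoC 0) by ring. rewrite Cmod_0. lra.
  - unfold damped, teval in *; simpl.
    set (E := fold_right (fun e acc => Cmod (fst e) * weight al (snd e) + acc) 0 p) in *.
    replace (Cminus _ _) with (Cplus (Cmult (Cmult (fst e) (chi (snd e) s t)) (RtoC (exp (- (c * weight al (snd e))) - 1)))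
      (Cminus (peval (damped_chi al c s t) p) (peval (fun m => chi m s t) p))).
    2: { unfold damped_chi at 2. rewrite RtoC_minus. aring. }
    eapply Rle_trans; [apply Cmod_triangle|].
    rewrite !Cmod_mult, Cmod_chi, Cmod_R, Rmult_1_r.
    assert (B : Rabs (exp (- (c * weight al (snd e))) - 1) <= c * weight al (snd e)).
    { assert (0 <= c * weight al (snd e)) by (apply Rmult_le_pos; auto).
      pose proof (exp_neg_le_1 _ H). pose proof (exp_ineq1_le (- (c * weight al (snd e)))).
      apply Rabs_le. lra. }
    pose proof (Cmod_ge_0 (fst e)). nra.
Qed.

(** One polynomial p is fixed within k / 4 of F. Its own damping error is at most c W, as 1 - e^(-x)
    <= x, so c0 can be read off from p; the contraction transports the closeness of p and F to their
    damped forms for every c. *)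
Lemma damping_close al F k : Aalpha al F -> 0 < k ->
  exists c0, 0 < c0 /\ forall c, 0 < c -> c <= c0 -> forall G, damping al c F G -> near G F k.
Proof.
  intros HF Hk. destruct (Aalpha_approx al F HF (k / 4)) as [p [Hp HN]]; [lra|].
  set (W := fold_right (fun e acc => Cmod (fst e) * weight al (snd e) + acc) 0 p).
  assert (HW : 0 <= W).
  { unfold W. clear HN W. induction Hp as [|e p He Hp IH]; simpl; [lra|].
    pose proof (Cmod_ge_0 (fst e)). nra. }
  exists (k / 4 / (W + 1)). split; [apply Rdiv_lt_0_compat; lra|].
  intros c Hc Hc0 G HG.
  assert (HcW : c * W <= k / 4).
  { apply Rle_trans with (k / 4 / (W + 1) * (W + 1)).
    - apply Rmult_le_compat; lra.
    - right; field; lra. }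
  assert (N1 : near G (damped al c p) (k / 2)).
  { intros s t. apply le_epsilon. intros e He. destruct (HG (Rmin (e / 2) (k / 8))) as [q [Hq [HFq HGq]]].
    { apply Rmin_pos; lra. }
    pose proof (Rmin_l (e / 2) (k / 8)). pose proof (Rmin_r (e / 2) (k / 8)).
    pose proof (near_damped al c q p _ (Rlt_le _ _ Hc) Hq Hp (near_trans _ _ _ _ _ (near_sym _ _ _ HFq) HN)) as N.
    pose proof (near_trans _ _ _ _ _ HGq N s t). lra. }
  pose proof (damped_close al c p (Rlt_le _ _ Hc) Hp) as N2. fold W in N2.
  intros s t. pose proof (near_trans _ _ _ _ _ (near_trans _ _ _ _ _ N1 N2) (near_sym _ _ _ HN) s t). lra.
Qed.

(** * Phases along the flow *)

(* Taking [a = - floor (al b)] keeps [a + al b] in the interval 0 <= x < 1, so the phase is [b t] up to [T1], and [b t] sweeps past pi. *)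
Lemma phase_sweep al T1 T2 : 0 < al -> Rabs T1 <= PI / 4 -> Rabs (T2 - al * T1) <= PI / 4 ->
  (forall a b : Z, 0 <= IZR a + al * IZR b -> IZR a + al * IZR b <= 1 -> 0 < cos (IZR a * T1 + IZR b * T2)) ->
  T2 = al * T1.
Proof.
  intros Hal H1 Ht H. pose proof PI_RGT_0 as Hpi.
  destruct (Req_dec (T2 - al * T1) 0) as [E|E]; [lra|]. exfalso.
  set (t := T2 - al * T1) in *.
  assert (Ht0 : 0 < Rabs t) by (apply Rabs_pos_lt; auto).
  (* Here b is the first integer with b |t| > 3 pi / 4, and |t| <= pi / 4 keeps b |t| <= pi. The
     remaining part of the phase is at most pi / 4, so up to sign the total lies in
     [pi / 2, 5 pi / 4], where the cosine is not positive. *)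
  destruct (archimed (3 * PI / (4 * Rabs t))) as [A1 A2].
  set (b := up (3 * PI / (4 * Rabs t))) in *.
  assert (B1 : 3 * PI / 4 < IZR b * Rabs t).
  { apply Rmult_lt_reg_r with (/ Rabs t); [apply Rinv_0_lt_compat; auto|].
    replace (IZR b * Rabs t * / Rabs t) with (IZR b) by (field; lra).
    replace (3 * PI / 4 * / Rabs t) with (3 * PI / (4 * Rabs t)) by (field; lra). lra. }
  assert (B2 : IZR b * Rabs t <= PI).
  { apply Rle_trans with ((3 * PI / (4 * Rabs t) + 1) * Rabs t).
    - apply Rmult_le_compat_r; lra.
    - replace ((3 * PI / (4 * Rabs t) + 1) * Rabs t) with (3 * PI / 4 + Rabs t) by (field; lra). lra. }
  destruct (archimed (al * IZR b)) as [C1 C2].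
  set (a := (1 - up (al * IZR b))%Z).
  assert (Ea : IZR a = 1 - IZR (up (al * IZR b))) by (unfold a; rewrite minus_IZR; auto).
  assert (Hg0 : 0 <= IZR a + al * IZR b) by lra.
  assert (Hg1 : IZR a + al * IZR b <= 1) by lra.
  specialize (H a b Hg0 Hg1).
  replace (IZR a * T1 + IZR b * T2) with ((IZR a + al * IZR b) * T1 + IZR b * t) in H by (unfold t; ring).
  set (g := IZR a + al * IZR b) in *.
  assert (Hg : Rabs (g * T1) <= PI / 4).
  { rewrite Rabs_mult, (Rabs_pos_eq g) by lra. pose proof (Rabs_pos T1). nra. }
  apply Rabs_le_between in Hg.
  destruct (Rcase_abs t) as [L|L].
  - rewrite (Rabs_left t L) in *. rewrite <- cos_neg in H.
    enough (cos (- (g * T1 + IZR b * t)) <= 0) by lra. apply cos_le_0; lra.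
  - rewrite (Rabs_right t L) in *.
    enough (cos (g * T1 + IZR b * t) <= 0) by lra. apply cos_le_0; lra.
Qed.

Lemma polar_atan (w : C) : 0 < fst w -> w = Cmult (RtoC (Cmod w)) (expi (atan (snd w / fst w))).
Proof.
  intros Hw. assert (E : Cmod w = fst w * sqrt (1 + (snd w / fst w)²)).
  { unfold Cmod. rewrite <- (sqrt_Rsqr (fst w)) at 2 by lra.
    rewrite <- sqrt_mult; [|apply Rle_0_sqr|].
    - f_equal. unfold Rsqr. field. lra.
    - pose proof (Rle_0_sqr (snd w / fst w)). lra. }
  set (q := snd w / fst w) in *.
  assert (Hq : 0 < sqrt (1 + q²)).
  { apply sqrt_lt_R0. pose proof (Rle_0_sqr q). lra. }
  apply C_eq; simpl; rewrite E, cos_atan, sin_atan.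
  - field; lra.
  - replace (snd w) with (q * fst w) by (unfold q; field; lra). field; lra.
Qed.

Lemma atan_le_Rabs x : Rabs (atan x) <= Rabs x.
Proof.
  pose proof (bounded_variation atan (fun t => / (1 + t ^ 2)) 1 0 x) as H.
  rewrite atan_0, !Rminus_0_r, Rmult_1_l in H. apply H.
  intros t _. split.
  - apply is_derive_Reals, derivable_pt_lim_atan.
  - assert (0 <= t ^ 2) by apply pow2_ge_0.
    rewrite Rabs_pos_eq by (left; apply Rinv_0_lt_compat; lra).
    rewrite <- Rinv_1. apply Rinv_le_contravar; lra.
Qed.

Lemma lipschitz_continuous (f : R -> R) (K : R) : (forall x, Rabs (f x - f 0) <= K * Rabs x) -> continuity_pt f 0.
Proof.
  intros H e He. assert (HK : 0 <= Rabs K) by apply Rabs_pos.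
  exists (e / (Rabs K + 1)). split; [apply Rdiv_lt_0_compat; lra|].
  intros x [_ Hx]. simpl in *. unfold Rdist in *. rewrite Rminus_0_r in Hx.
  eapply Rle_lt_trans; [apply H|].
  apply Rle_lt_trans with (Rabs K * Rabs x).
  - apply Rmult_le_compat_r; [apply Rabs_pos | apply Rle_abs].
  - pose proof (Rabs_pos x).
    apply Rle_lt_trans with ((Rabs K + 1) * Rabs x); [nra|].
    apply Rlt_le_trans with ((Rabs K + 1) * (e / (Rabs K + 1))).
    + apply Rmult_lt_compat_l; lra.
    + right; field; lra.
Qed.

Lemma contR_along f s t al : contR f -> continuity_pt (fun x => f (s + x) (t + al * x)) 0.
Proof.
  intros Hf e He. destruct (Hf s t (mkposreal e He)) as [d D].
  pose proof (cond_pos d) as Hd.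
  exists (d / (1 + Rabs al)). pose proof (Rabs_pos al) as Ha. split; [apply Rdiv_lt_0_compat; lra|].
  intros x [_ Hx]. simpl in *. unfold Rdist in *. rewrite Rminus_0_r in Hx.
  rewrite Rmult_0_r, !Rplus_0_r.
  assert (Hx2 : (1 + Rabs al) * Rabs x < d).
  { apply Rlt_le_trans with ((1 + Rabs al) * (d / (1 + Rabs al))).
    - apply Rmult_lt_compat_l; lra.
    - right; field; lra. }
  pose proof (Rabs_pos x).
  apply D.
  - replace (s + x - s) with x by ring. nra.
  - replace (t + al * x - t) with (al * x) by ring. rewrite Rabs_mult. nra.
Qed.

Lemma const_of_locally_const (f : R -> R) : (forall x, exists d, 0 < d /\ forall y, Rabs (y - x) < d -> f y = f x) ->
  forall x, f x = f 0.
Proof.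
  intros H x.
  assert (D : forall t, is_derive f t 0).
  { intros t. destruct (H t) as [d [Hd E]].
    apply is_derive_ext_loc with (fun _ => f t).
    - exists (mkposreal d Hd). intros y Hy. symmetry. apply E. exact Hy.
    - apply (@is_derive_const R_AbsRing R_NormedModule). }
  pose proof (bounded_variation f (fun _ => 0) 0 0 x) as B.
  assert (Rabs (f x - f 0) <= 0 * Rabs (x - 0)).
  { apply B. intros t _. split; auto. rewrite Rabs_R0; lra. }
  rewrite Rmult_0_l in H0. apply Rabs_le_between in H0. lra.
Qed.

(** The disc about w of radius |w| lies on one side of the line through 0 orthogonal to w. The
    conclusion is the positivity of the real part of z times the conjugate of w. *)
Lemma Re_prod_pos (z w : C) : Cmod (Cminus z w) < Cmod w -> 0 < fst z * fst w + snd z * snd w.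
Proof.
  intros H. pose proof (Cmod_ge_0 (Cminus z w)) as H0.
  assert (H2 : Cmod (Cminus z w) ^ 2 < Cmod w ^ 2) by nra.
  rewrite !Cmod2_alt in H2. unfold Re, Im in H2. simpl in H2.
  pose proof (pow2_ge_0 (fst z)). pose proof (pow2_ge_0 (snd z)). nra.
Qed.

(** Records some phase of a nonzero number instead of its principal argument, so that phases add
    under products without reduction modulo 2 pi. *)
Definition posphase (z : C) (phi : R) : Prop := exists r, 0 < r /\ z = Cmult (RtoC r) (expi phi).

Lemma posphase_mult z w a b : posphase z a -> posphase w b -> posphase (Cmult z w) (a + b).
Proof.
  intros [r [Hr ->]] [q [Hq ->]]. exists (r * q). split; [apply Rmult_lt_0_compat; auto|].
  rewrite expi_add, RtoC_mult. ring.
Qed.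

Lemma posphase_div z w v a b : posphase z a -> posphase w b -> Cmult v z = w -> posphase v (b - a).
Proof.
  intros [r [Hr ->]] [q [Hq ->]] E. exists (q / r). split; [apply Rdiv_lt_0_compat; auto|].
  assert (E2 : v = Cmult (Cmult v (Cmult (RtoC r) (expi a))) (Cmult (RtoC (/ r)) (expi (- a)))).
  { replace (Cmult (Cmult v (Cmult (RtoC r) (expi a))) (Cmult (RtoC (/ r)) (expi (- a)))) with
      (Cmult v (Cmult (Cmult (RtoC r) (RtoC (/ r))) (Cmult (expi a) (expi (- a))))) by ring.
    rewrite <- RtoC_mult, Rinv_r, <- expi_add, Rplus_opp_r, expi_0 by lra. ring. }
  rewrite E2, E. unfold Rminus. rewrite expi_add. unfold Rdiv. rewrite RtoC_mult. ring.
Qed.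

Lemma posphase_Re z w a b : posphase z a -> posphase w b -> 0 < fst z * fst w + snd z * snd w -> 0 < cos (a - b).
Proof.
  intros [r [Hr ->]] [q [Hq ->]] H. simpl in H. rewrite cos_minus.
  assert (E : (r * cos a - 0 * sin a) * (q * cos b - 0 * sin b) + (r * sin a + 0 * cos a) * (q * sin b + 0 * cos b)
    = (r * q) * (cos a * cos b + sin a * sin b)) by ring.
  rewrite E in H. apply Rmult_lt_reg_l with (r * q); [apply Rmult_lt_0_compat; auto|]. lra.
Qed.

(** * Multiplicative unimodular families along the flow *)

Section FlowPhase.
Context (al : R) (Hal : 0 < al) (u : Z * Z -> fn) (H1 H2 : R -> R -> R).
Context (CH1 : contR H1) (CH2 : contR H2).
Context (uA : forall m, 0 <= weight al m -> Aalpha al (u m)).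
Context (u1 : forall m s t, 0 <= weight al m -> Cmod (u m s t) = 1).
Context (umul : forall m n, 0 <= weight al m -> 0 <= weight al n -> forall s t, u (freq_add m n) s t = Cmult (u m s t) (u n s t)).
Context (uH1 : forall s t, u (1, 0)%Z s t = expi (H1 s t)) (uH2 : forall s t, u (0, 1)%Z s t = expi (H2 s t)).

Lemma weight_10 : weight al (1, 0)%Z = 1.
Proof. unfold weight; simpl; ring. Qed.
Lemma weight_01 : weight al (0, 1)%Z = al.
Proof. unfold weight; simpl; ring. Qed.
Lemma weight_00 : weight al (0, 0)%Z = 0.
Proof. unfold weight; simpl; ring. Qed.

Lemma unimodular_family_le1 m : 0 <= weight al m -> forall s t, Cmod (u m s t) <= 1.
Proof. intros Hm s t. rewrite u1; auto; lra. Qed.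

Lemma damping_ext c F F' G : (forall s t, F s t = F' s t) -> damping al c F G -> damping al c F' G.
Proof.
  intros E HM eps He. destruct (HM eps He) as [p [Hp [N1 N2]]]. exists p. split; auto. split; auto.
  intros s t. rewrite <- E. apply N1.
Qed.

Section FixC.
Context (c : R) (Hc : 0 < c) (G1 G2 : fn) (M1 : damping al c (u (1, 0)%Z) G1) (M2 : damping al c (u (0, 1)%Z) G2).
Context (k : R) (Hk : 0 < k) (Hk2 : k <= 1 / 2) (N1 : near G1 (u (1, 0)%Z) k) (N2 : near G2 (u (0, 1)%Z) k).

(** The damped function relative to the undamped phase. It stays within k <= 1/2 of 1, so [atan]
    reads off its argument without a choice of branch, and Hj + [phase_corr] is a phase of G. *)
Definition quot (G : fn) (Hj : R -> R -> R) : fn := fun s t => Cmult (G s t) (expi (- Hj s t)).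
Definition phase_corr (G : fn) (Hj : R -> R -> R) (s t : R) : R := atan (snd (quot G Hj s t) / fst (quot G Hj s t)).

Lemma quot_near G Hj U : near G U k -> (forall s t, U s t = expi (Hj s t)) ->
  forall s t, Cmod (Cminus (quot G Hj s t) (RtoC 1)) <= k.
Proof.
  intros N E s t. replace (Cminus (quot G Hj s t) (RtoC 1)) with (Cmult (Cminus (G s t) (U s t)) (expi (- Hj s t))).
  - rewrite Cmod_mult, Cmod_expi, Rmult_1_r. apply N.
  - unfold quot. rewrite E. replace (RtoC 1) with (Cmult (expi (Hj s t)) (expi (- Hj s t))).
    + aring.
    + rewrite <- expi_add, Rplus_opp_r. apply expi_0.
Qed.

Lemma quot_comp G Hj U : near G U k -> (forall s t, U s t = expi (Hj s t)) ->
  forall s t, 1 - k <= fst (quot G Hj s t) /\ Rabs (snd (quot G Hj s t)) <= k.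
Proof.
  intros N E s t. pose proof (quot_near G Hj U N E s t) as Q.
  pose proof (Rabs_fst_le (Cminus (quot G Hj s t) (RtoC 1))) as A1.
  pose proof (Rabs_snd_le (Cminus (quot G Hj s t) (RtoC 1))) as A2.
  revert Q A1 A2. generalize (quot G Hj s t). intros z Q A1 A2. simpl in A1, A2.
  split.
  - assert (B : Rabs (fst z + - (1)) <= k) by lra. apply Rabs_le_between in B. lra.
  - replace (snd z) with (snd z + - 0) by ring. lra.
Qed.

Lemma phase_corr_small G Hj U : near G U k -> (forall s t, U s t = expi (Hj s t)) ->
  forall s t, Rabs (phase_corr G Hj s t) <= 2 * k.
Proof.
  intros N E s t. unfold phase_corr. eapply Rle_trans; [apply atan_le_Rabs|].
  destruct (quot_comp G Hj U N E s t) as [Q1 Q2].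
  unfold Rdiv. rewrite Rabs_mult, Rabs_inv, (Rabs_pos_eq (fst (quot G Hj s t))) by lra.
  apply Rmult_le_reg_r with (fst (quot G Hj s t)); [lra|].
  rewrite Rmult_assoc, Rinv_l, Rmult_1_r by lra. nra.
Qed.

Lemma phase_corr_spec G Hj U : near G U k -> (forall s t, U s t = expi (Hj s t)) ->
  forall s t, posphase (G s t) (Hj s t + phase_corr G Hj s t).
Proof.
  intros N E s t. destruct (quot_comp G Hj U N E s t) as [Q1 Q2].
  exists (Cmod (quot G Hj s t)). split.
  - apply Rlt_le_trans with (Rabs (fst (quot G Hj s t))); [rewrite Rabs_pos_eq; lra | apply Rabs_fst_le].
  - rewrite expi_add. unfold phase_corr.
    pose proof (polar_atan (quot G Hj s t) ltac:(lra)) as P.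
    transitivity (Cmult (expi (Hj s t)) (quot G Hj s t)).
    + unfold quot. transitivity (Cmult (G s t) (Cmult (expi (Hj s t)) (expi (- Hj s t)))); [|aring].
      rewrite <- expi_add, Rplus_opp_r, expi_0. aring.
    + rewrite P at 1. aring.
Qed.

(** Stated along the flow, the direction in which [damping_lipschitz] controls G; the real part of
    [quot] is bounded away from 0, so the quotient under [atan] is continuous. *)
Lemma phase_corr_cont G Hj U : contR Hj -> damping al c U G -> (forall s t, Cmod (U s t) <= 1) ->
  near G U k -> (forall s t, U s t = expi (Hj s t)) ->
  forall s t, continuity_pt (fun x => Hj (s + x) (t + al * x) + phase_corr G Hj (s + x) (t + al * x)) 0.
Proof.
  intros CH M B N E s t.
  assert (L : forall x, Cmod (Cminus (G (s + x) (t + al * x)) (G (s + 0) (t + al * 0))) <= 4 / c * Rabs x).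
  { intros x. rewrite Rmult_0_r, !Rplus_0_r.
    pose proof (damping_lipschitz al c U G 1 Hc M B s t x) as Q. rewrite Rmult_1_r in Q. exact Q. }
  assert (K1 : continuity_pt (fun x => fst (G (s + x) (t + al * x))) 0).
  { apply lipschitz_continuous with (4 / c). intros x. eapply Rle_trans; [|apply L]. apply (Rabs_fst_le (Cminus _ _)). }
  assert (K2 : continuity_pt (fun x => snd (G (s + x) (t + al * x))) 0).
  { apply lipschitz_continuous with (4 / c). intros x. eapply Rle_trans; [|apply L]. apply (Rabs_snd_le (Cminus _ _)). }
  assert (Cc : contR (fun s t => cos (- Hj s t))).
  { apply contR_comp; [apply continuity_cos|]. apply contR_ext with (fun s t => (-1) * Hj s t); [intros; ring|].
    apply contR_mult; auto; apply contR_const. }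
  assert (Cs : contR (fun s t => sin (- Hj s t))).
  { apply contR_comp; [apply continuity_sin|]. apply contR_ext with (fun s t => (-1) * Hj s t); [intros; ring|].
    apply contR_mult; auto; apply contR_const. }
  pose proof (contR_along _ s t al Cc) as K3. pose proof (contR_along _ s t al Cs) as K4.
  assert (Q1 : continuity_pt (fun x => fst (quot G Hj (s + x) (t + al * x))) 0).
  { apply (continuity_pt_minus (fun x => fst (G (s + x) (t + al * x)) * cos (- Hj (s + x) (t + al * x)))
      (fun x => snd (G (s + x) (t + al * x)) * sin (- Hj (s + x) (t + al * x)))); 
    [apply (continuity_pt_mult (fun x => fst (G (s + x) (t + al * x))) (fun x => cos (- Hj (s + x) (t + al * x))))
    |apply (continuity_pt_mult (fun x => snd (G (s + x) (t + al * x))) (fun x => sin (- Hj (s + x) (t + al * x))))]; auto. }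
  assert (Q2 : continuity_pt (fun x => snd (quot G Hj (s + x) (t + al * x))) 0).
  { apply (continuity_pt_plus (fun x => fst (G (s + x) (t + al * x)) * sin (- Hj (s + x) (t + al * x)))
      (fun x => snd (G (s + x) (t + al * x)) * cos (- Hj (s + x) (t + al * x)))); 
    [apply (continuity_pt_mult (fun x => fst (G (s + x) (t + al * x))) (fun x => sin (- Hj (s + x) (t + al * x))))
    |apply (continuity_pt_mult (fun x => snd (G (s + x) (t + al * x))) (fun x => cos (- Hj (s + x) (t + al * x))))]; auto. }
  apply (continuity_pt_plus (fun x => Hj (s + x) (t + al * x)) (fun x => phase_corr G Hj (s + x) (t + al * x))).
  - apply contR_along; auto.
  - apply (continuity_pt_comp (fun x => snd (quot G Hj (s + x) (t + al * x)) / fst (quot G Hj (s + x) (t + al * x))) atan).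
    + apply (continuity_pt_div (fun x => snd (quot G Hj (s + x) (t + al * x))) (fun x => fst (quot G Hj (s + x) (t + al * x)))); auto.
      destruct (quot_comp G Hj U N E (s + 0) (t + al * 0)). lra.
    + apply derivable_continuous_pt, derivable_pt_atan.
Qed.

Let X1 (s t : R) : R := H1 s t + phase_corr G1 H1 s t.
Let X2 (s t : R) : R := H2 s t + phase_corr G2 H2 s t.

Lemma unimodular_family_0 s t : u (0, 0)%Z s t = RtoC 1.
Proof.
  assert (E : u (0, 0)%Z s t = Cmult (u (0, 0)%Z s t) (u (0, 0)%Z s t)).
  { rewrite <- umul by (rewrite weight_00; lra). reflexivity. }
  assert (NZ : u (0, 0)%Z s t <> RtoC 0).
  { intros Z0. pose proof (u1 (0, 0)%Z s t) as Q. rewrite Z0, Cmod_0, weight_00 in Q. specialize (Q ltac:(lra)). lra. }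
  replace (u (0, 0)%Z s t) with (Cmult (Cmult (u (0, 0)%Z s t) (u (0, 0)%Z s t)) (Cinv (u (0, 0)%Z s t))).
  - rewrite <- E. apply Cinv_r; auto.
  - rewrite <- Cmult_assoc, Cinv_r by auto. aring.
Qed.

Lemma weight_nat (i j : nat) : 0 <= weight al (Z.of_nat i, Z.of_nat j).
Proof.
  unfold weight; simpl. rewrite <- !INR_IZR_INZ. pose proof (pos_INR i). pose proof (pos_INR j).
  assert (0 <= al * INR j) by (apply Rmult_le_pos; lra). lra.
Qed.

Lemma damping_nat_phase (i j : nat) : exists G, damping al c (u (Z.of_nat i, Z.of_nat j)) G /\
  forall s t, posphase (G s t) (INR i * X1 s t + INR j * X2 s t).
Proof.
  induction i as [|i [G [IH1 IH2]]].
  - induction j as [|j [G [IH1 IH2]]].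
    + exists (fun _ _ => RtoC 1). split.
      * apply damping_ext with (fun _ _ => RtoC 1); [intros; symmetry; apply unimodular_family_0|].
        intros eps He. exists ((RtoC 1, (0, 0)%Z) :: nil). split; [|split].
        -- constructor; [|constructor]. simpl. rewrite weight_00; lra.
        -- intros s t. unfold teval; simpl. rewrite chi_0.
           replace (Cminus _ _) with (RtoC 0) by ring. rewrite Cmod_0; lra.
        -- intros s t. unfold damped; simpl. rewrite (proj1 (hom_damped_chi al c s t)).
           replace (Cminus _ _) with (RtoC 0) by ring. rewrite Cmod_0; lra.
      * intros s t. exists 1. split; [lra|]. simpl INR. replace (0 * X1 s t + 0 * X2 s t) with 0 by ring. rewrite expi_0. ring.
    + exists (fun s t => Cmult (G2 s t) (G s t)). split.
      * apply damping_ext with (fun s t => Cmult (u (0, 1)%Z s t) (u (Z.of_nat 0, Z.of_nat j) s t)).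
        -- intros s t. rewrite <- umul by (rewrite ?weight_01; try lra; apply weight_nat).
           f_equal. unfold freq_add; simpl fst; simpl snd. f_equal; lia.
        -- apply damping_mult with 1; auto; try lra; apply unimodular_family_le1; rewrite ?weight_01; try lra; apply weight_nat.
      * intros s t. rewrite S_INR. replace (INR 0 * X1 s t + (INR j + 1) * X2 s t) with (X2 s t + (INR 0 * X1 s t + INR j * X2 s t)) by ring.
        apply posphase_mult; auto. apply phase_corr_spec with (u (0, 1)%Z); auto.
  - exists (fun s t => Cmult (G1 s t) (G s t)). split.
    + apply damping_ext with (fun s t => Cmult (u (1, 0)%Z s t) (u (Z.of_nat i, Z.of_nat j) s t)).
      * intros s t. rewrite <- umul by (rewrite ?weight_10; try lra; apply weight_nat).
        f_equal. unfold freq_add; simpl fst; simpl snd. f_equal; lia.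
      * apply damping_mult with 1; auto; try lra; apply unimodular_family_le1; rewrite ?weight_10; try lra; apply weight_nat.
    + intros s t. rewrite S_INR. replace ((INR i + 1) * X1 s t + INR j * X2 s t) with (X1 s t + (INR i * X1 s t + INR j * X2 s t)) by ring.
      apply posphase_mult; auto. apply phase_corr_spec with (u (1, 0)%Z); auto.
Qed.

(** For a or b negative, u_(a,b) is not a product of the two generators. Multiplied by the member of
    index (|a|, |b|) it becomes one; damping respects this product, and the phase follows by
    division. *)
Lemma damping_phase (a b : Z) G : 0 <= weight al (a, b) -> damping al c (u (a, b)) G ->
  forall s t, posphase (G s t) (IZR a * X1 s t + IZR b * X2 s t).
Proof.
  intros Hw M s t.
  set (n := Z.to_nat (Z.abs a)). set (n' := Z.to_nat (Z.abs b)).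
  destruct (damping_nat_phase n n') as [Ga [Ma Pa]].
  destruct (damping_nat_phase (Z.to_nat (a + Z.of_nat n)) (Z.to_nat (b + Z.of_nat n'))) as [Gb [Mb Pb]].
  assert (E : forall s t, Cmult (G s t) (Ga s t) = Gb s t).
  { apply (damping_unique al c (u (Z.of_nat (Z.to_nat (a + Z.of_nat n)), Z.of_nat (Z.to_nat (b + Z.of_nat n'))))); auto; [lra|].
    apply damping_ext with (fun s t => Cmult (u (a, b) s t) (u (Z.of_nat n, Z.of_nat n') s t)).
    - intros s' t'. rewrite <- umul by (auto; apply weight_nat). f_equal. unfold freq_add; simpl.
      rewrite !Z2Nat.id by lia. reflexivity.
    - apply damping_mult with 1; auto; try lra; apply unimodular_family_le1; auto; apply weight_nat. }
  replace (IZR a * X1 s t + IZR b * X2 s t) with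
    ((INR (Z.to_nat (a + Z.of_nat n)) * X1 s t + INR (Z.to_nat (b + Z.of_nat n')) * X2 s t) - (INR n * X1 s t + INR n' * X2 s t)).
  - eapply posphase_div; [apply Pa | apply Pb | apply E].
  - rewrite !INR_IZR_INZ, !Z2Nat.id, !plus_IZR by lia. ring.
Qed.

Lemma G1_ge_half s t : 1 / 2 <= Cmod (G1 s t).
Proof.
  pose proof (Cmod_triangle (Cminus (u (1, 0)%Z s t) (G1 s t)) (G1 s t)) as T.
  replace (Cplus (Cminus (u (1, 0)%Z s t) (G1 s t)) (G1 s t)) with (u (1, 0)%Z s t) in T by aring.
  rewrite u1 in T by (rewrite weight_10; lra).
  pose proof (near_sym _ _ _ N1 s t). lra.
Qed.

(* The damped functions for [m] and [(1,0) - m] have modulus at most 1 and product [G1], so neither can be small. *)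
Lemma damping_ge_half m G : 0 <= weight al m -> weight al m <= 1 -> damping al c (u m) G -> forall s t, 1 / 2 <= Cmod (G s t).
Proof.
  intros Hm0 Hm1 M s t.
  assert (Hm' : 0 <= weight al (freq_add (1, 0)%Z (freq_opp m))) by (rewrite weight_add, weight_opp, weight_10; lra).
  destruct (damping_exists al c (u (freq_add (1, 0)%Z (freq_opp m)))) as [G' M']; [lra | auto|].
  assert (E : forall s t, Cmult (G s t) (G' s t) = G1 s t).
  { apply (damping_unique al c (u (1, 0)%Z)); auto; [lra|].
    apply damping_ext with (fun s t => Cmult (u m s t) (u (freq_add (1, 0)%Z (freq_opp m)) s t)).
    - intros s' t'. rewrite <- umul by auto. f_equal. destruct m as [a b]. unfold freq_add, freq_opp; cbn [fst snd]. f_equal; lia.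
    - apply damping_mult with 1; auto; try lra; apply unimodular_family_le1; auto. }
  pose proof (G1_ge_half s t) as Q. rewrite <- E, Cmod_mult in Q.
  pose proof (damping_bound al c _ G' 1 (Rlt_le _ _ Hc) M' (unimodular_family_le1 _ Hm') s t).
  pose proof (Cmod_ge_0 (G s t)). nra.
Qed.

(** Local constancy is enough. On a short step every damped u_m with 0 <= w(m) <= 1 moves by less
    than its own modulus, so its phase increment has positive cosine for all these m at once, and
    [phase_sweep] makes the increments of X1 and X2 exactly proportional. *)
Lemma damped_phase_const s t x : X2 (s + x) (t + al * x) - al * X1 (s + x) (t + al * x) = X2 s t - al * X1 s t.
Proof.
  pose proof PI_RGT_0 as Hpi.
  set (f := fun x => X2 (s + x) (t + al * x) - al * X1 (s + x) (t + al * x)).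
  assert (E : f x = f 0).
  { apply const_of_locally_const. intros y.
    assert (CX1 : continuity_pt (fun x => X1 ((s + y) + x) ((t + al * y) + al * x)) 0).
    { apply phase_corr_cont with (u (1, 0)%Z); auto. apply unimodular_family_le1. rewrite weight_10; lra. }
    assert (CX2 : continuity_pt (fun x => X2 ((s + y) + x) ((t + al * y) + al * x)) 0).
    { apply phase_corr_cont with (u (0, 1)%Z); auto. apply unimodular_family_le1. rewrite weight_01; lra. }
    assert (CT : continuity_pt (fun x => X2 ((s + y) + x) ((t + al * y) + al * x) - al * X1 ((s + y) + x) ((t + al * y) + al * x)) 0).
    { apply (continuity_pt_minus (fun x => X2 ((s + y) + x) ((t + al * y) + al * x)) (fun x => al * X1 ((s + y) + x) ((t + al * y) + al * x))); auto.
      apply (continuity_pt_scal (fun x => X1 ((s + y) + x) ((t + al * y) + al * x))); auto. }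
    destruct (CX1 (PI / 4)) as [d1 [Hd1 D1]]; [lra|].
    destruct (CT (PI / 4)) as [d2 [Hd2 D2]]; [lra|].
    (* Within c / 8 the Lipschitz constant 4 / c gives a displacement below 1/2, the lower bound of
       [damping_ge_half]; d1 and d2 give the bounds pi / 4 on the increments. *)
    exists (Rmin (c / 8) (Rmin d1 d2)). split; [repeat apply Rmin_pos; auto; lra|].
    intros z Hz.
    assert (Z0 : Rabs (z - y) < c / 8) by (eapply Rlt_le_trans; [exact Hz | apply Rmin_l]).
    assert (Z1 : Rabs (z - y) < d1).
    { eapply Rlt_le_trans; [exact Hz|]. eapply Rle_trans; [apply Rmin_r | apply Rmin_l]. }
    assert (Z2 : Rabs (z - y) < d2).
    { eapply Rlt_le_trans; [exact Hz|]. eapply Rle_trans; [apply Rmin_r | apply Rmin_r]. }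
    destruct (Req_dec z y) as [->|NE]; [reflexivity|].
    set (w := z - y) in *.
    assert (Hw0 : w <> 0) by (unfold w; lra).
    assert (PW : forall d, Rabs w < d -> D_x no_cond 0 w /\ Rdist w 0 < d).
    { intros d Hd. split; [split; [exact I | auto]|]. unfold Rdist. rewrite Rminus_0_r. exact Hd. }
    specialize (D1 w (PW d1 Z1)). specialize (D2 w (PW d2 Z2)). simpl in D1, D2. unfold Rdist in D1, D2.
    rewrite Rmult_0_r, !Rplus_0_r in D1, D2.
    unfold f. replace (s + z) with (s + y + w) by (unfold w; ring).
    replace (t + al * z) with (t + al * y + al * w) by (unfold w; ring).
    set (s0 := s + y) in *. set (t0 := t + al * y) in *.
    set (T1 := X1 (s0 + w) (t0 + al * w) - X1 s0 t0).
    set (T2 := X2 (s0 + w) (t0 + al * w) - X2 s0 t0).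
    enough (T2 = al * T1) by (unfold T1, T2 in *; lra).
    apply phase_sweep; auto.
    - unfold T1; lra.
    - unfold T2, T1. left. eapply Rle_lt_trans; [|exact D2]. right; f_equal; ring.
    - intros a b Ha0 Ha1.
      destruct (damping_exists al c (u (a, b))) as [G M]; [lra | apply uA; exact Ha0|].
      pose proof (damping_phase a b G Ha0 M s0 t0) as P0.
      pose proof (damping_phase a b G Ha0 M (s0 + w) (t0 + al * w)) as P1.
      replace (IZR a * T1 + IZR b * T2) with ((IZR a * X1 (s0 + w) (t0 + al * w) + IZR b * X2 (s0 + w) (t0 + al * w)) -
        (IZR a * X1 s0 t0 + IZR b * X2 s0 t0)) by (unfold T1, T2; ring).
      apply (posphase_Re _ _ _ _ P1 P0). apply Re_prod_pos.
      pose proof (damping_ge_half (a, b) G Ha0 Ha1 M s0 t0) as Hh.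
      pose proof (damping_lipschitz al c _ G 1 Hc M (unimodular_family_le1 (a, b) Ha0) s0 t0 w) as L.
      assert (4 * 1 / c * Rabs w < 1 / 2).
      { apply Rlt_le_trans with (4 * 1 / c * (c / 8)).
        - apply Rmult_lt_compat_l; auto. apply Rdiv_lt_0_compat; lra.
        - right; field; lra. }
      lra. }
  unfold f in E. rewrite Rmult_0_r, !Rplus_0_r in E. exact E.
Qed.

(** The relation is exact for the damped phases. Each of the four corrections is at most 2 k, the
    two belonging to H1 being multiplied by al. *)
Lemma phase_diff_almost_const s t x :
  Rabs ((H2 (s + x) (t + al * x) - al * H1 (s + x) (t + al * x)) - (H2 s t - al * H1 s t)) <= 4 * (1 + al) * k.
Proof.
  pose proof (damped_phase_const s t x) as E. unfold X1, X2 in E.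
  pose proof (phase_corr_small G1 H1 _ N1 uH1 s t) as B1. pose proof (phase_corr_small G2 H2 _ N2 uH2 s t) as B2.
  pose proof (phase_corr_small G1 H1 _ N1 uH1 (s + x) (t + al * x)) as B3.
  pose proof (phase_corr_small G2 H2 _ N2 uH2 (s + x) (t + al * x)) as B4.
  apply Rabs_le_between in B1, B2, B3, B4. apply Rabs_le. split; nra.
Qed.

End FixC.

Lemma flow_phase s t x : H2 (s + x) (t + al * x) - al * H1 (s + x) (t + al * x) = H2 s t - al * H1 s t.
Proof.
  set (d := (H2 (s + x) (t + al * x) - al * H1 (s + x) (t + al * x)) - (H2 s t - al * H1 s t)).
  enough (Rabs d <= 0) by (apply Rabs_le_between in H; unfold d in H; lra).
  apply (le_epsilon_scaled _ _ (2 * (1 + al))); [lra|]. intros e He He1. rewrite Rplus_0_l.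
  destruct (damping_close al (u (1, 0)%Z) (e / 2)) as [c1 [Hc1 C1]]; [apply uA; rewrite weight_10; lra | lra|].
  destruct (damping_close al (u (0, 1)%Z) (e / 2)) as [c2 [Hc2 C2]]; [apply uA; rewrite weight_01; lra | lra|].
  set (c := Rmin c1 c2). assert (Hc : 0 < c) by (apply Rmin_pos; auto).
  destruct (damping_exists al c (u (1, 0)%Z)) as [G1 M1]; [lra | apply uA; rewrite weight_10; lra|].
  destruct (damping_exists al c (u (0, 1)%Z)) as [G2 M2]; [lra | apply uA; rewrite weight_01; lra|].
  replace (2 * (1 + al) * e) with (4 * (1 + al) * (e / 2)) by field.
  apply (phase_diff_almost_const c Hc G1 G2 M1 M2 (e / 2)); try lra.
  - apply (C1 c); auto. apply Rmin_l.
  - apply (C2 c); auto. apply Rmin_r.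
Qed.

End FlowPhase.

(** * Lifting unimodular functions *)

(** Distinct endpoint values would differ by at least 2 pi, and f would pass through f 0 + pi or f 0
    - pi, where [expi] is -1. *)
Lemma phase_const (f : R -> R) : continuity f -> (forall x, 0 <= x <= 1 -> expi (f x) = RtoC 1) -> f 1 = f 0.
Proof.
  intros Hf H. destruct (Req_dec (f 1) (f 0)) as [E|NE]; auto. exfalso.
  pose proof PI_RGT_0 as Hpi.
  destruct (expi_eq (f 1) (f 0)) as [k Hk]; [rewrite !H by lra; reflexivity|].
  assert (Hk0 : (k <> 0)%Z) by (intros ->; simpl in Hk; lra).
  assert (HM : exists y, Rmin (f 0) (f 1) <= y <= Rmax (f 0) (f 1) /\ (y = f 0 + PI \/ y = f 0 - PI)).
  { destruct (Z_lt_le_dec k 0) as [L|L].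
    - assert (IZR k <= -1) by (apply IZR_le; lia).
      exists (f 0 - PI). rewrite Rmin_right, Rmax_left by nra. split; [nra|auto].
    - assert (1 <= IZR k) by (apply IZR_le; lia).
      exists (f 0 + PI). rewrite Rmin_left, Rmax_right by nra. split; [nra|auto]. }
  destruct HM as [y [Hy Hy2]].
  destruct (IVT_gen f 0 1 y Hf Hy) as [x [Hx Ex]].
  rewrite Rmin_left, Rmax_right in Hx by lra.
  pose proof (H x Hx) as E1. pose proof (H 0 ltac:(lra)) as E0. rewrite Ex in E1.
  injection E1 as E1 _. injection E0 as E0 _.
  destruct Hy2 as [-> | ->].
  - rewrite cos_plus, cos_PI, sin_PI, E0 in E1. lra.
  - rewrite cos_minus, cos_PI, sin_PI, E0 in E1. lra.
Qed.

Lemma contR_line f a b c d : contR f -> continuity (fun x => f (a + b * x) (c + d * x)).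
Proof.
  intros Hf x. apply continuity_pt_filterlim.
  assert (Cf : contR (fun u v => f (a + b * u) (c + d * u))).
  { apply (contR_comp2 f (fun u _ => a + b * u) (fun u _ => c + d * u)); auto;
    repeat first [apply contR_plus | apply contR_mult | apply contR_const | apply contR_fst]. }
  apply (contR_continuous_snd (fun v u => f (a + b * u) (c + d * u)) 0 x).
  apply (contR_comp2 (fun u v => f (a + b * u) (c + d * u)) (fun _ t => t) (fun s _ => s)); auto;
  [apply contR_snd | apply contR_fst].
Qed.

Section Lift.
Context (u : fn) (Cu : contC u) (Pu : periodic2 u) (u1 : forall s t, Cmod (u s t) = 1).

(* Phase of [u (b * x) / u (a * x)]; the truncation at 1/2 makes it continuous everywhere. *)
Definition step (a b s t : R) : R :=
  let w := Cmult (u (b * s) (b * t)) (Cconj (u (a * s) (a * t))) in atan (snd w / Rmax (fst w) (1 / 2)).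

Lemma contR_step a b : contR (step a b).
Proof.
  assert (CW : contC (fun s t => Cmult (u (b * s) (b * t)) (Cconj (u (a * s) (a * t))))).
  { assert (L : forall c, contC (fun s t => u (c * s) (c * t))).
    { intros c. apply contC_comp2; auto; apply contR_mult; (apply contR_const || apply contR_fst || apply contR_snd). }
    apply contC_mult; auto. destruct (L a) as [L1 L2]. split; auto.
    apply contR_ext with (fun s t => (-1) * snd (u (a * s) (a * t))); [intros; simpl; ring|].
    apply contR_mult; auto. apply contR_const. }
  destruct CW as [W1 W2].
  unfold step. apply contR_comp; [intros x; apply derivable_continuous_pt, derivable_pt_atan|].
  assert (PM : forall x, 0 < Rmax x (1 / 2)) by (intros x; eapply Rlt_le_trans; [|apply Rmax_r]; lra).
  apply contR_mult; auto. intros s t. apply continuity_2d_pt_inv; [|apply Rgt_not_eq, PM].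
  revert s t.
  (* The maximum of x and 1/2 is written as (x + 1/2 + |x - 1/2|) / 2, which is visibly
     continuous. *)
  apply contR_ext with (fun s t => (fst (Cmult (u (b * s) (b * t)) (Cconj (u (a * s) (a * t)))) + 1 / 2 +
     Rabs (fst (Cmult (u (b * s) (b * t)) (Cconj (u (a * s) (a * t)))) - 1 / 2)) * / 2).
  - intros s t. generalize (fst (Cmult (u (b * s) (b * t)) (Cconj (u (a * s) (a * t))))). intros x.
    unfold Rmax, Rabs. destruct (Rle_dec x (1 / 2)); destruct (Rcase_abs (x - 1 / 2)); lra.
  - apply contR_mult; [|apply contR_const]. apply contR_plus; [apply contR_plus; [auto|apply contR_const]|].
    apply contR_comp; [apply Rcontinuity_abs|]. apply contR_minus; [auto | apply contR_const].
Qed.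

Lemma unit_conj z : Cmod z = 1 -> Cmult z (Cconj z) = RtoC 1.
Proof. intros E. rewrite <- Cmod2_conj, E. f_equal. ring. Qed.

Lemma step_phase a b s t : Cmod (Cminus (u (b * s) (b * t)) (u (a * s) (a * t))) < 1 / 2 ->
  Cmult (u (a * s) (a * t)) (expi (step a b s t)) = u (b * s) (b * t).
Proof.
  intros Hd. unfold step. set (x := u (b * s) (b * t)) in *. set (y := u (a * s) (a * t)) in *.
  assert (Hx : Cmod x = 1) by apply u1. assert (Hy : Cmod y = 1) by apply u1.
  set (w := Cmult x (Cconj y)).
  assert (Hw : Cmod (Cminus w (RtoC 1)) < 1 / 2).
  { rewrite <- (unit_conj y Hy). unfold w.
    replace (Cminus (Cmult x (Cconj y)) (Cmult y (Cconj y))) with (Cmult (Cminus x y) (Cconj y)) by aring.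
    rewrite Cmod_mult, Cmod_conj, Hy, Rmult_1_r. exact Hd. }
  assert (Hw1 : 1 / 2 < fst w).
  { assert (Q2 : Rabs (fst w + - (1)) < 1 / 2) by exact (Rle_lt_trans _ _ _ (Rabs_fst_le (Cminus w (RtoC 1))) Hw).
    apply Rabs_def2 in Q2. lra. }
  cbv zeta. fold w. rewrite Rmax_left by lra.
  pose proof (polar_atan w ltac:(lra)) as P.
  assert (Mw : Cmod w = 1) by (unfold w; rewrite Cmod_mult, Cmod_conj, Hx, Hy; ring).
  rewrite Mw, Cmult_1_l in P. rewrite <- P. unfold w.
  transitivity (Cmult x (Cmult y (Cconj y))); [aring|]. rewrite unit_conj by auto. apply Cmult_1_r.
Qed.

(** The phase accumulated by u over the first n of N equal steps on the segment from the origin to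
    (s, t). *)
Fixpoint psum (N n : nat) (s t : R) : R :=
  match n with O => 0 | S j => psum N j s t + step (INR j / INR N) (INR (S j) / INR N) s t end.

Lemma contR_psum N n : contR (psum N n).
Proof. induction n as [|n IH]; [apply contR_const | apply (contR_plus (psum N n)); auto; apply contR_step]. Qed.

(** Phase increments are summed along the ray from the origin. The sum is a lift as soon as N is
    large for the point ([good]); any two such N give the same value, by [phase_const] along the
    ray. N can therefore be held fixed near each point, and continuity is that of [psum]. *)
Lemma lift_exists : exists Hh : R -> R -> R, contR Hh /\ forall s t, u s t = expi (Hh s t).
Proof.
  destruct (unif_cont u Cu Pu (1 / 2)) as [d [Hd D]]; [lra|].
  set (good := fun (N : nat) s t => Rabs s + Rabs t < INR N * d).
  assert (GP : forall N s t, good N s t -> 0 < INR N).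
  { intros N s t Hg. unfold good in Hg. pose proof (Rabs_pos s). pose proof (Rabs_pos t).
    destruct (Rle_lt_dec (INR N) 0); auto. nra. }
  assert (E1 : forall N s t, good N s t -> forall n, Cmult (u 0 0) (expi (psum N n s t)) = u (INR n / INR N * s) (INR n / INR N * t)).
  { intros N s t Hg n. pose proof (GP N s t Hg) as HN. induction n as [|n IH].
    - cbn [psum INR]. rewrite expi_0. unfold Rdiv. rewrite !Rmult_0_l. apply Cmult_1_r.
    - cbn [psum]. rewrite expi_add, Cmult_assoc, IH. apply step_phase.
      pose proof (Rabs_pos s) as Ps. pose proof (Rabs_pos t) as Pt.
      assert (S1 : forall z, INR (S n) / INR N * z - INR n / INR N * z = z / INR N) by (intros; rewrite S_INR; field; lra).
      assert (S2 : forall z, Rabs z < INR N * d -> Rabs (z / INR N) < d).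
      { intros z Hz. unfold Rdiv. rewrite Rabs_mult, Rabs_inv, (Rabs_pos_eq (INR N)) by lra.
        apply Rmult_lt_reg_r with (INR N); auto. rewrite Rmult_assoc, Rinv_l by lra. lra. }
      unfold good in Hg. apply D; rewrite S1; apply S2; lra. }
  assert (E2 : forall N s t, good N s t -> Cmult (u 0 0) (expi (psum N N s t)) = u s t).
  { intros N s t Hg. rewrite (E1 N s t Hg N). pose proof (GP N s t Hg). f_equal; field; lra. }
  assert (Z0 : forall N, psum N N 0 0 = 0).
  { intros N. assert (Z1 : forall n, psum N n 0 0 = 0); [|apply Z1].
    induction n as [|n IH]; [reflexivity|]. cbn [psum]. rewrite IH. unfold step. rewrite !Rmult_0_r.
    rewrite unit_conj by apply u1. simpl. unfold Rdiv. rewrite Rmult_0_l, atan_0. ring. }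
  assert (U0 : u 0 0 <> RtoC 0).
  { intros E. pose proof (u1 0 0) as Q. rewrite E, Cmod_0 in Q. lra. }
  assert (CONS : forall N M s t, good N s t -> good M s t -> psum N N s t = psum M M s t).
  { intros N M s t HN HM.
    set (f := fun x => psum N N (0 + s * x) (0 + t * x) - psum M M (0 + s * x) (0 + t * x)).
    assert (Cf : continuity f).
    { apply (continuity_minus (fun x => psum N N (0 + s * x) (0 + t * x)) (fun x => psum M M (0 + s * x) (0 + t * x)));
      apply contR_line; apply contR_psum. }
    assert (F1 : f 1 = f 0).
    { apply phase_const; auto. intros x Hx. unfold f.
      assert (GG : forall K, good K s t -> good K (0 + s * x) (0 + t * x)).
      { intros K HK. unfold good in *. rewrite !Rplus_0_l, !Rabs_mult, (Rabs_pos_eq x) by lra.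
        pose proof (Rabs_pos s). pose proof (Rabs_pos t). nra. }
      pose proof (E2 N _ _ (GG N HN)) as A1. pose proof (E2 M _ _ (GG M HM)) as A2.
      rewrite <- A2 in A1.
      assert (A3 : expi (psum N N (0 + s * x) (0 + t * x)) = expi (psum M M (0 + s * x) (0 + t * x))).
      { apply (f_equal (Cmult (Cinv (u 0 0)))) in A1. rewrite !Cmult_assoc, Cinv_l, !Cmult_1_l in A1 by auto. exact A1. }
      unfold Rminus. rewrite expi_add, A3, <- expi_add, Rplus_opp_r. apply expi_0. }
    unfold f in F1. rewrite !Rmult_0_r, !Rmult_1_r, !Rplus_0_l, !Z0 in F1. lra. }
  (* A starting phase: [atan] in the right half-plane, the same after a rotation by pi in the left
     one, and plus or minus pi / 2 on the imaginary axis. *)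
  assert (T0 : exists th, u 0 0 = expi th).
  { destruct (u 0 0) as [x y] eqn:E0.
    pose proof (u1 0 0) as Q. rewrite E0 in Q. unfold Cmod in Q; simpl in Q.
    assert (Q2 : x * x + y * y = 1).
    { rewrite <- (sqrt_sqrt (x * x + y * y)) by nra.
      replace (sqrt (x * x + y * y)) with 1; [ring|]. rewrite <- Q. f_equal; ring. }
    destruct (Rle_lt_dec x 0) as [L|L].
    - destruct (Rlt_le_dec x 0) as [L2|L2].
      + pose proof (polar_atan (- x, - y) ltac:(simpl; lra)) as P. simpl in P.
        assert (M : Cmod (- x, - y) = 1) by (unfold Cmod; simpl; transitivity (sqrt 1); [f_equal; nra | apply sqrt_1]).
        rewrite M, Cmult_1_l in P. exists (atan (- y / - x) + PI).
        rewrite expi_add, <- P. apply C_eq; simpl; rewrite cos_PI, sin_PI; ring.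
      + assert (x = 0) by lra. subst x. destruct (Rle_lt_dec y 0).
        * exists (- (PI / 2)). rewrite expi_conj. apply C_eq; simpl; rewrite ?cos_PI2, ?sin_PI2; nra.
        * exists (PI / 2). apply C_eq; simpl; rewrite ?cos_PI2, ?sin_PI2; nra.
    - pose proof (polar_atan (x, y) ltac:(simpl; lra)) as P. simpl in P.
      assert (M : Cmod (x, y) = 1) by (unfold Cmod; simpl; transitivity (sqrt 1); [f_equal; nra | apply sqrt_1]).
      rewrite M, Cmult_1_l in P. exists (atan (y / x)). exact P. }
  destruct T0 as [th Hth].
  assert (NE : forall r, exists N : nat, r < INR N * d).
  { intros r. destruct (archimed (Rabs r / d)) as [A1 _].
    exists (Z.to_nat (up (Rabs r / d))).
    assert (0 <= Rabs r / d) by (apply Rmult_le_pos; [apply Rabs_pos | left; apply Rinv_0_lt_compat; auto]).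
    rewrite INR_IZR_INZ, Z2Nat.id by (apply le_IZR; lra).
    apply Rle_lt_trans with (Rabs r / d * d).
    - replace (Rabs r / d * d) with (Rabs r) by (field; lra). apply Rle_abs.
    - apply Rmult_lt_compat_r; auto. }
  set (NN := fun s t => Z.to_nat (up ((Rabs s + Rabs t) / d))).
  assert (NG : forall s t, good (NN s t) s t).
  { intros s t. unfold good, NN. pose proof (Rabs_pos s). pose proof (Rabs_pos t).
    destruct (archimed ((Rabs s + Rabs t) / d)) as [A1 _].
    assert (0 <= (Rabs s + Rabs t) / d) by (apply Rmult_le_pos; [lra | left; apply Rinv_0_lt_compat; auto]).
    rewrite INR_IZR_INZ, Z2Nat.id by (apply le_IZR; lra).
    replace (Rabs s + Rabs t) with ((Rabs s + Rabs t) / d * d) at 1 by (field; lra).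
    apply Rmult_lt_compat_r; auto. }
  exists (fun s t => th + psum (NN s t) (NN s t) s t). split.
  (* The margin 2 keeps this N good on the whole neighbourhood of radius 1 in each coordinate. *)
  - intros s t. destruct (NE (Rabs s + Rabs t + 2)) as [N HN].
    apply continuity_2d_pt_ext_loc with (fun s t => th + psum N N s t).
    + exists (mkposreal 1 Rlt_0_1). simpl. intros s' t' Hs Ht. f_equal.
      apply CONS; auto. unfold good.
      pose proof (Rabs_triang (s' - s) s). pose proof (Rabs_triang (t' - t) t).
      replace (s' - s + s) with s' in * by ring. replace (t' - t + t) with t' in * by ring. lra.
    + apply (contR_plus (fun _ _ => th) (psum N N)); [apply contR_const | apply contR_psum].
  - intros s t. rewrite expi_add, <- Hth. symmetry. apply E2, NG.
Qed.

End Lift.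

Lemma phase_const_2d (f : R -> R -> R) : contR f -> (forall s t, expi (f s t) = RtoC 1) -> forall s t, f s t = f 0 0.
Proof.
  intros Hf H s t.
  pose proof (phase_const (fun x => f (0 + s * x) (0 + t * x)) (contR_line f 0 s 0 t Hf) ltac:(intros; apply H)) as E.
  cbv beta in E. rewrite !Rmult_0_r, !Rmult_1_r, !Rplus_0_l in E. exact E.
Qed.

(* [a] and [b] are the winding numbers of [u]. *)
Lemma lift_winding (u : fn) (Hh : R -> R -> R) : periodic2 u -> contR Hh -> (forall s t, u s t = expi (Hh s t)) ->
  exists a b : Z, exists h : R -> R -> R, contR h /\ (forall s t, h (s + 2 * PI) t = h s t /\ h s (t + 2 * PI) = h s t) /\
    forall s t, Hh s t = IZR a * s + IZR b * t + h s t.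
Proof.
  intros Pu CH E. pose proof PI_RGT_0 as Hpi.
  assert (W1 : exists a : Z, forall s t, Hh (s + 2 * PI) t - Hh s t = 2 * PI * IZR a).
  { destruct (expi_eq (Hh (0 + 2 * PI) 0) (Hh 0 0)) as [a Ha]; [rewrite <- !E; apply Pu|].
    exists a. intros s t. rewrite <- Ha.
    apply (phase_const_2d (fun s t => Hh (s + 2 * PI) t - Hh s t)).
    - apply contR_minus; auto. apply (contR_comp2 Hh); auto.
      + apply contR_plus; [apply contR_fst | apply contR_const].
      + apply contR_snd.
    - intros s' t'. unfold Rminus. rewrite expi_add, <- E, (proj1 (Pu s' t')), E, <- expi_add, Rplus_opp_r. apply expi_0. }
  assert (W2 : exists b : Z, forall s t, Hh s (t + 2 * PI) - Hh s t = 2 * PI * IZR b).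
  { destruct (expi_eq (Hh 0 (0 + 2 * PI)) (Hh 0 0)) as [b Hb]; [rewrite <- !E; apply Pu|].
    exists b. intros s t. rewrite <- Hb.
    apply (phase_const_2d (fun s t => Hh s (t + 2 * PI) - Hh s t)).
    - apply contR_minus; auto. apply (contR_comp2 Hh); auto.
      + apply contR_fst.
      + apply contR_plus; [apply contR_snd | apply contR_const].
    - intros s' t'. unfold Rminus. rewrite expi_add, <- E, (proj2 (Pu s' t')), E, <- expi_add, Rplus_opp_r. apply expi_0. }
  destruct W1 as [a Ha]. destruct W2 as [b Hb].
  exists a, b, (fun s t => Hh s t - (IZR a * s + IZR b * t)). split; [|split].
  - apply contR_minus; auto. apply contR_lin0.
  - intros s t. specialize (Ha s t). specialize (Hb s t). split; lra.
  - intros; ring.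
Qed.

(** * Diophantine approximation and rigidity *)

Lemma nth_map_eq {A : Type} (f : nat -> A) (n : nat) :
  ~ NoDup (map f (seq 0 n)) -> exists i j, (i < j < n)%nat /\ f i = f j.
Proof.
  intros H. apply NNPP. intros HN. apply H.
  assert (G : forall m k, (m + k <= n)%nat -> NoDup (map f (seq m k))).
  { intros m k. revert m. induction k as [|k IH]; intros m Hm; simpl; [constructor|].
    constructor; [|apply IH; lia].
    intros HI. apply in_map_iff in HI. destruct HI as [j [E Hj]]. apply in_seq in Hj.
    apply HN. exists m, j. split; [lia | auto]. }
  apply G. lia.
Qed.

Lemma pigeonhole_list {A : Type} (f : nat -> A) (l : list A) : (forall n, In (f n) l) ->
  exists i j, (i < j <= length l)%nat /\ f i = f j.
Proof.
  intros H. destruct (nth_map_eq f (S (length l))) as [i [j [Hij E]]].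
  - intros HD. apply NoDup_incl_length with (l' := l) in HD.
    + rewrite length_map, length_seq in HD. lia.
    + intros a Ha. apply in_map_iff in Ha. destruct Ha as [k [<- _]]. apply H.
  - exists i, j. split; [lia | auto].
Qed.

(** Dirichlet's pigeonhole argument: the N + 1 fractional parts of j th, for j from 0 to N, fall
    into N intervals of length 1 / N. *)
Lemma dirichlet (th : R) (N : nat) : (1 <= N)%nat ->
  exists x y : Z, (1 <= y <= Z.of_nat N)%Z /\ Rabs (IZR x - IZR y * th) < / INR N.
Proof.
  intros HN. assert (HN' : 0 < INR N) by (apply lt_0_INR; lia).
  set (fl := fun j : nat => (up (INR j * th) - 1)%Z).
  set (fr := fun j : nat => INR j * th - IZR (fl j)).
  assert (Hfr : forall j, 0 <= fr j < 1).
  { intros j. unfold fr, fl. rewrite minus_IZR. destruct (archimed (INR j * th)) as [A1 A2]. lra. }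
  set (g := fun j : nat => (up (INR N * fr j) - 1)%Z).
  assert (Hg : forall j, IZR (g j) <= INR N * fr j < IZR (g j) + 1).
  { intros j. unfold g. rewrite minus_IZR. destruct (archimed (INR N * fr j)) as [A1 A2]. lra. }
  destruct (pigeonhole_list g (map Z.of_nat (seq 0 N))) as [i [j [Hij E]]].
  - intros j. apply in_map_iff. exists (Z.to_nat (g j)).
    destruct (Hg j) as [G1 G2]. destruct (Hfr j) as [F1 F2].
    assert (0 <= g j)%Z.
    { apply Z.lt_succ_r. apply lt_IZR. unfold Z.succ. rewrite plus_IZR. nra. }
    assert (g j < Z.of_nat N)%Z.
    { apply lt_IZR. rewrite <- INR_IZR_INZ. nra. }
    split; [lia|]. apply in_seq. lia.
  - rewrite length_map, length_seq in Hij.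
    exists (fl j - fl i)%Z, (Z.of_nat j - Z.of_nat i)%Z. split; [lia|].
    replace (IZR (fl j - fl i) - IZR (Z.of_nat j - Z.of_nat i) * th) with (fr i - fr j).
    + pose proof (Hg i) as Gi. pose proof (Hg j) as Gj. rewrite E in Gi.
      apply Rmult_lt_reg_l with (INR N); auto. rewrite Rinv_r by lra.
      rewrite <- (Rabs_pos_eq (INR N)) at 1 by lra. rewrite <- Rabs_mult.
      apply Rabs_def1; lra.
    + unfold fr. rewrite !minus_IZR, <- !INR_IZR_INZ. ring.
Qed.

Lemma irrational_weight_0 al (m : Z * Z) : irrational al -> weight al m = 0 -> m = (0, 0)%Z.
Proof.
  intros Hi H. destruct m as [a b]. unfold weight in H; simpl in H.
  destruct (Z.eq_dec b 0) as [->|Hb].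
  - rewrite Rmult_0_r, Rplus_0_r in H. apply eq_IZR in H. subst; auto.
  - exfalso. apply (Hi (- a)%Z b Hb). rewrite opp_IZR. assert (IZR b <> 0) by (apply not_0_IZR; auto).
    apply Rmult_eq_reg_r with (IZR b); auto. field_simplify; auto. lra.
Qed.

(** Dirichlet approximation gives a nonzero frequency of small weight; the weight is nonzero by
    irrationality, and negating the frequency fixes the sign. *)
Lemma small_weight al eps : irrational al -> 0 < eps -> exists m, 0 < weight al m < eps.
Proof.
  intros Hi He. destruct (archimed_cor1 eps He) as [N [HN HN0]].
  destruct (dirichlet al N) as [x [y [Hy Hxy]]]; [lia|].
  assert (E : weight al (x, (- y)%Z) = IZR x - IZR y * al) by (unfold weight; simpl; rewrite opp_IZR; ring).
  destruct (Rtotal_order (weight al (x, (- y)%Z)) 0) as [L|[Z0|L]].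
  - exists (freq_opp (x, - y)%Z). rewrite weight_opp. rewrite <- E in Hxy. rewrite Rabs_left in Hxy by auto. lra.
  - apply irrational_weight_0 in Z0; auto. injection Z0 as _ Z0. lia.
  - exists (x, (- y)%Z). rewrite <- E in Hxy. rewrite Rabs_right in Hxy by lra. lra.
Qed.

Lemma expi_linear_approx x : Cmod (Cminus (expi x) (1, x)) <= 2 * x ^ 2.
Proof.
  assert (S1 : forall t, Rabs (sin t) <= Rabs t).
  { intros t. pose proof (bounded_variation sin cos 1 0 t) as H. rewrite sin_0, !Rminus_0_r, Rmult_1_l in H.
    apply H. intros y _. split; [auto_derive; auto; ring|]. apply Rabs_le. apply COS_bound. }
  assert (C1 : forall t, Rabs (cos t - 1) <= Rabs t * Rabs t).
  { intros t. pose proof (bounded_variation cos (fun y => - sin y) (Rabs t) 0 t) as H. rewrite cos_0, !Rminus_0_r in H.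
    apply H. intros y Hy. split; [auto_derive; auto; ring|]. rewrite Rabs_Ropp. rewrite Rminus_0_r in Hy.
    eapply Rle_trans; [apply S1 | auto]. }
  assert (C2 : forall t, Rabs (cos t - 1) <= Rabs t).
  { intros t. pose proof (bounded_variation cos (fun y => - sin y) 1 0 t) as H. rewrite cos_0, !Rminus_0_r, Rmult_1_l in H.
    apply H. intros y Hy. split; [auto_derive; auto; ring|]. rewrite Rabs_Ropp. apply Rabs_le, SIN_bound. }
  assert (S2 : Rabs (sin x - x) <= Rabs x * Rabs x).
  { pose proof (bounded_variation (fun y => sin y - y) (fun y => cos y - 1) (Rabs x) 0 x) as H.
    cbv beta in H. rewrite sin_0, !Rminus_0_r in H.
    apply H. intros y Hy. split; [auto_derive; auto; ring|]. rewrite Rminus_0_r in Hy. eapply Rle_trans; [apply C2|exact Hy]. }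
  specialize (C1 x). assert (E : Rabs x * Rabs x = x ^ 2) by (rewrite <- Rabs_mult, Rabs_pos_eq by nra; ring).
  rewrite E in *. eapply Rle_trans; [apply Cmod_le_sum|]. simpl fst. simpl snd. unfold Rminus in *. lra.
Qed.

Definition shift (a b : R) (F : fn) : fn := fun s t => F (s + a) (t + b).

Lemma contC_shift a b F : contC F -> contC (shift a b F).
Proof.
  intros H. apply (contC_comp2 F (fun s _ => s + a) (fun _ t => t + b)); auto; apply contR_plus; (apply contR_fst || apply contR_snd || apply contR_const).
Qed.

Lemma coef_shift_teval a b p m : coef (shift a b (teval p)) m = Cmult (chi m a b) (coef (teval p) m).
Proof.
  rewrite (coef_ext _ (teval (map (fun e => (Cmult (fst e) (chi (snd e) a b), snd e)) p))).
  - rewrite !coef_teval. induction p as [|f p IH]; simpl; [aring|].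
    rewrite IH. destruct (freq_dec (snd f) m) as [->|_]; aring.
  - intros s t. unfold shift, teval. induction p as [|f p IH]; simpl; [reflexivity|].
    rewrite IH.
    assert (E : chi (snd f) (s + a) (t + b) = Cmult (chi (snd f) s t) (chi (snd f) a b)).
    { unfold chi. rewrite <- expi_add. f_equal. aring. }
    rewrite E. aring.
Qed.

(** Read off from the terms of a polynomial and then passed to the uniform limit, in place of a
    change of variables in the iterated integral. *)
Lemma coef_shift a b F m : contC F -> periodic2 F -> coef (shift a b F) m = Cmult (chi m a b) (coef F m).
Proof.
  intros HC HP. apply C_eq_of_small. intros e He.
  destruct (fejer_approx F HC HP (e / 4)) as [n Hn]; [lra|].
  set (p := fejer F n) in *.
  assert (D1 : Cmod (Cminus (coef (shift a b F) m) (coef (shift a b (teval p)) m)) <= 2 * (e / 4)).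
  { rewrite <- coef_minus by (apply contC_shift; auto; apply contC_teval).
    apply coef_bound; [apply contC_minus; apply contC_shift; auto; apply contC_teval | intros; apply Hn]. }
  assert (D2 : Cmod (Cminus (coef F m) (coef (teval p) m)) <= 2 * (e / 4)).
  { rewrite <- coef_minus by (auto; apply contC_teval).
    apply coef_bound; [apply contC_minus; auto; apply contC_teval | exact Hn]. }
  rewrite coef_shift_teval in D1.
  replace (Cminus (coef (shift a b F) m) (Cmult (chi m a b) (coef F m))) with
    (Cminus (Cminus (coef (shift a b F) m) (Cmult (chi m a b) (coef (teval p) m)))
      (Cmult (chi m a b) (Cminus (coef F m) (coef (teval p) m)))) by aring.
  eapply Rle_trans; [apply Cmod_triangle|]. rewrite Cmod_opp, Cmod_mult, Cmod_chi. lra.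
Qed.

Definition Rfun (h : R -> R -> R) : fn := fun s t => RtoC (h s t).
Definition periodicR (h : R -> R -> R) : Prop := forall s t, h (s + 2 * PI) t = h s t /\ h s (t + 2 * PI) = h s t.

Lemma contC_Rfun h : contR h -> contC (Rfun h).
Proof. intros H; split; [exact H | apply (contR_const 0)]. Qed.
Lemma periodic_Rfun h : periodicR h -> periodic2 (Rfun h).
Proof. intros H s t. unfold Rfun. destruct (H s t) as [-> ->]. auto. Qed.

Lemma Rfun_const h : contR h -> periodicR h -> (forall m, m <> (0, 0)%Z -> coef (Rfun h) m = RtoC 0) ->
  forall s t, h s t = h 0 0.
Proof.
  intros Ch Ph H s t.
  pose proof (const_of_coef (Rfun h) (contC_Rfun h Ch) (periodic_Rfun h Ph) H s t 0 0) as E.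
  unfold Rfun in E. injection E; auto.
Qed.

(* Invariance multiplies the coefficient at [m] by e^(i x weight(m)), and the weight vanishes only at 0. *)
Lemma flow_invariant_const al k : irrational al -> contR k -> periodicR k ->
  (forall s t x, k (s + x) (t + al * x) = k s t) -> forall s t, k s t = k 0 0.
Proof.
  intros Hi Ck Pk H. apply Rfun_const; auto. intros m Hm.
  assert (Hw : weight al m <> 0) by (intros E; apply Hm, irrational_weight_0 with al; auto).
  (* At this time the character m takes the value -1, so the coefficient equals its own opposite. *)
  set (x := PI / weight al m).
  pose proof (coef_shift x (al * x) (Rfun k) m (contC_Rfun k Ck) (periodic_Rfun k Pk)) as E.
  rewrite (coef_ext _ (Rfun k)) in E by (intros; unfold shift, Rfun; rewrite H; auto).
  assert (EX : chi m x (al * x) = RtoC (-1)).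
  { unfold chi. replace (IZR (fst m) * x + IZR (snd m) * (al * x)) with (weight al m * x) by (unfold weight; aring).
    replace (weight al m * x) with PI by (unfold x; field; auto).
    apply C_eq; simpl; [apply cos_PI | apply sin_PI]. }
  rewrite EX in E. revert E. generalize (coef (Rfun k) m). intros z E.
  assert (E1 := f_equal fst E). assert (E2 := f_equal snd E). simpl in E1, E2.
  apply C_eq; simpl; lra.
Qed.

Lemma Rfun_coef_conj h m : contR h -> coef (Rfun h) (freq_opp m) = Cconj (coef (Rfun h) m).
Proof.
  intros Ch. unfold coef.
  assert (E : freq_opp (freq_opp m) = m) by (destruct m; unfold freq_opp; simpl; f_equal; lia). rewrite E.
  assert (N : forall s t, IZR (- fst m) * s + IZR (- snd m) * t = - (IZR (fst m) * s + IZR (snd m) * t)).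
  { intros. rewrite !opp_IZR. ring. }
  apply C_eq.
  - apply mean_ext. intros s t. unfold chi, freq_opp; simpl. rewrite N, cos_neg, sin_neg. ring.
  - transitivity ((-1) * mean (fun s t => snd (Cmult (Rfun h s t) (chi (freq_opp m) s t)))); [|simpl; ring].
    rewrite <- mean_scal.
    + apply mean_ext. intros s t. unfold chi, freq_opp; simpl. rewrite N, cos_neg, sin_neg. ring.
    + apply (contC_mult (Rfun h) (chi (freq_opp m))); [apply contC_Rfun; auto | apply contC_chi].
Qed.

(* If chi_M e^(i sg h) is analytic with weight of M equal to lam * sg, for arbitrarily small sg,
   then linearising in sg kills the negative Fourier coefficients of h. *)
Lemma linearise al lam h : irrational al -> contR h -> periodicR h ->
  (forall eps, 0 < eps -> exists sg, 0 < sg < eps /\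
    forall m, weight al m + lam * sg < 0 -> coef (fun s t => expi (sg * h s t)) m = RtoC 0) ->
  forall s t, h s t = h 0 0.
Proof.
  intros Hi Ch Ph HS.
  assert (NEG : forall m, weight al m < 0 -> coef (Rfun h) m = RtoC 0).
  { intros m Hm.
    destruct (CT2_bounded (Rfun h) (contC_Rfun h Ch) (periodic_Rfun h Ph)) as [B [HB BB]].
    apply Cmod_eq_0. apply Rle_antisym; [|apply Cmod_ge_0].
    apply (le_epsilon_scaled _ _ (4 * B ^ 2)); [nra|]. intros eps He _. rewrite Rplus_0_l.
    (* Below this threshold lam sg cannot bring the negative weight of m up to 0, whatever the sign
       of lam. *)
    assert (HL : 0 < - weight al m / (Rabs lam + 1)).
    { apply Rdiv_lt_0_compat; [lra|]. pose proof (Rabs_pos lam). lra. }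
    destruct (HS (Rmin eps (- weight al m / (Rabs lam + 1)))) as [sg [[Hs1 Hs2] Hsg]]; [apply Rmin_pos; auto|].
    assert (Hse : sg < eps) by (eapply Rlt_le_trans; [exact Hs2|apply Rmin_l]).
    assert (Hsl : sg < - weight al m / (Rabs lam + 1)) by (eapply Rlt_le_trans; [exact Hs2|apply Rmin_r]).
    assert (Z0 : coef (fun s t => expi (sg * h s t)) m = RtoC 0).
    { apply Hsg. pose proof (Rabs_pos lam). pose proof (Rle_abs lam).
      assert (sg * (Rabs lam + 1) < - weight al m).
      { apply Rmult_lt_reg_r with (/ (Rabs lam + 1)); [apply Rinv_0_lt_compat; lra|].
        replace (sg * (Rabs lam + 1) * / (Rabs lam + 1)) with sg by (field; lra). exact Hsl. }
      nra. }
    assert (CE : contC (fun s t => expi (sg * h s t))).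
    { apply contC_expi. apply contR_mult; auto. apply contR_const. }
    assert (CR := contC_Rfun h Ch).
    assert (Hm0 : coef (fun _ _ => RtoC 1) m = RtoC 0).
    { rewrite (coef_ext _ (chi (0, 0)%Z)) by (intros; rewrite chi_0; auto). rewrite coef_chi.
      destruct (freq_dec (0, 0)%Z m) as [E|_]; auto. subst m. unfold weight in Hm; simpl in Hm. lra. }
    (* The first-order part 1 + i sg h. The constant has no coefficient at m, whose weight is
       negative, so the quadratic error leaves sg |coef| <= 4 B^2 sg^2, and one factor sg
       cancels. *)
    set (L := fun s t => Cplus (RtoC 1) (Cmult (0, sg) (Rfun h s t))).
    assert (CL : contC L).
    { apply (contC_plus (fun _ _ => RtoC 1) (fun s t => Cmult (0, sg) (Rfun h s t))); [apply contC_const|].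
      apply contC_mult; [apply contC_const | auto]. }
    assert (EL : coef L m = Cmult (0, sg) (coef (Rfun h) m)).
    { unfold L. rewrite coef_plus, coef_scal, Hm0; auto; [ring|apply contC_const|].
      apply contC_mult; [apply contC_const | auto]. }
    assert (D : Cmod (Cminus (coef (fun s t => expi (sg * h s t)) m) (coef L m)) <= 2 * (2 * (sg * B) ^ 2)).
    { rewrite <- coef_minus by auto. apply coef_bound; [apply contC_minus; auto|].
      intros s t. unfold L. replace (Cplus (RtoC 1) (Cmult (0, sg) (Rfun h s t))) with ((1, sg * h s t) : C)
        by (apply C_eq; simpl; ring).
      eapply Rle_trans; [apply expi_linear_approx|]. apply Rmult_le_compat_l; [lra|].
      specialize (BB s t). unfold Rfun in BB. rewrite Cmod_R in BB.
      rewrite !Rpow_mult_distr. apply Rmult_le_compat_l; [apply pow2_ge_0|].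
      rewrite <- (pow2_abs (h s t)). apply pow_incr. split; [apply Rabs_pos | auto]. }
    rewrite Z0, EL in D.
    replace (Cminus (RtoC 0) (Cmult (0, sg) (coef (Rfun h) m))) with (Cmult (0, - sg) (coef (Rfun h) m)) in D
      by (apply C_eq; simpl; ring).
    rewrite Cmod_mult in D.
    assert (E : Cmod (0, - sg) = sg).
    { unfold Cmod; simpl. replace (0 * (0 * 1) + - sg * (- sg * 1)) with (Rsqr sg) by (unfold Rsqr; ring).
      apply sqrt_Rsqr; lra. }
    rewrite E in D.
    apply Rle_trans with (4 * B ^ 2 * sg).
    - apply Rmult_le_reg_l with sg; auto. nra.
    - apply Rmult_le_compat_l; [nra|lra]. }
  apply Rfun_const; auto. intros m Hm.
  destruct (Rtotal_order (weight al m) 0) as [L|[E|L]]; auto.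
  - exfalso. apply Hm, irrational_weight_0 with al; auto.
  (* As h is real, the coefficient at m is the conjugate of the one at -m, whose weight is
     negative. *)
  - assert (E : m = freq_opp (freq_opp m)) by (destruct m; unfold freq_opp; simpl; f_equal; lia).
    rewrite E, Rfun_coef_conj, NEG by (auto; rewrite weight_opp; lra). apply C_eq; simpl; ring.
Qed.

(** * Isometric automorphisms are affine *)

Lemma Aalpha_bounded al F : Aalpha al F -> exists B, 0 <= B /\ forall s t, Cmod (F s t) <= B.
Proof. intros HF. apply CT2_bounded; [eapply Aalpha_contC | eapply Aalpha_periodic]; eauto. Qed.

Lemma Aalpha_mult al F G : Aalpha al F -> Aalpha al G -> Aalpha al (fun s t => Cmult (F s t) (G s t)).
Proof.
  intros HF HG. destruct (Aalpha_bounded al F HF) as [B1 [HB1 BB1]]. destruct (Aalpha_bounded al G HG) as [B2 [HB2 BB2]].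
  apply Aalpha_of_approx. intros eps He.
  set (r := B1 + B2). set (d := Rmin 1 (eps / (2 * r + 1))).
  assert (Hr : 0 <= r) by (unfold r; lra).
  assert (0 < eps / (2 * r + 1)) by (apply Rdiv_lt_0_compat; lra).
  assert (Hd : 0 < d) by (apply Rmin_pos; lra).
  assert (Hd1 : d <= 1) by apply Rmin_l.
  assert (Hd2 : (2 * r + 1) * d <= eps).
  { apply Rle_trans with ((2 * r + 1) * (eps / (2 * r + 1))).
    - apply Rmult_le_compat_l; [lra | apply Rmin_r].
    - right; field; lra. }
  destruct (Aalpha_approx al F HF d Hd) as [p [Hp N1]]. destruct (Aalpha_approx al G HG d Hd) as [q [Hq N2]].
  exists (poly_mul p q). split; [apply analytic_poly_mul; auto|].
  intros s t. rewrite teval_poly_mul. eapply Rle_trans; [|exact Hd2].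
  apply near_mult; auto; try lra; intros; unfold r.
  - specialize (BB1 s0 t0). lra.
  - specialize (BB2 s0 t0). lra.
Qed.

Lemma Aalpha_plus al F G : Aalpha al F -> Aalpha al G -> Aalpha al (fun s t => Cplus (F s t) (G s t)).
Proof.
  intros HF HG. apply Aalpha_intro.
  - apply contC_plus; eapply Aalpha_contC; eauto.
  - intros s t. destruct (Aalpha_periodic al F HF s t) as [-> ->]. destruct (Aalpha_periodic al G HG s t) as [-> ->]. auto.
  - intros m Hm. rewrite coef_plus by (eapply Aalpha_contC; eauto).
    rewrite (Aalpha_coef al F m), (Aalpha_coef al G m) by auto. ring.
Qed.

Lemma Aalpha_scal al c F : Aalpha al F -> Aalpha al (fun s t => Cmult c (F s t)).
Proof.
  intros HF. apply Aalpha_intro.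
  - apply contC_mult; [apply contC_const | eapply Aalpha_contC; eauto].
  - intros s t. destruct (Aalpha_periodic al F HF s t) as [-> ->]. auto.
  - intros m Hm. rewrite coef_scal by (eapply Aalpha_contC; eauto).
    rewrite (Aalpha_coef al F m) by auto. ring.
Qed.

(** With x = 1 - cos a the square of the left side is 4 - 2 x, and that of the right side exceeds it
    by x^2 / 4. *)
Lemma Cmod_1_plus_expi a : Cmod (Cplus (RtoC 1) (expi a)) <= 2 - (1 - cos a) / 2.
Proof.
  pose proof (COS_bound a). apply Rsqr_incr_0_var; [|lra].
  unfold Rsqr. replace (Cmod (Cplus (RtoC 1) (expi a)) * Cmod (Cplus (RtoC 1) (expi a))) with (Cmod (Cplus (RtoC 1) (expi a)) ^ 2) by ring.
  rewrite Cmod2_alt. unfold Re, Im. simpl. pose proof (sin2_cos2 a) as E. unfold Rsqr in E. nra.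
Qed.

(** The function (2 + e^(i(s - s0)) + e^(i(t - t0))) / 4. Its frequencies have weights 0, 1 and al,
    so it lies in the algebra, and its modulus reaches 1 only at (s0, t0) modulo periods. *)
Definition peak (s0 t0 : R) : fn := teval
  ((RtoC (1 / 2), (0, 0)%Z) :: (Cmult (RtoC (1 / 4)) (expi (- s0)), (1, 0)%Z) ::
   (Cmult (RtoC (1 / 4)) (expi (- t0)), (0, 1)%Z) :: nil).

Lemma peak_eq s0 t0 s t : peak s0 t0 s t =
  Cmult (RtoC (1 / 4)) (Cplus (Cplus (RtoC 1) (expi (s - s0))) (Cplus (RtoC 1) (expi (t - t0)))).
Proof.
  unfold peak, teval, peval, fold_right. cbn [fst snd]. rewrite chi_0.
  replace (chi (1, 0)%Z s t) with (expi s) by (unfold chi; simpl; f_equal; ring).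
  replace (chi (0, 1)%Z s t) with (expi t) by (unfold chi; simpl; f_equal; ring).
  unfold Rminus. rewrite !expi_add.
  generalize (expi s) (expi t) (expi (- s0)) (expi (- t0)). intros. apply C_eq; simpl; lra.
Qed.

Lemma Aalpha_peak al s0 t0 : 0 < al -> Aalpha al (peak s0 t0).
Proof.
  intros Hal. apply teval_Aalpha. repeat constructor; unfold weight; simpl; lra.
Qed.

Lemma peak_1 s0 t0 : peak s0 t0 s0 t0 = RtoC 1.
Proof. rewrite peak_eq, !Rminus_diag_eq, expi_0 by reflexivity. apply C_eq; simpl; lra. Qed.

Lemma peak_bound s0 t0 s t : Cmod (peak s0 t0 s t) <= 1 - ((1 - cos (s0 - s)) + (1 - cos (t0 - t))) / 8.
Proof.
  rewrite peak_eq, Cmod_mult, Cmod_R, Rabs_pos_eq by lra.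
  pose proof (Cmod_triangle (Cplus (RtoC 1) (expi (s - s0))) (Cplus (RtoC 1) (expi (t - t0)))).
  pose proof (Cmod_1_plus_expi (s - s0)) as A1. pose proof (Cmod_1_plus_expi (t - t0)) as A2.
  rewrite <- cos_neg in A1, A2.
  replace (- (s - s0)) with (s0 - s) in A1 by ring. replace (- (t - t0)) with (t0 - t) in A2 by ring. lra.
Qed.

Section Aut.
Context (al : R) (Hal : 0 < al) (Hirr : irrational al) (T : fn -> fn) (HT : isometric_aut al T).

Lemma T_A F : Aalpha al F -> Aalpha al (T F).
Proof. apply HT. Qed.
Lemma T_surj G : Aalpha al G -> exists F, Aalpha al F /\ T F = G.
Proof.
  intros HG. destruct (proj1 (proj2 (proj2 HT)) G HG) as [F [HF E]]. exists F; split; auto.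
  extensionality s. extensionality t. apply E.
Qed.
Lemma T_plus F G : Aalpha al F -> Aalpha al G -> T (fun s t => Cplus (F s t) (G s t)) = (fun s t => Cplus (T F s t) (T G s t)).
Proof. intros HF HG. extensionality s. extensionality t. apply (proj1 (proj2 (proj2 (proj2 HT))) F G HF HG). Qed.
Lemma T_scal c F : Aalpha al F -> T (fun s t => Cmult c (F s t)) = (fun s t => Cmult c (T F s t)).
Proof. intros HF. extensionality s. extensionality t. apply (proj1 (proj2 (proj2 (proj2 (proj2 HT)))) c F HF). Qed.
Lemma T_mult F G : Aalpha al F -> Aalpha al G -> T (fun s t => Cmult (F s t) (G s t)) = (fun s t => Cmult (T F s t) (T G s t)).
Proof. intros HF HG. extensionality s. extensionality t. apply (proj1 (proj2 (proj2 (proj2 (proj2 (proj2 HT))))) F G HF HG). Qed.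
Lemma T_iso F r : Aalpha al F -> (bounded_by F r <-> bounded_by (T F) r).
Proof. intros HF. apply (proj2 (proj2 (proj2 (proj2 (proj2 (proj2 HT))))) F HF). Qed.

(** Linearity reduces this to the isometry for the difference. It lets T pass to uniform limits of
    polynomials. *)
Lemma T_near F G r : Aalpha al F -> Aalpha al G -> near F G r -> near (T F) (T G) r.
Proof.
  intros HF HG HN.
  set (D := fun s t => Cplus (F s t) (Cmult (RtoC (-1)) (G s t))).
  assert (HD : Aalpha al D) by (apply Aalpha_plus; auto; apply Aalpha_scal; auto).
  assert (ED : T D = fun s t => Cplus (T F s t) (Cmult (RtoC (-1)) (T G s t))).
  { unfold D. rewrite (T_plus F (fun s t => Cmult (RtoC (-1)) (G s t))), T_scal; auto. apply Aalpha_scal; auto. }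
  assert (BD : bounded_by D r).
  { intros s t. specialize (HN s t).
    replace (D s t) with (Cminus (F s t) (G s t)); [exact HN|]. unfold D. apply C_eq; simpl; ring. }
  apply (T_iso D r HD) in BD. rewrite ED in BD. intros s t. specialize (BD s t). cbv beta in BD.
  replace (Cminus (T F s t) (T G s t)) with (Cplus (T F s t) (Cmult (RtoC (-1)) (T G s t))); [exact BD|].
  apply C_eq; simpl; ring.
Qed.

Lemma T_chi_unimodular m s t : 0 <= weight al m -> Cmod (T (chi m) s t) = 1.
Proof.
  intros Hm. pose proof (chi_Aalpha al m Hm) as Ac. set (u := T (chi m)).
  assert (Au : Aalpha al u) by (apply T_A; auto).
  assert (ub : forall s t, Cmod (u s t) <= 1).
  { apply (T_iso (chi m) 1 Ac). intros s' t'. right. apply Cmod_chi. }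
  destruct (Rle_lt_or_eq_dec _ _ (ub s t)) as [L|E]; auto. exfalso.
  set (v := Cmod (u s t)) in *. assert (Hv : 0 <= v) by apply Cmod_ge_0.
  destruct (korovkin_bound u (Aalpha_contC _ _ Au) (Aalpha_periodic _ _ Au) ((1 - v) / 4)) as [Q [HQ KB]]; [lra|].
  (* At trigonometric distance at most eta from (s, t), |u| is at most v + (1 - v)/4 + (1 - v)/4 =
     (1 + v)/2; beyond eta the peak is at most 1 - eta / 8. The larger of the two bounds is r <
     1. *)
  set (eta := (1 - v) / (4 * (Q + 1))).
  assert (Heta : 0 < eta) by (apply Rdiv_lt_0_compat; lra).
  assert (HQe : Q * eta <= (1 - v) / 4).
  { apply Rle_trans with ((Q + 1) * eta); [nra|]. unfold eta. right; field; lra. }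
  set (r := Rmax ((1 + v) / 2) (1 - eta / 8)).
  assert (Hr : r < 1) by (apply Rmax_lub_lt; lra).
  set (f := peak s t). assert (Af : Aalpha al f) by (apply Aalpha_peak; auto).
  assert (UF : forall a b, Cmod (Cmult (u a b) (f a b)) <= r).
  { intros a b. rewrite Cmod_mult.
    pose proof (peak_bound s t a b) as PB. fold f in PB.
    pose proof (one_minus_cos_ge_0 (s - a)). pose proof (one_minus_cos_ge_0 (t - b)).
    pose proof (Cmod_ge_0 (u a b)). pose proof (Cmod_ge_0 (f a b)). pose proof (ub a b).
    set (d := (1 - cos (s - a)) + (1 - cos (t - b))) in *.
    destruct (Rle_lt_dec d eta) as [D|D].
    - apply Rle_trans with ((1 + v) / 2); [|apply Rmax_l].
      specialize (KB s t a b). fold d in KB.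
      pose proof (Cmod_triangle (Cminus (u a b) (u s t)) (u s t)) as TR.
      replace (Cplus (Cminus (u a b) (u s t)) (u s t)) with (u a b) in TR by aring. fold v in TR.
      assert (Q * d <= Q * eta) by (apply Rmult_le_compat_l; auto).
      assert (Cmod (u a b) <= (1 + v) / 2) by lra.
      assert (Cmod (f a b) <= 1) by (unfold d in *; lra). nra.
    - apply Rle_trans with (1 - eta / 8); [|apply Rmax_r]. nra. }
  (* Since |chi_m| = 1, the bound r on chi_m g is a bound on g, hence by isometry on T g = f, which
     takes the value 1. *)
  destruct (T_surj f Af) as [g [Ag Eg]].
  assert (B1 : bounded_by (fun s t => Cmult (chi m s t) (g s t)) r).
  { apply T_iso; [apply Aalpha_mult; auto|]. rewrite (T_mult (chi m) g Ac Ag), Eg. exact UF. }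
  assert (B2 : bounded_by g r).
  { intros a b. specialize (B1 a b). change (Cmod (Cmult (chi m a b) (g a b)) <= r) in B1.
    rewrite Cmod_mult, Cmod_chi, Rmult_1_l in B1. exact B1. }
  apply (T_iso g r Ag) in B2. rewrite Eg in B2. specialize (B2 s t).
  change (Cmod (f s t) <= r) in B2. unfold f in B2. rewrite peak_1, Cmod_1 in B2. lra.
Qed.

Lemma T_chi_add m n : 0 <= weight al m -> 0 <= weight al n -> forall s t,
  T (chi (freq_add m n)) s t = Cmult (T (chi m) s t) (T (chi n) s t).
Proof.
  intros Hm Hn s t.
  replace (chi (freq_add m n)) with (fun s t => Cmult (chi m s t) (chi n s t)).
  - rewrite (T_mult (chi m) (chi n)) by (apply chi_Aalpha; auto). reflexivity.
  - extensionality a. extensionality b. symmetry. apply chi_add.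
Qed.

Lemma T_teval p s t : analytic al p -> T (teval p) s t = peval (fun m => T (chi m) s t) p.
Proof.
  intros Hp. induction Hp as [|e p He Hp IH].
  - replace (teval nil) with (fun s t : R => Cmult (RtoC 0) (chi (0, 0)%Z s t)).
    + rewrite T_scal by (apply chi_Aalpha; unfold weight; simpl; lra). simpl. aring.
    + extensionality a. extensionality b. unfold teval; simpl. aring.
  - change (teval (e :: p)) with (fun s t => Cplus (Cmult (fst e) (chi (snd e) s t)) (teval p s t)).
    rewrite (T_plus (fun s t => Cmult (fst e) (chi (snd e) s t)) (teval p)).
    + rewrite T_scal by (apply chi_Aalpha; auto). rewrite IH. reflexivity.
    + apply Aalpha_scal, chi_Aalpha; auto.
    + apply teval_Aalpha; auto.
Qed.

Section Lifted.
Context (H1 H2 : R -> R -> R) (CH1 : contR H1) (CH2 : contR H2).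
Context (E1 : forall s t, T (chi (1, 0)%Z) s t = expi (H1 s t)) (E2 : forall s t, T (chi (0, 1)%Z) s t = expi (H2 s t)).

Lemma T_chi_nat (i j : nat) s t : T (chi (Z.of_nat i, Z.of_nat j)) s t = chi (Z.of_nat i, Z.of_nat j) (H1 s t) (H2 s t).
Proof.
  assert (C10 : chi (1, 0)%Z (H1 s t) (H2 s t) = expi (H1 s t)) by (unfold chi; simpl; f_equal; ring).
  assert (C01 : chi (0, 1)%Z (H1 s t) (H2 s t) = expi (H2 s t)) by (unfold chi; simpl; f_equal; ring).
  induction i as [|i IHi].
  - induction j as [|j IHj].
    + rewrite (unimodular_family_0 al (fun m => T (chi m))); [symmetry; apply chi_0 | intros; apply T_chi_unimodular; auto | apply T_chi_add].
    + replace (Z.of_nat 0, Z.of_nat (S j)) with (freq_add (0, 1)%Z (Z.of_nat 0, Z.of_nat j)).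
      * rewrite T_chi_add, chi_add, IHj, E2, C01; auto; [rewrite weight_01; lra | apply weight_nat; auto].
      * unfold freq_add; cbn [fst snd]. f_equal; lia.
  - replace (Z.of_nat (S i), Z.of_nat j) with (freq_add (1, 0)%Z (Z.of_nat i, Z.of_nat j)).
    + rewrite T_chi_add, chi_add, IHi, E1, C10; auto; [rewrite weight_10; lra | apply weight_nat; auto].
    + unfold freq_add; cbn [fst snd]. f_equal; lia.
Qed.

(** Multiplication by the member of index (|a|, |b|) moves (a, b) into the quadrant covered by
    [T_chi_nat]; the extra factor is unimodular and cancels. *)
Lemma T_chi m s t : 0 <= weight al m -> T (chi m) s t = chi m (H1 s t) (H2 s t).
Proof.
  intros Hm. destruct m as [a b].
  set (n := Z.to_nat (Z.abs a)). set (n' := Z.to_nat (Z.abs b)).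
  assert (E : Cmult (T (chi (a, b)) s t) (T (chi (Z.of_nat n, Z.of_nat n')) s t) =
    Cmult (chi (a, b) (H1 s t) (H2 s t)) (T (chi (Z.of_nat n, Z.of_nat n')) s t)).
  { rewrite <- T_chi_add by (auto; apply weight_nat; auto).
    rewrite (T_chi_nat n n'), <- chi_add.
    replace (freq_add (a, b) (Z.of_nat n, Z.of_nat n')) with (Z.of_nat (Z.to_nat (a + Z.of_nat n)), Z.of_nat (Z.to_nat (b + Z.of_nat n'))).
    - apply T_chi_nat.
    - unfold freq_add; cbn [fst snd]. rewrite !Z2Nat.id by lia. reflexivity. }
  assert (NZ : T (chi (Z.of_nat n, Z.of_nat n')) s t <> RtoC 0).
  { intros Z0. pose proof (T_chi_unimodular (Z.of_nat n, Z.of_nat n') s t (weight_nat al Hal n n')) as Q.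
    rewrite Z0, Cmod_0 in Q. lra. }
  apply (f_equal (fun z => Cmult z (Cinv (T (chi (Z.of_nat n, Z.of_nat n')) s t)))) in E.
  rewrite <- !Cmult_assoc, !Cinv_r, !Cmult_1_r in E by auto. exact E.
Qed.

Lemma T_eval F s t : Aalpha al F -> T F s t = F (H1 s t) (H2 s t).
Proof.
  intros HF. apply C_eq_of_small. intros e He.
  destruct (Aalpha_approx al F HF (e / 2)) as [p [Hp HN]]; [lra|].
  pose proof (T_near F (teval p) (e / 2) HF (teval_Aalpha al p Hp) HN s t) as N1.
  rewrite T_teval in N1 by auto.
  rewrite (peval_ext _ (fun m => chi m (H1 s t) (H2 s t))) in N1.
  - specialize (HN (H1 s t) (H2 s t)). unfold teval in HN.
    replace (Cminus (T F s t) (F (H1 s t) (H2 s t))) with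
      (Cminus (Cminus (T F s t) (peval (fun m => chi m (H1 s t) (H2 s t)) p)) (Cminus (F (H1 s t) (H2 s t)) (peval (fun m => chi m (H1 s t) (H2 s t)) p))) by aring.
    eapply Rle_trans; [apply Cmod_triangle|]. rewrite Cmod_opp. lra.
  - intros f Hf. apply T_chi. unfold analytic in Hp. rewrite List.Forall_forall in Hp. apply Hp; auto.
Qed.

Lemma lift_diff_flow s t x : H2 (s + x) (t + al * x) - al * H1 (s + x) (t + al * x) = H2 s t - al * H1 s t.
Proof.
  apply (flow_phase al Hal (fun m => T (chi m))); auto.
  - intros m Hm. apply T_A, chi_Aalpha; auto.
  - intros; apply T_chi_unimodular; auto.
  - apply T_chi_add.
Qed.

Context (a b c d : Z) (h1 h2 : R -> R -> R) (Ch1 : contR h1) (Ch2 : contR h2) (Ph1 : periodicR h1) (Ph2 : periodicR h2).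
Context (D1 : forall s t, H1 s t = IZR a * s + IZR b * t + h1 s t) (D2 : forall s t, H2 s t = IZR c * s + IZR d * t + h2 s t).

Let k (s t : R) : R := h2 s t - al * h1 s t.
Let lam : R := IZR a + al * IZR b.

Lemma contR_k : contR k.
Proof. apply contR_minus; auto. apply contR_mult; auto. apply contR_const. Qed.

Lemma periodic_k : periodicR k.
Proof. intros s t. unfold k. destruct (Ph1 s t) as [-> ->]. destruct (Ph2 s t) as [-> ->]. auto. Qed.

(** Along the flow the linear part of H2 - al H1 changes at rate q. The whole is constant there and
    its periodic part k is bounded, so q = 0. *)
Lemma eigen : IZR c + al * IZR d = al * lam.
Proof.
  set (q := IZR c + al * IZR d - al * lam). enough (q = 0) by (unfold q in *; lra).
  destruct (osc_bound (Rfun k) (contC_Rfun k contR_k) (periodic_Rfun k periodic_k)) as [B [HB BB]].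
  destruct (Req_dec q 0) as [E|E]; auto. exfalso.
  (* Over this displacement k would have to change by B + 1, more than its oscillation. *)
  set (x := (B + 1) / q).
  pose proof (lift_diff_flow 0 0 x) as KF. rewrite !D1, !D2 in KF.
  assert (KE : k (0 + x) (0 + al * x) - k 0 0 = - (q * x)) by (unfold k, q, lam; lra).
  specialize (BB 0 0 (0 + x) (0 + al * x)). unfold Rfun in BB.
  rewrite <- RtoC_minus, Cmod_R, KE in BB.
  replace (q * x) with (B + 1) in BB by (unfold x; field; auto).
  rewrite Rabs_Ropp, Rabs_pos_eq in BB by lra. lra.
Qed.

(** Once the linear part cancels along the flow, k itself is invariant, and by irrationality an
    invariant continuous periodic function is constant. *)
Lemma k_const s t : k s t = k 0 0.
Proof.
  apply (flow_invariant_const al k Hirr contR_k periodic_k).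
  intros s' t' x. pose proof (lift_diff_flow s' t' x) as KF. rewrite !D1, !D2 in KF. pose proof eigen as EG.
  unfold k, lam in *.
  assert (EX : (IZR c + al * IZR d) * x = al * (IZR a + al * IZR b) * x) by (rewrite EG; ring). lra.
Qed.

Lemma h1_const s t : h1 s t = h1 0 0.
Proof.
  apply (linearise al lam h1 Hirr Ch1 Ph1).
  intros eps He. destruct (small_weight al eps Hirr He) as [[p q] Hm].
  exists (weight al (p, q)). split; auto. set (sg := weight al (p, q)) in *.
  intros tau Ht.
  (* The row vector (p, q) A. By the eigenvector relation its weight is lam times that of (p, q). *)
  set (M := ((p * a + q * c)%Z, (p * b + q * d)%Z)).
  assert (WM : weight al M = lam * sg).
  { unfold M, weight, sg, lam; simpl. unfold weight; simpl. rewrite !plus_IZR, !mult_IZR. pose proof eigen as EG. unfold lam in EG.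
    replace (IZR p * IZR a + IZR q * IZR c + al * (IZR p * IZR b + IZR q * IZR d)) with
      (IZR p * (IZR a + al * IZR b) + IZR q * (IZR c + al * IZR d)) by ring. rewrite EG. ring. }
  (* Substituting h2 = al h1 + k turns p h1 + q h2 into sg h1 + q k, so a single function remains in
     the exponent. *)
  assert (EU : forall s t, T (chi (p, q)) s t = Cmult (expi (IZR q * k 0 0)) (Cmult (chi M s t) (expi (sg * h1 s t)))).
  { intros s' t'. rewrite T_chi by (fold sg; lra). unfold chi. rewrite <- !expi_add. f_equal.
    rewrite D1, D2. unfold M, sg, weight; simpl. rewrite !plus_IZR, !mult_IZR.
    pose proof (k_const s' t') as KC. unfold k in KC at 1.
    assert (EH : h2 s' t' = al * h1 s' t' + k 0 0) by lra. rewrite EH. ring. }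
  assert (CE : contC (fun s t => expi (sg * h1 s t))).
  { apply contC_expi. apply contR_mult; auto. apply contR_const. }
  assert (Z0 : coef (T (chi (p, q))) (freq_add tau M) = RtoC 0).
  { apply (Aalpha_coef al); [apply T_A, chi_Aalpha; fold sg; lra|]. rewrite weight_add, WM. exact Ht. }
  rewrite (coef_ext _ _ _ EU), coef_scal in Z0 by (apply contC_mult; [apply contC_chi | auto]).
  rewrite (coef_mul_chi (fun s t => expi (sg * h1 s t))) in Z0.
  replace (freq_add (freq_add tau M) (freq_opp M)) with tau in Z0.
  2: { destruct tau. unfold freq_add, freq_opp, M; cbn [fst snd]. f_equal; lia. }
  apply (f_equal (Cmult (expi (- (IZR q * k 0 0))))) in Z0.
  rewrite Cmult_assoc, <- expi_add, Rplus_opp_l, expi_0, Cmult_1_l, Cmult_0_r in Z0. exact Z0.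
Qed.

Let A : mat := Mat a b c d.

Lemma T_affine F s t : Aalpha al F ->
  T F s t = F (IZR a * s + IZR b * t + h1 0 0) (IZR c * s + IZR d * t + h2 0 0).
Proof.
  intros HF. rewrite T_eval, D1, D2, h1_const by auto. do 2 f_equal.
  pose proof (k_const s t) as KC. unfold k in KC. rewrite h1_const in KC. lra.
Qed.

(** T carries polynomials to polynomials with frequencies in the row lattice of A. If m were
    outside, an approximation of chi_m within 1/4 by such an image would have coefficient 0 at m,
    although the coefficients may differ by at most 1/2 and that of chi_m is 1. *)
Lemma winding_surj m : 0 <= weight al m -> exists p q : Z, (p * a + q * c = fst m)%Z /\ (p * b + q * d = snd m)%Z.
Proof.
  intros Hm. destruct (T_surj (chi m) (chi_Aalpha al m Hm)) as [F [HF EF]].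
  destruct (Aalpha_approx al F HF (1 / 4)) as [p [Hp HN]]; [lra|].
  pose proof (T_near F (teval p) (1 / 4) HF (teval_Aalpha al p Hp) HN) as N1. rewrite EF in N1.
  assert (AT : Aalpha al (T (teval p))) by (apply T_A, teval_Aalpha; auto).
  assert (CB : Cmod (Cminus (coef (chi m) m) (coef (T (teval p)) m)) <= 2 * (1 / 4)).
  { rewrite <- coef_minus by (apply contC_chi || (eapply Aalpha_contC; eauto)).
    apply coef_bound; [apply contC_minus; [apply contC_chi | eapply Aalpha_contC; eauto] | exact N1]. }
  rewrite coef_chi in CB. destruct (freq_dec m m) as [_|X]; [|congruence].
  apply NNPP. intros HNE.
  set (img := fun n : Z * Z => ((fst n * a + snd n * c)%Z, (fst n * b + snd n * d)%Z)).
  set (p' := map (fun e => (Cmult (fst e) (expi (IZR (fst (snd e)) * h1 0 0 + IZR (snd (snd e)) * h2 0 0)), img (snd e))) p).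
  assert (ET : forall s t, T (teval p) s t = teval p' s t).
  { intros s t. rewrite T_affine by (apply teval_Aalpha; auto). unfold p', teval. clear.
    induction p as [|e p IH]; simpl; [reflexivity|]. rewrite IH.
    assert (E : chi (snd e) (IZR a * s + IZR b * t + h1 0 0) (IZR c * s + IZR d * t + h2 0 0) =
      Cmult (expi (IZR (fst (snd e)) * h1 0 0 + IZR (snd (snd e)) * h2 0 0)) (chi (img (snd e)) s t)).
    { unfold chi, img; simpl. rewrite <- expi_add, !plus_IZR, !mult_IZR. f_equal. ring. }
    rewrite E. aring. }
  assert (Z0 : coef (T (teval p)) m = RtoC 0).
  { rewrite (coef_ext _ _ _ ET), coef_teval. unfold p'. clear - HNE. induction p as [|e p IH]; cbn [map fold_right fst snd]; auto.
    rewrite IH. destruct (freq_dec (img (snd e)) m) as [E|_]; [|apply Cplus_0_l].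
    exfalso. apply HNE. exists (fst (snd e)), (snd (snd e)). rewrite <- E. split; reflexivity. }
  rewrite Z0 in CB. replace (Cminus (RtoC 1) (RtoC 0)) with (RtoC 1) in CB by ring. rewrite Cmod_1 in CB. lra.
Qed.

(** Both unit vectors lie in the row lattice, so A has an integral left inverse and its determinant
    is a unit. *)
Lemma winding_GL : inGL2Z A.
Proof.
  destruct (winding_surj (1, 0)%Z) as [p [q [X1 X2]]]; [rewrite weight_10; lra|].
  destruct (winding_surj (0, 1)%Z) as [p' [q' [Y1 Y2]]]; [rewrite weight_01; lra|].
  simpl in *. unfold inGL2Z, mdet, A; simpl.
  assert (E : ((p * q' - q * p') * (a * d - b * c) = 1)%Z).
  { replace ((p * q' - q * p') * (a * d - b * c))%Z with
      ((p * a + q * c) * (p' * b + q' * d) - (p * b + q * d) * (p' * a + q' * c))%Z by ring.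
    rewrite X1, X2, Y1, Y2. reflexivity. }
  destruct (Z.mul_eq_1 _ _ E) as [E3|E3]; rewrite E3 in E; lia.
Qed.

(** lam is the weight of the frequency (a, b) of T chi_(1,0), so membership in the algebra excludes
    lam < 0. If lam were 0, irrationality would make the first row of A vanish. *)
Lemma lam_pos : 0 < lam.
Proof.
  assert (AT : Aalpha al (T (chi (1, 0)%Z))) by (apply T_A, chi_Aalpha; rewrite weight_10; lra).
  assert (EU : forall s t, T (chi (1, 0)%Z) s t = Cmult (expi (h1 0 0)) (chi (a, b) s t)).
  { intros s t. rewrite T_affine by (apply chi_Aalpha; rewrite weight_10; lra).
    unfold chi; simpl. rewrite <- expi_add. f_equal. ring. }
  destruct (Rtotal_order lam 0) as [L|[E|L]]; auto; exfalso.
  - assert (Z0 : coef (T (chi (1, 0)%Z)) (a, b) = RtoC 0) by (apply (Aalpha_coef al); auto).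
    rewrite (coef_ext _ _ _ EU), coef_scal, coef_chi in Z0 by apply contC_chi.
    destruct (freq_dec (a, b) (a, b)) as [_|X]; [|congruence].
    apply (f_equal Cmod) in Z0. rewrite Cmod_mult, Cmod_expi, Cmod_1, Cmod_0 in Z0. lra.
  - apply (irrational_weight_0 al (a, b)) in E; auto. injection E as Ea Eb.
    pose proof winding_GL as [G|G]; unfold mdet, A in G; simpl in G; rewrite Ea, Eb in G; lia.
Qed.

End Lifted.

Theorem aut_affine : exists (A : mat) (d1 d2 : R), inGL2Z A /\ 0 < IZR (ma A) + al * IZR (mb A) /\
  IZR (mc A) + al * IZR (md A) = al * (IZR (ma A) + al * IZR (mb A)) /\
  forall F s t, Aalpha al F -> T F s t = F (IZR (ma A) * s + IZR (mb A) * t + d1) (IZR (mc A) * s + IZR (md A) * t + d2).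
Proof.
  assert (P10 : 0 <= weight al (1, 0)%Z) by (rewrite weight_10; lra).
  assert (P01 : 0 <= weight al (0, 1)%Z) by (rewrite weight_01; lra).
  pose proof (T_A _ (chi_Aalpha al _ P10)) as A1. pose proof (T_A _ (chi_Aalpha al _ P01)) as A2.
  destruct (lift_exists _ (Aalpha_contC _ _ A1) (Aalpha_periodic _ _ A1) (fun s t => T_chi_unimodular _ s t P10)) as [H1 [CH1 E1]].
  destruct (lift_exists _ (Aalpha_contC _ _ A2) (Aalpha_periodic _ _ A2) (fun s t => T_chi_unimodular _ s t P01)) as [H2 [CH2 E2]].
  destruct (lift_winding _ H1 (Aalpha_periodic _ _ A1) CH1 E1) as [a [b [h1 [Ch1 [Ph1 D1]]]]].
  destruct (lift_winding _ H2 (Aalpha_periodic _ _ A2) CH2 E2) as [c [d [h2 [Ch2 [Ph2 D2]]]]].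
  exists (Mat a b c d), (h1 0 0), (h2 0 0). cbn [ma mb mc md]. split; [|split; [|split]].
  - apply (winding_GL H1 H2 CH1 CH2 E1 E2 a b c d h1 h2); auto.
  - apply (lam_pos H1 H2 CH1 CH2 E1 E2 a b c d h1 h2); auto.
  - apply (eigen H1 H2 CH1 CH2 E1 E2 a b c d h1 h2); auto.
  - intros F s t HF. apply (T_affine H1 H2 CH1 CH2 E1 E2 a b c d h1 h2); auto.
Qed.

End Aut.

(** * The stabiliser of the flow direction *)

Definition mone : mat := Mat 1 0 0 1.
Definition mmul (A B : mat) : mat :=
  Mat (ma A * ma B + mb A * mc B) (ma A * mb B + mb A * md B)
      (mc A * ma B + md A * mc B) (mc A * mb B + md A * md B).
Definition lam (al : R) (A : mat) : R := IZR (ma A) + al * IZR (mb A).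

(* [A] in GL(2,Z) having the vector (1, al) as an eigenvector with positive eigenvalue [lam al A]. *)
Definition stab (al : R) (A : mat) : Prop :=
  inGL2Z A /\ 0 < lam al A /\ IZR (mc A) + al * IZR (md A) = al * lam al A.

Lemma mat_eq A B : ma A = ma B -> mb A = mb B -> mc A = mc B -> md A = md B -> A = B.
Proof. destruct A, B; simpl; intros; subst; auto. Qed.

Lemma mmul_assoc A B C : mmul A (mmul B C) = mmul (mmul A B) C.
Proof. apply mat_eq; simpl; ring. Qed.
Lemma mmul_1_l A : mmul mone A = A.
Proof. apply mat_eq; destruct A as [a b c d]; unfold mmul, mone; cbn [ma mb mc md]; ring. Qed.
Lemma mmul_1_r A : mmul A mone = A.
Proof. apply mat_eq; destruct A as [a b c d]; unfold mmul, mone; cbn [ma mb mc md]; ring. Qed.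

Lemma mdet_mmul A B : mdet (mmul A B) = (mdet A * mdet B)%Z.
Proof. unfold mdet; simpl; ring. Qed.

Lemma inGL2Z_sqr A : inGL2Z A -> (mdet A * mdet A = 1)%Z.
Proof. intros [-> | ->]; reflexivity. Qed.

Lemma mmul_inv_l A : inGL2Z A -> mmul (mat_inv A) A = mone.
Proof.
  intros H. apply inGL2Z_sqr in H. unfold mdet in H.
  apply mat_eq; unfold mat_inv, mdet, mmul, mone; cbn [ma mb mc md]; rewrite <- ?H; ring.
Qed.

Lemma mmul_inv_r A : inGL2Z A -> mmul A (mat_inv A) = mone.
Proof.
  intros H. apply inGL2Z_sqr in H. unfold mdet in H.
  apply mat_eq; unfold mat_inv, mdet, mmul, mone; cbn [ma mb mc md]; rewrite <- ?H; ring.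
Qed.

Lemma inGL2Z_mmul A B : inGL2Z A -> inGL2Z B -> inGL2Z (mmul A B).
Proof. unfold inGL2Z. rewrite mdet_mmul. intros [-> | ->] [-> | ->]; auto. Qed.

Lemma inGL2Z_inv A : inGL2Z A -> inGL2Z (mat_inv A).
Proof.
  intros H. pose proof (mdet_mmul (mat_inv A) A) as E. rewrite mmul_inv_l in E by auto.
  change (mdet mone) with 1%Z in E. unfold inGL2Z in *. destruct H as [H|H]; rewrite H in E; lia.
Qed.

Lemma lam_mmul al A B : stab al B -> lam al (mmul A B) = lam al A * lam al B.
Proof.
  intros [_ [_ E]]. unfold lam at 1, mmul; cbn [ma mb]. rewrite !plus_IZR, !mult_IZR.
  replace (IZR (ma A) * IZR (ma B) + IZR (mb A) * IZR (mc B) + al * (IZR (ma A) * IZR (mb B) + IZR (mb A) * IZR (md B)))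
    with (IZR (ma A) * lam al B + IZR (mb A) * (IZR (mc B) + al * IZR (md B))) by (unfold lam; ring).
  rewrite E. unfold lam. ring.
Qed.

Lemma lam_one al : lam al mone = 1.
Proof. unfold lam; simpl; ring. Qed.

Lemma stab_one al : stab al mone.
Proof. split; [left; reflexivity|]. rewrite lam_one. simpl. split; lra. Qed.

Lemma stab_mmul al A B : stab al A -> stab al B -> stab al (mmul A B).
Proof.
  intros HA HB. pose proof (lam_mmul al A B HB) as E. destruct HA as [A1 [A2 A3]]. destruct HB as [B1 [B2 B3]].
  split; [apply inGL2Z_mmul; auto|]. rewrite E. split; [apply Rmult_lt_0_compat; auto|].
  unfold mmul; cbn [mc md]. rewrite !plus_IZR, !mult_IZR.
  replace (IZR (mc A) * IZR (ma B) + IZR (md A) * IZR (mc B) + al * (IZR (mc A) * IZR (mb B) + IZR (md A) * IZR (md B)))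
    with (IZR (mc A) * lam al B + IZR (md A) * (IZR (mc B) + al * IZR (md B))) by (unfold lam; ring).
  rewrite B3. replace (IZR (mc A) * lam al B + IZR (md A) * (al * lam al B)) with ((IZR (mc A) + al * IZR (md A)) * lam al B) by ring.
  rewrite A3. ring.
Qed.

(** The second factor is the other eigenvalue of A, namely the trace minus [lam al A]. *)
Lemma lam_conj al A : stab al A -> lam al A * (IZR (md A) - al * IZR (mb A)) = IZR (mdet A).
Proof.
  intros [_ [_ E]]. unfold mdet. rewrite minus_IZR, !mult_IZR.
  replace (lam al A * (IZR (md A) - al * IZR (mb A))) with
    (IZR (ma A) * IZR (md A) + IZR (mb A) * (al * IZR (md A) - al * lam al A)) by (unfold lam; ring).
  rewrite <- E. ring.
Qed.

Lemma stab_inv al A : stab al A -> stab al (mat_inv A) /\ lam al (mat_inv A) = / lam al A.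
Proof.
  intros HA. pose proof (lam_conj al A HA) as LC. pose proof HA as [A1 [A2 A3]].
  assert (E : lam al (mat_inv A) = / lam al A).
  { apply Rmult_eq_reg_l with (lam al A); [|lra]. rewrite Rinv_r by lra.
    unfold lam at 2. unfold mat_inv; cbn [ma mb]. rewrite opp_IZR, !mult_IZR.
    replace (lam al A * (IZR (mdet A) * IZR (md A) + al * - (IZR (mdet A) * IZR (mb A)))) with
      (IZR (mdet A) * (lam al A * (IZR (md A) - al * IZR (mb A)))) by ring.
    rewrite LC, <- mult_IZR, inGL2Z_sqr; auto. }
  split; auto. split; [apply inGL2Z_inv; auto|]. rewrite E. split; [apply Rinv_0_lt_compat; auto|].
  rewrite <- E. unfold lam, mat_inv; cbn [ma mb mc md]. rewrite !opp_IZR, !mult_IZR.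
  unfold lam in A3. 
  replace (- (IZR (mdet A) * IZR (mc A)) + al * (IZR (mdet A) * IZR (ma A))) with
    (IZR (mdet A) * (al * IZR (ma A) - IZR (mc A))) by ring.
  replace (IZR (mc A)) with (al * (IZR (ma A) + al * IZR (mb A)) - al * IZR (md A)) by lra. ring.
Qed.

(** By irrationality the eigenvalue a + al b determines the first row, and al times it determines
    the second. *)
Lemma stab_lam_inj al A B : irrational al -> stab al A -> stab al B -> lam al A = lam al B -> A = B.
Proof.
  intros Hi [_ [_ A3]] [_ [_ B3]] E.
  assert (E1 : ((ma A - ma B)%Z, (mb A - mb B)%Z) = (0, 0)%Z).
  { apply (irrational_weight_0 al); auto. unfold weight; cbn [fst snd]. rewrite !minus_IZR. unfold lam in E. lra. }
  assert (E2 : ((mc A - mc B)%Z, (md A - md B)%Z) = (0, 0)%Z).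
  { apply (irrational_weight_0 al); auto. unfold weight; cbn [fst snd]. rewrite !minus_IZR. rewrite E in A3. lra. }
  injection E1 as X1 X2. injection E2 as X3 X4. apply mat_eq; lia.
Qed.

Fixpoint npow (A : mat) (n : nat) : mat := match n with O => mone | S k => mmul (npow A k) A end.
Definition mpow (A : mat) (k : Z) : mat :=
  match k with
  | Z0 => mone
  | Zpos p => npow A (Pos.to_nat p)
  | Zneg p => npow (mat_inv A) (Pos.to_nat p)
  end.

Lemma npow_comm A n : mmul (npow A n) A = mmul A (npow A n).
Proof.
  induction n as [|n IH]; simpl; [rewrite mmul_1_l, mmul_1_r; auto|].
  rewrite (mmul_assoc A (npow A n) A), <- IH. reflexivity.
Qed.

Lemma stab_npow al A n : stab al A -> stab al (npow A n) /\ lam al (npow A n) = lam al A ^ n.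
Proof.
  intros HA. induction n as [|n [IH1 IH2]]; simpl.
  - split; [apply stab_one | apply lam_one].
  - split; [apply stab_mmul; auto|]. rewrite lam_mmul, IH2 by auto. ring.
Qed.

Lemma stab_mpow al A k : stab al A -> stab al (mpow A k) /\ lam al (mpow A k) = powerRZ (lam al A) k.
Proof.
  intros HA. destruct k as [|p|p]; simpl.
  - split; [apply stab_one | apply lam_one].
  - apply stab_npow; auto.
  - destruct (stab_inv al A HA) as [H1 H2]. destruct (stab_npow al (mat_inv A) (Pos.to_nat p) H1) as [H3 H4].
    split; auto. rewrite H4, H2, pow_inv. reflexivity.
Qed.

(** Eigenvalues determine elements of the stabiliser, so the exponent law for real powers replaces
    an induction on signs. *)
Lemma mpow_add al A j k : irrational al -> stab al A -> mmul (mpow A j) (mpow A k) = mpow A (j + k).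
Proof.
  intros Hi HA. destruct (stab_mpow al A j HA) as [J1 J2]. destruct (stab_mpow al A k HA) as [K1 K2].
  destruct (stab_mpow al A (j + k) HA) as [S1 S2].
  apply (stab_lam_inj al); auto; [apply stab_mmul; auto|].
  rewrite lam_mmul, J2, K2, S2 by auto. symmetry. apply powerRZ_add.
  destruct HA as [_ [H _]]. lra.
Qed.

Lemma psi_mmul A B c : psi (mmul A B) c = psi A (psi B c).
Proof. unfold psi, mmul; cbn [ma mb mc md fst snd]. rewrite !plus_IZR, !mult_IZR. f_equal; ring. Qed.
Lemma psi_one c : psi mone c = c.
Proof. destruct c. unfold psi; simpl. f_equal; ring. Qed.

Lemma pi_mat_psi A F s t : pi_mat A F s t = F (fst (psi A (s, t))) (snd (psi A (s, t))).
Proof. reflexivity. Qed.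

(** Composition makes [pi_mat] reverse products, so a new factor belongs on the right, as in [npow].
    For [psi] the order is the opposite one, and [iter_psi] uses [npow_comm]. *)
Lemma iter_pi_mat A n F : Nat.iter n (pi_mat A) F = pi_mat (npow A n) F.
Proof.
  induction n as [|n IH]; simpl; extensionality s; extensionality t.
  - unfold pi_mat; simpl. f_equal; ring.
  - rewrite IH, !pi_mat_psi, psi_mmul. destruct (psi A (s, t)) as [x y]. reflexivity.
Qed.

Lemma pi_pow_mpow A k F : pi_pow A k F = pi_mat (mpow A k) F.
Proof.
  destruct k as [|p|p]; unfold pi_pow, zpow, mpow; try apply iter_pi_mat.
  extensionality s; extensionality t. unfold pi_mat; simpl. f_equal; ring.
Qed.

Lemma iter_psi A n c : Nat.iter n (psi A) c = psi (npow A n) c.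
Proof.
  induction n as [|n IH]; simpl; [symmetry; apply psi_one|].
  rewrite IH, <- psi_mmul, npow_comm. reflexivity.
Qed.

Lemma psi_pow_mpow A k c : psi_pow A k c = psi (mpow A k) c.
Proof.
  destruct k as [|p|p]; unfold psi_pow, zpow, mpow; try apply iter_psi. symmetry; apply psi_one.
Qed.

Lemma stab_relation al A : stab al A -> IZR (mb A) * al ^ 2 + IZR (ma A - md A) * al + IZR (- mc A) = 0.
Proof. intros [_ [_ E]]. unfold lam in E. rewrite minus_IZR, opp_IZR. lra. Qed.

(** The eigenvector equation is a quadratic equation for al with coefficients b, a - d and -c. If al
    is not quadratic then b = 0, irrationality gives c = 0 and a = d, and a = 1 is the only positive
    integer whose square is a unit. *)
Lemma stab_not_quadratic al A : irrational al -> ~ quadratic_irrational al -> stab al A -> A = mone.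
Proof.
  intros Hi Hq HA. pose proof (stab_relation al A HA) as E.
  assert (Hb : mb A = 0%Z).
  { destruct (Z.eq_dec (mb A) 0) as [|NE]; auto. exfalso. apply Hq. split; auto. do 3 eexists; eauto. }
  rewrite Hb in E.
  assert (E1 : ((- mc A)%Z, (ma A - md A)%Z) = (0, 0)%Z).
  { apply (irrational_weight_0 al); auto. unfold weight; cbn [fst snd]. lra. }
  injection E1 as X1 X2. destruct HA as [G [L _]]. unfold lam in L. rewrite Hb, Rmult_0_r, Rplus_0_r in L.
  apply lt_IZR in L. unfold inGL2Z, mdet in G. rewrite Hb in G.
  assert (md A = ma A) by lia. rewrite H in G.
  assert (ma A = 1%Z) by nia.
  apply mat_eq; simpl; lia.
Qed.

Lemma list_min {X : Type} (f : X -> R) (P : X -> Prop) (l : list X) : (exists x, In x l /\ P x) ->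
  exists x, In x l /\ P x /\ forall y, In y l -> P y -> f x <= f y.
Proof.
  induction l as [|a l IH]; intros [x [Hx Px]]; [destruct Hx|].
  destruct (classic (exists y, In y l /\ P y)) as [E|E].
  - destruct (IH E) as [m [Hm [Pm Mm]]].
    destruct (classic (P a /\ f a <= f m)) as [[Pa La]|N].
    + exists a. split; [left; auto|split; auto]. intros y [<-|Hy] Py; [lra|]. specialize (Mm y Hy Py). lra.
    + exists m. split; [right; auto|split; auto]. intros y [<-|Hy] Py; auto.
      destruct (Rle_lt_dec (f m) (f a)); auto. exfalso. apply N. split; auto. lra.
  - destruct Hx as [<-|Hx]; [|exfalso; eauto].
    exists a. split; [left; auto|split; auto]. intros y [<-|Hy] Py; [lra|]. exfalso; eauto.
Qed.

(** * Pell's equation and the generator of the stabiliser *)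

Section Quadratic.
Context (al : R) (Hi : irrational al) (p q r : Z) (Hp : p <> 0%Z) (Hq : IZR p * al ^ 2 + IZR q * al + IZR r = 0).

(** The discriminant; [th] is one of its two square roots, of either sign, and inherits the
    irrationality of al. *)
Let D : Z := (q * q - 4 * p * r)%Z.
Let th : R := 2 * IZR p * al + IZR q.

Lemma th_sqr : th * th = IZR D.
Proof.
  unfold th, D. rewrite minus_IZR, !mult_IZR.
  replace ((2 * IZR p * al + IZR q) * (2 * IZR p * al + IZR q)) with
    (4 * IZR p * (IZR p * al ^ 2 + IZR q * al + IZR r) + (IZR q * IZR q - 4 * IZR p * IZR r)) by ring.
  rewrite Hq. ring.
Qed.

Lemma th_irr x y : IZR x + IZR y * th = 0 -> x = 0%Z /\ y = 0%Z.
Proof.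
  intros H. assert (E : ((x + y * q)%Z, (2 * p * y)%Z) = (0, 0)%Z).
  { apply (irrational_weight_0 al); auto. unfold weight; cbn [fst snd]. rewrite plus_IZR, !mult_IZR.
    rewrite <- H. unfold th. ring. }
  pose proof (f_equal fst E) as E1. pose proof (f_equal snd E) as E2. cbn [fst snd] in E1, E2.
  assert (y = 0%Z) by (apply Z.mul_eq_0 in E2; destruct E2; [lia | auto]). subst. split; lia.
Qed.

Lemma th_irr' x y : IZR x - IZR y * th = 0 -> x = 0%Z /\ y = 0%Z.
Proof.
  intros H. destruct (th_irr x (- y)) as [E1 E2]; [rewrite opp_IZR; lra|]. split; lia.
Qed.

Lemma norm_th x y : (IZR x - IZR y * th) * (IZR x + IZR y * th) = IZR (x * x - D * (y * y)).
Proof.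
  rewrite minus_IZR, !mult_IZR.
  replace ((IZR x - IZR y * th) * (IZR x + IZR y * th)) with (IZR x * IZR x - (th * th) * (IZR y * IZR y)) by ring.
  rewrite th_sqr. reflexivity.
Qed.

(** For a Dirichlet pair, |x - y th| < 1/N and |x + y th| <= 1/N + 2 N |th|, so the norm x^2 - D y^2
    is at most 1 + 2 |th| in modulus, independently of N. *)
Let Kb : nat := Z.to_nat (up (1 + 2 * Rabs th)).

Definition small_norm (z : Z * Z) : Prop :=
  (1 <= snd z)%Z /\ (Z.abs (fst z * fst z - D * (snd z * snd z)) <= Z.of_nat Kb)%Z.
Definition err (z : Z * Z) : R := Rabs (IZR (fst z) - IZR (snd z) * th).

Lemma err_pos z : small_norm z -> 0 < err z.
Proof.
  intros [H1 _]. apply Rabs_pos_lt. intros E. apply th_irr' in E. lia.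
Qed.

Lemma small_norm_below (e : R) : 0 < e -> exists z, small_norm z /\ err z < e.
Proof.
  intros He. destruct (archimed_cor1 e He) as [N [HN HN0]].
  destruct (dirichlet th N) as [x [y [Hy Hxy]]]; [lia|].
  exists (x, y). split; [|unfold err; simpl; lra]. split; [simpl; lia|]. cbn [fst snd].
  assert (HN1 : 1 <= INR N) by (change 1 with (INR 1); apply le_INR; lia).
  assert (Hy1 : IZR y <= INR N) by (rewrite INR_IZR_INZ; apply IZR_le; lia).
  assert (Hy0 : 1 <= IZR y) by (apply IZR_le; lia).
  assert (HI : / INR N <= 1) by (rewrite <- Rinv_1; apply Rinv_le_contravar; lra).
  assert (B : Rabs (IZR (x * x - D * (y * y))) <= 1 + 2 * Rabs th).
  { rewrite <- norm_th, Rabs_mult.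
    assert (B2 : Rabs (IZR x + IZR y * th) <= / INR N + 2 * INR N * Rabs th).
    { replace (IZR x + IZR y * th) with ((IZR x - IZR y * th) + 2 * IZR y * th) by ring.
      eapply Rle_trans; [apply Rabs_triang|]. rewrite Rabs_mult, (Rabs_pos_eq (2 * IZR y)) by lra.
      pose proof (Rabs_pos th). nra. }
    apply Rle_trans with (/ INR N * (/ INR N + 2 * INR N * Rabs th)).
    - apply Rmult_le_compat; try apply Rabs_pos; lra.
    - replace (/ INR N * (/ INR N + 2 * INR N * Rabs th)) with (/ INR N * / INR N + 2 * Rabs th) by (field; lra).
      assert (0 < / INR N) by (apply Rinv_0_lt_compat; lra). nra. }
  destruct (archimed (1 + 2 * Rabs th)) as [A1 _]. pose proof (Rabs_pos th).
  assert (0 <= up (1 + 2 * Rabs th))%Z by (apply le_IZR; lra).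
  unfold Kb. rewrite Z2Nat.id by auto. apply le_IZR. rewrite abs_IZR. lra.
Qed.

(** The existential stands outside the implication so that choice yields a successor function on all
    pairs. *)
Lemma next_small z : exists z', small_norm z -> small_norm z' /\ err z' < err z.
Proof.
  destruct (classic (small_norm z)) as [H|H].
  - destruct (small_norm_below (err z) (err_pos z H)) as [z' Hz']. exists z'; auto.
  - exists z. tauto.
Qed.

(** Pairs of bounded norm with strictly decreasing error form an infinite sequence, so two of them
    have the same norm k and agree modulo k. Their quotient in the quadratic field is integral of
    norm 1, and it is nontrivial because the errors differ. *)
Lemma pell : exists x y : Z, (x * x - D * (y * y) = 1)%Z /\ y <> 0%Z.
Proof.
  destruct (small_norm_below 1 Rlt_0_1) as [z0 [Hz0 _]].
  set (next := fun z => proj1_sig (constructive_indefinite_description _ (next_small z))).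
  assert (HN : forall z, small_norm z -> small_norm (next z) /\ err (next z) < err z).
  { intros z. apply (proj2_sig (constructive_indefinite_description _ (next_small z))). }
  clearbody next.
  set (sq := fun n => Nat.iter n next z0).
  assert (S1 : forall n, small_norm (sq n)) by (induction n as [|n IH]; [auto | apply HN; auto]).
  assert (S2 : forall i j, (i < j)%nat -> err (sq j) < err (sq i)).
  { intros i j Hij. induction Hij as [|j Hij IH].
    - apply HN; auto.
    - eapply Rlt_trans; [|exact IH]. apply HN; auto. }
  set (nm := fun z : Z * Z => (fst z * fst z - D * (snd z * snd z))%Z).
  assert (NZ : forall z, small_norm z -> nm z <> 0%Z).
  { intros z Hz E. pose proof (norm_th (fst z) (snd z)) as N. unfold nm in E. rewrite E in N.
    destruct Hz as [Hz _]. apply Rmult_integral in N. destruct N as [N|N].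
    - apply th_irr' in N. lia.
    - apply th_irr in N. lia. }
  (* Residues modulo a nonzero norm are smaller than that norm in modulus, so all keys lie in one
     finite box. *)
  set (key := fun n => (nm (sq n), ((fst (sq n) mod nm (sq n))%Z, (snd (sq n) mod nm (sq n))%Z))).
  destruct (pigeonhole_list key (list_prod (Z_interval Kb) (list_prod (Z_interval Kb) (Z_interval Kb)))) as [i [j [Hij E]]].
  - intros n. pose proof (S1 n) as Sn. pose proof (NZ _ Sn) as N0. destruct Sn as [_ Sn]. fold (nm (sq n)) in Sn.
    assert (MB : forall u, (Z.abs (u mod nm (sq n)) <= Z.of_nat Kb)%Z).
    { intros u. pose proof (Z.mod_bound_or u (nm (sq n)) N0). lia. }
    unfold key. apply in_prod_iff. split; [apply in_Z_interval; auto|]. apply in_prod_iff. split; apply in_Z_interval; auto.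
  - pose proof (S2 i j ltac:(lia)) as SE. pose proof (S1 i) as Si. pose proof (S1 j) as Sj.
    unfold key in E. injection E as E1 E2 E3.
    destruct (sq i) as [x1 y1]. destruct (sq j) as [x2 y2]. pose proof (NZ _ Si) as N0.
    unfold nm in *. cbn [fst snd] in *. rewrite <- E1 in E2, E3.
    set (k := (x1 * x1 - D * (y1 * y1))%Z) in *.
    destruct Si as [Y1 _]. destruct Sj as [Y2 _]. cbn [fst snd] in *.
    pose proof (Z.div_mod x1 k N0) as X1. pose proof (Z.div_mod x2 k N0) as X2.
    pose proof (Z.div_mod y1 k N0) as W1. pose proof (Z.div_mod y2 k N0) as W2.
    set (u := (x2 / k - x1 / k)%Z). set (v := (y2 / k - y1 / k)%Z).
    assert (Ex : x2 = (x1 + k * u)%Z) by (unfold u; lia).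
    assert (Ey : y2 = (y1 + k * v)%Z) by (unfold v; lia).
    (* X + Y th = (x2 + y2 th) / (x1 + y1 th), that is (x1 - y1 th)(x2 + y2 th) / k; the congruences
       modulo k make the division exact. *)
    set (X := (1 + x1 * u - D * (y1 * v))%Z). set (Y := (x1 * v - y1 * u)%Z).
    assert (HX : (k * X = x1 * x2 - D * (y1 * y2))%Z) by (unfold X; rewrite Ex, Ey; unfold k; ring).
    assert (HY : (k * Y = x1 * y2 - y1 * x2)%Z) by (unfold Y; rewrite Ex, Ey; ring).
    exists X, Y. split.
    + assert (E : (k * k * (X * X - D * (Y * Y)) = k * k)%Z).
      { replace (k * k * (X * X - D * (Y * Y)))%Z with ((k * X) * (k * X) - D * ((k * Y) * (k * Y)))%Z by ring.
        rewrite HX, HY. rewrite E1 at 2. unfold k. ring. }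
      apply Z.mul_reg_l with (k * k)%Z; [|rewrite E; ring].
      intros Z1. apply Z.mul_eq_0 in Z1. tauto.
    (* Y = 0 would make the two pairs proportional. Having equal norms and positive second entries
       they would coincide, against the strict decrease of the error. *)
    + intros HY0. rewrite HY0, Z.mul_0_r in HY.
      assert (E : (k * (y1 * y1) = k * (y2 * y2))%Z).
      { rewrite E1 at 1. unfold k.
        replace ((x2 * x2 - D * (y2 * y2)) * (y1 * y1))%Z with ((y1 * x2) * (y1 * x2) - D * (y1 * y1 * (y2 * y2)))%Z by ring.
        replace (y1 * x2)%Z with (x1 * y2)%Z by lia. ring. }
      apply Z.mul_reg_l in E; [|auto].
      assert (Ey' : y1 = y2) by (clear - E Y1 Y2; nia).
      rewrite <- Ey' in *. assert (Ex' : x1 = x2).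
      { apply Z.mul_reg_l with y1; lia. }
      rewrite Ex' in SE. lra.
Qed.

Lemma nontrivial_stab : exists A, stab al A /\ 1 < lam al A.
Proof.
  destruct pell as [x0 [y0 [N0 Hy0]]].
  assert (W : exists x y : Z, (x * x - D * (y * y) = 1)%Z /\ y <> 0%Z /\ 0 < IZR x + IZR y * th).
  { destruct (Rtotal_order (IZR x0 + IZR y0 * th) 0) as [L|[E|L]].
    - exists (- x0)%Z, (- y0)%Z. split; [lia|split; [lia|]]. rewrite !opp_IZR. lra.
    - apply th_irr in E. lia.
    - exists x0, y0. auto. }
  destruct W as [x [y [N [Hy L]]]].
  (* This is x I + y N, where N has rows (q, 2p) and (-2r, -q): trace 0, determinant -D, and
     eigenvector (1, al) with eigenvalue th. *)
  set (A := Mat (x + y * q) (2 * y * p) (- (2 * y * r)) (x - y * q)).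
  assert (EL : lam al A = IZR x + IZR y * th).
  { unfold lam, A, th; cbn [ma mb]. rewrite plus_IZR, !mult_IZR. ring. }
  assert (SA : stab al A).
  { split; [|split].
    - left. unfold mdet, A; cbn [ma mb mc md]. rewrite <- N. unfold D. ring.
    - rewrite EL; auto.
    - rewrite EL. unfold A, th; cbn [mc md]. rewrite opp_IZR, minus_IZR, !mult_IZR.
      replace (al * (IZR x + IZR y * (2 * IZR p * al + IZR q))) with
        (2 * IZR y * (IZR p * al ^ 2 + IZR q * al + IZR r) + (al * IZR x - al * IZR y * IZR q - 2 * IZR y * IZR r)) by ring.
      rewrite Hq. ring. }
  (* An eigenvalue below 1 is exchanged for its inverse; the value 1 would force y = 0. *)
  destruct (Rtotal_order (lam al A) 1) as [L1|[E|L1]].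
  - exists (mat_inv A). destruct (stab_inv al A SA) as [I1 I2]. split; auto. rewrite I2.
    rewrite <- Rinv_1. apply Rinv_lt_contravar; [|auto]. destruct SA as [_ [P _]]. lra.
  - exfalso. rewrite EL in E. destruct (th_irr (x - 1) y) as [_ Z0]; [rewrite minus_IZR; lra|]. auto.
  - exists A; auto.
Qed.

(** The eigenvalues have product 1 or -1, so the second has modulus at most 1. Their difference
    times p equals b th, which bounds b, and then a = lam - al b is bounded too. *)
Lemma stab_entries_bounded (Lm : R) : 1 < Lm -> exists K : nat, forall A, stab al A -> 1 < lam al A -> lam al A <= Lm ->
  (Z.abs (ma A) <= Z.of_nat K)%Z /\ (Z.abs (mb A) <= Z.of_nat K)%Z.
Proof.
  intros HL.
  assert (Hth : 0 < Rabs th).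
  { apply Rabs_pos_lt. intros E. destruct (th_irr 0 1) as [_ X]; [rewrite E; ring | lia]. }
  assert (Hp' : 0 < Rabs (IZR p)) by (apply Rabs_pos_lt, not_0_IZR; auto).
  set (Bb := (Lm + 1) * Rabs (IZR p) / Rabs th).
  assert (HBb : 0 <= Bb).
  { unfold Bb. left. apply Rdiv_lt_0_compat; auto. apply Rmult_lt_0_compat; lra. }
  set (Ba := Lm + Rabs al * Bb).
  assert (HBa : 0 <= Ba) by (unfold Ba; pose proof (Rabs_pos al); nra).
  destruct (archimed (Ba + Bb)) as [U _].
  assert (U0 : (0 <= up (Ba + Bb))%Z) by (apply le_IZR; lra).
  exists (Z.to_nat (up (Ba + Bb))). intros A SA L1 L2. rewrite Z2Nat.id by auto.
  pose proof (stab_relation al A SA) as E.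
  (* The quadratic relations coming from A and from (p, q, r) are combined so that al^2 drops out;
     irrationality makes both remaining coefficients vanish. *)
  assert (E1 : ((- p * mc A - mb A * r)%Z, (p * (ma A - md A) - mb A * q)%Z) = (0, 0)%Z).
  { apply (irrational_weight_0 al); auto. unfold weight; cbn [fst snd]. rewrite !minus_IZR, !mult_IZR, opp_IZR, minus_IZR.
    rewrite minus_IZR, opp_IZR in E.
    replace (- IZR p * IZR (mc A) - IZR (mb A) * IZR r + al * (IZR p * (IZR (ma A) - IZR (md A)) - IZR (mb A) * IZR q))
      with (IZR p * (IZR (mb A) * al ^ 2 + (IZR (ma A) - IZR (md A)) * al + - IZR (mc A)) - IZR (mb A) * (IZR p * al ^ 2 + IZR q * al + IZR r)) by ring.
    rewrite E, Hq. ring. }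
  injection E1 as _ E1. apply (f_equal IZR) in E1. rewrite !minus_IZR, !mult_IZR, minus_IZR in E1.
  pose proof (lam_conj al A SA) as LC.
  assert (CB : Rabs (IZR (md A) - al * IZR (mb A)) <= 1).
  { apply Rmult_le_reg_l with (lam al A); [lra|]. rewrite <- (Rabs_pos_eq (lam al A)) at 1 by lra.
    rewrite <- Rabs_mult, LC, Rmult_1_r. destruct SA as [[G|G] _]; rewrite G; unfold Rabs; destruct Rcase_abs; lra. }
  assert (EB : IZR (mb A) * th = IZR p * (lam al A - (IZR (md A) - al * IZR (mb A)))).
  { unfold th, lam. lra. }
  assert (BB : Rabs (IZR (mb A)) <= Bb).
  { apply Rmult_le_reg_r with (Rabs th); auto. rewrite <- Rabs_mult, EB, Rabs_mult.
    unfold Bb. replace ((Lm + 1) * Rabs (IZR p) / Rabs th * Rabs th) with (Rabs (IZR p) * (Lm + 1)) by (field; lra).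
    apply Rmult_le_compat_l; [lra|]. apply Rabs_le_between in CB. apply Rabs_le. lra. }
  assert (BA : Rabs (IZR (ma A)) <= Ba).
  { replace (IZR (ma A)) with (lam al A + - (al * IZR (mb A))) by (unfold lam; ring).
    eapply Rle_trans; [apply Rabs_triang|]. rewrite Rabs_Ropp, Rabs_mult, (Rabs_pos_eq (lam al A)) by lra.
    unfold Ba. pose proof (Rabs_pos al). nra. }
  split; apply le_IZR; rewrite abs_IZR; lra.
Qed.

(** The eigenvalue depends on the first row alone, so a minimum is taken over the finitely many
    first rows whose eigenvalue does not exceed that of one nontrivial element A0. *)
Lemma minimal_stab : exists A, stab al A /\ 1 < lam al A /\ forall B, stab al B -> 1 < lam al B -> lam al A <= lam al B.
Proof.
  destruct nontrivial_stab as [A0 [S0 L0]].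
  destruct (stab_entries_bounded (lam al A0) L0) as [K HK].
  set (P := fun z : Z * Z => exists c d, stab al (Mat (fst z) (snd z) c d) /\ 1 < lam al (Mat (fst z) (snd z) c d)).
  assert (IN : forall A, stab al A -> 1 < lam al A -> lam al A <= lam al A0 -> In (ma A, mb A) (box K) /\ P (ma A, mb A)).
  { intros A SA LA LA0. destruct (HK A SA LA LA0). split.
    - apply in_prod_iff. split; apply in_Z_interval; auto.
    - exists (mc A), (md A). destruct A; auto. }
  destruct (list_min (fun z => IZR (fst z) + al * IZR (snd z)) P (box K)) as [[a b] [_ [[c [d [S1 L1]]] M]]].
  - exists (ma A0, mb A0). apply IN; auto. lra.
  - exists (Mat a b c d). split; [auto|split; auto]. intros B SB LB.
    destruct (Rle_lt_dec (lam al B) (lam al A0)) as [Q|Q].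
    + destruct (IN B SB LB Q) as [I1 I2]. apply (M _ I1 I2).
    + destruct (IN A0 S0 L0 (Rle_refl _)) as [I1 I2]. specialize (M _ I1 I2).
      apply Rle_trans with (lam al A0); [exact M|lra].
Qed.

(** With k the integer part of the quotient of logarithms, B A^(-k) has its eigenvalue in [1, lam
    A). Minimality makes it 1, and then B = A^k because eigenvalues determine elements. *)
Lemma stab_generator : exists A, stab al A /\ 1 < lam al A /\ forall B, stab al B -> exists k, B = mpow A k.
Proof.
  destruct minimal_stab as [A [SA [LA MA]]]. exists A. split; [auto|split; auto].
  intros B SB. pose proof SB as [_ [LB _]].
  assert (HlnA : 0 < ln (lam al A)) by (rewrite <- ln_1; apply ln_increasing; lra).
  set (x := ln (lam al B) / ln (lam al A)).
  destruct (archimed x) as [A1 A2]. set (k := (up x - 1)%Z).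
  assert (Hk : IZR k <= x < IZR k + 1) by (unfold k; rewrite minus_IZR; lra).
  exists k. destruct (stab_mpow al A k SA) as [S1 S2]. destruct (stab_inv al _ S1) as [I1 I2].
  set (M := mmul B (mat_inv (mpow A k))).
  assert (SM : stab al M) by (apply stab_mmul; auto).
  assert (EM : lam al M = lam al B * / lam al (mpow A k)) by (unfold M; rewrite lam_mmul, I2; auto).
  assert (Pk : 0 < lam al (mpow A k)) by (destruct S1 as [_ [P _]]; auto).
  assert (lnk : ln (lam al (mpow A k)) = IZR k * ln (lam al A)).
  { rewrite S2, powerRZ_Rpower by lra. unfold Rpower. apply ln_exp. }
  assert (lnM : ln (lam al M) = ln (lam al B) - IZR k * ln (lam al A)).
  { rewrite EM, ln_mult, ln_Rinv, lnk by (auto; apply Rinv_0_lt_compat; auto). ring. }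
  assert (lnB : ln (lam al B) = x * ln (lam al A)) by (unfold x; field; lra).
  assert (LM : 0 < lam al M) by (destruct SM as [_ [P _]]; auto).
  assert (M1 : lam al M < lam al A).
  { apply ln_lt_inv; auto; [lra|]. rewrite lnM, lnB. nra. }
  assert (M2 : 1 <= lam al M).
  { destruct (Rle_lt_dec 1 (lam al M)) as [|L]; auto. exfalso.
    apply ln_increasing in L; auto. rewrite ln_1, lnM, lnB in L. nra. }
  assert (M3 : lam al M = 1).
  { destruct (Rle_lt_or_eq_dec _ _ M2) as [L|E]; auto. specialize (MA M SM L). lra. }
  apply (stab_lam_inj al); auto. rewrite M3 in EM.
  apply Rmult_eq_reg_r with (/ lam al (mpow A k)); [|apply Rinv_neq_0_compat; lra].
  rewrite <- EM, Rinv_r by lra. reflexivity.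
Qed.

End Quadratic.

(** * Affine automorphisms *)

(** Here the translation follows the matrix, whereas in [pi_c c (pi_mat A F)] it precedes it; the
    two are related by [psi A]. *)
Definition affine (A : mat) (d1 d2 : R) (F : fn) : fn :=
  fun s t => F (IZR (ma A) * s + IZR (mb A) * t + d1) (IZR (mc A) * s + IZR (md A) * t + d2).

Definition pair_add (x y : R * R) : R * R := (fst x + fst y, snd x + snd y).

Lemma psi_pair_add A x y : psi A (pair_add x y) = pair_add (psi A x) (psi A y).
Proof. unfold psi, pair_add; simpl. f_equal; ring. Qed.

Lemma pi_c_pi_mat c A F s t : pi_c c (pi_mat A F) s t =
  F (fst (psi A (pair_add (s, t) c))) (snd (psi A (pair_add (s, t) c))).
Proof. reflexivity. Qed.

Lemma pi_c_pi_mat_affine c A F : pi_c c (pi_mat A F) = affine A (fst (psi A c)) (snd (psi A c)) F.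
Proof. extensionality s. extensionality t. unfold pi_c, pi_mat, affine, psi; simpl. f_equal; ring. Qed.

(** Composition sends the frequency n to the row vector n A, whose weight is that of n times the
    positive eigenvalue, so analytic polynomials stay analytic. *)
Lemma Aalpha_affine al A d1 d2 F : stab al A -> Aalpha al F -> Aalpha al (affine A d1 d2 F).
Proof.
  intros SA HF. apply Aalpha_of_approx. intros eps He.
  destruct (Aalpha_approx al F HF eps He) as [p [Hp HN]].
  set (img := fun n : Z * Z => ((fst n * ma A + snd n * mc A)%Z, (fst n * mb A + snd n * md A)%Z)).
  exists (map (fun e => (Cmult (fst e) (expi (IZR (fst (snd e)) * d1 + IZR (snd (snd e)) * d2)), img (snd e))) p). split.
  - clear HN. destruct SA as [_ [LP E]].
    induction Hp as [|e p He' Hp IH]; constructor; auto. cbn [snd].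
    replace (weight al (img (snd e))) with (lam al A * weight al (snd e)); [apply Rmult_le_pos; lra|].
    unfold weight, img; cbn [fst snd]. rewrite !plus_IZR, !mult_IZR.
    replace (IZR (fst (snd e)) * IZR (ma A) + IZR (snd (snd e)) * IZR (mc A) + al * (IZR (fst (snd e)) * IZR (mb A) + IZR (snd (snd e)) * IZR (md A)))
      with (IZR (fst (snd e)) * lam al A + IZR (snd (snd e)) * (IZR (mc A) + al * IZR (md A))) by (unfold lam; ring).
    rewrite E. ring.
  - intros s t. match goal with |- Cmod (Cminus _ ?z) <= _ => replace z with
      (teval p (IZR (ma A) * s + IZR (mb A) * t + d1) (IZR (mc A) * s + IZR (md A) * t + d2)) end; [apply HN|].
    clear. unfold teval. induction p as [|e p IH]; [reflexivity|]. cbn [map peval fold_right fst snd]. unfold peval in IH. rewrite IH. f_equal.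
    assert (E : chi (snd e) (IZR (ma A) * s + IZR (mb A) * t + d1) (IZR (mc A) * s + IZR (md A) * t + d2) =
      Cmult (expi (IZR (fst (snd e)) * d1 + IZR (snd (snd e)) * d2)) (chi (img (snd e)) s t)).
    { unfold chi, img; cbn [fst snd]. rewrite <- expi_add, !plus_IZR, !mult_IZR. f_equal. ring. }
    rewrite E, Cmult_assoc. reflexivity.
Qed.

Lemma affine_inverse A d1 d2 G : inGL2Z A ->
  affine A d1 d2 (affine (mat_inv A) (fst (psi (mat_inv A) (- d1, - d2))) (snd (psi (mat_inv A) (- d1, - d2))) G) = G.
Proof.
  intros HA. extensionality s. extensionality t.
  rewrite <- pi_c_pi_mat_affine. unfold affine at 1. rewrite pi_c_pi_mat.
  replace (pair_add (IZR (ma A) * s + IZR (mb A) * t + d1, IZR (mc A) * s + IZR (md A) * t + d2) (- d1, - d2)) with (psi A (s, t)).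
  - rewrite <- psi_mmul, mmul_inv_l, psi_one by auto. reflexivity.
  - unfold psi, pair_add; simpl. f_equal; ring.
Qed.

Lemma affine_onto A d1 d2 s t : inGL2Z A ->
  exists x y, IZR (ma A) * x + IZR (mb A) * y + d1 = s /\ IZR (mc A) * x + IZR (md A) * y + d2 = t.
Proof.
  intros HA. destruct (psi (mat_inv A) (s - d1, t - d2)) as [x y] eqn:Ev. exists x, y.
  assert (E : psi A (x, y) = (s - d1, t - d2)) by (rewrite <- Ev, <- psi_mmul, mmul_inv_r, psi_one; auto).
  unfold psi in E; cbn [fst snd] in E. injection E as X1 X2. lra.
Qed.

Lemma affine_inj A d1 d2 F G : inGL2Z A -> affine A d1 d2 F = affine A d1 d2 G -> F = G.
Proof.
  intros HA E. extensionality s. extensionality t.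
  destruct (affine_onto A d1 d2 s t HA) as [x [y [X1 X2]]].
  apply (f_equal (fun f => f x y)) in E. unfold affine in E. rewrite X1, X2 in E. exact E.
Qed.

Lemma affine_isometric al A d1 d2 : stab al A -> isometric_aut al (affine A d1 d2).
Proof.
  intros SA. pose proof SA as [GA _]. destruct (stab_inv al A SA) as [SI _].
  split; [intros F HF; apply Aalpha_affine; auto|].
  split; [intros F G _ _ E|].
  { assert (E' : affine A d1 d2 F = affine A d1 d2 G) by (extensionality s; extensionality t; apply E).
    apply affine_inj in E'; auto. subst. intros s t; reflexivity. }
  split; [intros G HG|].
  { eexists. split; [apply (Aalpha_affine al (mat_inv A) (fst (psi (mat_inv A) (- d1, - d2))) (snd (psi (mat_inv A) (- d1, - d2))) G); auto|].
    rewrite affine_inverse by auto. intros s t; reflexivity. }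
  split; [intros F G _ _ s t; reflexivity|].
  split; [intros l F _ s t; reflexivity|].
  split; [intros F G _ _ s t; reflexivity|].
  intros F _ b. split; intros H s t; [apply H|].
  destruct (affine_onto A d1 d2 s t GA) as [x [y [X1 X2]]].
  specialize (H x y). unfold affine in H. rewrite X1, X2 in H. exact H.
Qed.

Lemma integer_slope (n : Z) (e : R) : (forall x, expi (IZR n * x + e) = expi e) -> n = 0%Z.
Proof.
  intros H. destruct (Z.eq_dec n 0) as [|NE]; auto. exfalso.
  assert (Hn : IZR n <> 0) by (apply not_0_IZR; auto).
  specialize (H (PI / IZR n)). replace (IZR n * (PI / IZR n) + e) with (e + PI) in H by (field; auto).
  rewrite expi_add in H. unfold expi in H. pose proof (sin2_cos2 e) as S. unfold Rsqr in S.
  injection H as H1 H2. rewrite cos_PI, sin_PI in *. nra.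
Qed.

(** The characters (1, 0) and (0, 1) are tested: their images determine the rows of the matrix
    exactly and the translation modulo 2 pi. *)
Lemma affine_faithful al A B x y : 0 < al -> 
  (forall F, Aalpha al F -> feq (affine A (fst x) (snd x) F) (affine B (fst y) (snd y) F)) ->
  A = B /\ angle_eq x y.
Proof.
  intros Hal H. destruct x as [x1 x2]. destruct y as [y1 y2]. cbn [fst snd] in H.
  assert (H1 : forall s t, expi (IZR (ma A) * s + IZR (mb A) * t + x1) = expi (IZR (ma B) * s + IZR (mb B) * t + y1)).
  { intros s t. pose proof (H (chi (1, 0)%Z) (chi_Aalpha al _ ltac:(rewrite weight_10; lra)) s t) as E.
    unfold affine, chi in E. cbn [fst snd] in E. rewrite !Rmult_1_l, !Rmult_0_l, !Rplus_0_r in E. exact E. }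
  assert (H2 : forall s t, expi (IZR (mc A) * s + IZR (md A) * t + x2) = expi (IZR (mc B) * s + IZR (md B) * t + y2)).
  { intros s t. pose proof (H (chi (0, 1)%Z) (chi_Aalpha al _ ltac:(rewrite weight_01; lra)) s t) as E.
    unfold affine, chi in E. cbn [fst snd] in E. rewrite !Rmult_1_l, !Rmult_0_l, !Rplus_0_l in E. exact E. }
  assert (SL : forall a b a' b' u v, (forall s t, expi (IZR a * s + IZR b * t + u) = expi (IZR a' * s + IZR b' * t + v)) ->
    a = a' /\ b = b' /\ exists k : Z, u - v = 2 * PI * IZR k).
  { intros a b a' b' u v E.
    assert (E0 : expi u = expi v).
    { specialize (E 0 0). rewrite !Rmult_0_r, !Rplus_0_l in E. exact E. }
    assert (CAN : forall z w, expi z = expi w -> expi (z - w) = RtoC 1).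
    { intros z w Ez. unfold Rminus. rewrite expi_add, Ez, <- expi_add, Rplus_opp_r. apply expi_0. }
    split; [|split].
    - enough (a - a' = 0)%Z by lia. apply (integer_slope _ (u - v)). intros s.
      rewrite (CAN u v E0). specialize (E s 0). rewrite !Rmult_0_r, !Rplus_0_r in E. apply CAN in E. rewrite <- E.
      f_equal. rewrite minus_IZR. ring.
    - enough (b - b' = 0)%Z by lia. apply (integer_slope _ (u - v)). intros t.
      rewrite (CAN u v E0). specialize (E 0 t). rewrite !Rmult_0_r, !Rplus_0_l in E. apply CAN in E. rewrite <- E.
      f_equal. rewrite minus_IZR. ring.
    - apply expi_eq; auto. }
  destruct (SL _ _ _ _ _ _ H1) as [A1 [A2 [k Hk]]]. destruct (SL _ _ _ _ _ _ H2) as [A3 [A4 [l Hl]]].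
  split; [apply mat_eq; auto|]. exists k, l. cbn [fst snd]. auto.
Qed.

(** The inverse matrix is integral, so it maps differences in 2 pi Z^2 to such differences. *)
Lemma angle_eq_psi A c d : inGL2Z A -> angle_eq (psi A c) (psi A d) -> angle_eq c d.
Proof.
  intros HA [k [l [Hk Hl]]].
  assert (E : forall z, psi (mat_inv A) (psi A z) = z) by (intros; rewrite <- psi_mmul, mmul_inv_l, psi_one; auto).
  set (M := mat_inv A) in *. clearbody M.
  destruct c as [c1 c2]. destruct d as [d1 d2].
  pose proof (E (c1, c2)) as Ec. pose proof (E (d1, d2)) as Ed.
  destruct (psi A (c1, c2)) as [u1 u2]. destruct (psi A (d1, d2)) as [v1 v2]. cbn [fst snd] in *.
  unfold psi in Ec, Ed. cbn [fst snd] in Ec, Ed. injection Ec as Ec1 Ec2. injection Ed as Ed1 Ed2.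
  exists (ma M * k + mb M * l)%Z, (mc M * k + md M * l)%Z. cbn [fst snd].
  rewrite <- Ec1, <- Ec2, <- Ed1, <- Ed2, !plus_IZR, !mult_IZR.
  replace u1 with (v1 + 2 * PI * IZR k) by lra. replace u2 with (v2 + 2 * PI * IZR l) by lra. split; ring.
Qed.

Lemma aut_stab al T : 0 < al -> irrational al -> isometric_aut al T ->
  exists A c, stab al A /\ forall F, Aalpha al F -> T F = pi_c c (pi_mat A F).
Proof.
  intros Hal Hi HT. destruct (aut_affine al Hal Hi T HT) as [A [d1 [d2 [GA [LA [EA HA]]]]]].
  (* The translation is performed before A, so it must be pulled back by the inverse of A. *)
  exists A, (psi (mat_inv A) (d1, d2)). split; [split; auto|].
  intros F HF. rewrite pi_c_pi_mat_affine, <- psi_mmul, mmul_inv_r, psi_one by auto.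
  extensionality s. extensionality t. apply HA; auto.
Qed.

Lemma pi_c_affine c F : pi_c c F = affine mone (fst c) (snd c) F.
Proof. extensionality s. extensionality t. unfold pi_c, affine, mone; simpl. f_equal; ring. Qed.

Theorem mainTheorem13 (alpha : R) (Hpos : 0 < alpha) (Hirr : irrational alpha) :
  (~ quadratic_irrational alpha ->
     (forall T, isometric_aut alpha T ->
        exists c, forall F, Aalpha alpha F -> feq (T F) (pi_c c F)) /\
     (forall c, isometric_aut alpha (pi_c c)) /\
     (forall c d, (forall F, Aalpha alpha F -> feq (pi_c c F) (pi_c d F)) ->
        angle_eq c d)) /\
  (quadratic_irrational alpha ->
     exists A : mat, inGL2Z A /\ A <> Mat 1 0 0 1 /\
       (forall T, isometric_aut alpha T ->
          exists c k, forall F, Aalpha alpha F -> feq (T F) (pi_c c (pi_pow A k F))) /\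
       (forall c k, isometric_aut alpha (fun F => pi_c c (pi_pow A k F))) /\
       (forall x y : (R * R) * Z,
          (forall F, Aalpha alpha F ->
             feq (pi_c (fst x) (pi_pow A (- snd x) F))
                 (pi_c (fst y) (pi_pow A (- snd y) F))) ->
          angle_eq (fst x) (fst y) /\ snd x = snd y) /\
       (forall (x y : (R * R) * Z) F, Aalpha alpha F ->
          feq (pi_c (fst x) (pi_pow A (- snd x) (pi_c (fst y) (pi_pow A (- snd y) F))))
              (pi_c (fst (sd_mul A x y)) (pi_pow A (- snd (sd_mul A x y)) F)))).
Proof.
  split.
  - intros Hq. split; [|split].
    + intros T HT. destruct (aut_stab alpha T Hpos Hirr HT) as [A [c [SA HA]]].
      apply stab_not_quadratic in SA; auto. subst A.
      exists c. intros F HF. rewrite (HA F HF), pi_c_pi_mat_affine, psi_one, <- pi_c_affine. intros s t; reflexivity.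
    + intros c. replace (pi_c c) with (affine mone (fst c) (snd c)) by (extensionality F; symmetry; apply pi_c_affine).
      apply affine_isometric, stab_one.
    + intros c d H. apply (affine_faithful alpha mone mone); auto.
      intros F HF. rewrite <- !pi_c_affine. auto.
  - intros [_ [p [q [r [Hp Hq]]]]].
    destruct (stab_generator alpha Hirr p q r Hp Hq) as [A [SA [LA GA]]].
    (* The eigenvalue of A exceeds 1, so the powers of A are told apart by the logarithms of their
       eigenvalues. *)
    assert (INJ : forall j k, mpow A j = mpow A k -> j = k).
    { intros j k E. apply (f_equal (fun M => ln (lam alpha M))) in E.
      assert (LN : forall i, ln (lam alpha (mpow A i)) = IZR i * ln (lam alpha A)).
      { intros i. rewrite (proj2 (stab_mpow alpha A i SA)), powerRZ_Rpower by lra. apply ln_exp. }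
      rewrite !LN in E. assert (0 < ln (lam alpha A)) by (rewrite <- ln_1; apply ln_increasing; lra).
      apply Rmult_eq_reg_r in E; [|lra]. apply eq_IZR; auto. }
    exists A. split; [apply SA|]. split; [|split; [|split; [|split]]].
    + intros E. assert (E' : A = mone) by exact E. rewrite E', lam_one in LA. lra.
    + intros T HT. destruct (aut_stab alpha T Hpos Hirr HT) as [B [c [SB HB]]].
      destruct (GA B SB) as [k ->]. exists c, k. intros F HF. rewrite (HB F HF), pi_pow_mpow. intros s t; reflexivity.
    + intros c k. replace (fun F => pi_c c (pi_pow A k F)) with (affine (mpow A k) (fst (psi (mpow A k) c)) (snd (psi (mpow A k) c))).
      * apply affine_isometric, stab_mpow; auto.
      * extensionality F. rewrite pi_pow_mpow, pi_c_pi_mat_affine. reflexivity.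
    + intros [c m] [d n] H. cbn [fst snd] in *.
      destruct (affine_faithful alpha (mpow A (- m)) (mpow A (- n)) (psi (mpow A (- m)) c) (psi (mpow A (- n)) d)) as [E1 E2]; auto.
      { intros F HF. rewrite <- !pi_c_pi_mat_affine, <- !pi_pow_mpow. auto. }
      apply INJ in E1. assert (m = n) by lia. subst n. split; auto.
      apply (angle_eq_psi (mpow A (- m))); auto. apply (stab_mpow alpha); auto.
    (* Moving a translation by d to the left past [pi_mat M] turns it into the translation by M^(-1)
       d. With M = A^(-m) this is psi_A^m(d), which is why (c, m) is represented with the exponent
       -m. *)
    + intros [c m] [d n] F HF s t. unfold sd_mul. cbn [fst snd].
      rewrite !pi_pow_mpow, psi_pow_mpow, !pi_c_pi_mat.
      replace (psi (mpow A (- n)) (pair_add (fst (psi (mpow A (- m)) (pair_add (s, t) c)), snd (psi (mpow A (- m)) (pair_add (s, t) c))) d))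
        with (psi (mpow A (- (m + n))) (pair_add (s, t) (fst c + fst (psi (mpow A m) d), snd c + snd (psi (mpow A m) d)))); [reflexivity|].
      rewrite <- surjective_pairing.
      change (fst c + fst (psi (mpow A m) d), snd c + snd (psi (mpow A m) d)) with (pair_add c (psi (mpow A m) d)).
      rewrite !psi_pair_add, <- !psi_mmul, !(mpow_add alpha) by auto.
      replace (- n + - m)%Z with (- (m + n))%Z by lia. replace (- (m + n) + m)%Z with (- n)%Z by lia.
      unfold pair_add; simpl. f_equal; ring.
Qed.
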